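(* Let $S=\{p=\exp(x,y,t)\in\mathbb{H}^1: t=f(x,y),\ (x,y)\in\mathbb{R}^2\}$ be a $T$-graph of class $\mathbf{C}^2$ over the $xy$-plane in the first Heisenberg group $\mathbb{H}^1$. If $|\mathcal{H}_H|\ge C>0$ for a constant $C$, then $$C\,\mathcal{H}^2_{Eu}(\mathcal{P}_{xy}(\mathcal{U}))\le\mathcal{H}^1_{Eu}(\mathcal{P}_{xy}(\partial\mathcal{U}))$$ for every $\mathbf{C}^1$-smooth relatively compact open set $\mathcal{U}\subset S$. Hence, taking $\mathcal{U}:=S\cap C_r(\mathcal{T})$, where $C_r(\mathcal{T})$ denotes a vertical cylinder of radius $r$ around the $T$-axis $\mathcal{T}:=\{p=\exp(0,0,t)\in\mathbb{H}^1: t\in\mathbb{R}\}$, yields $$r\le\frac{2}{C}$$ for every $r>0$.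
   Context: $\mathbb{H}^1$ is the first Heisenberg group: $\mathbb{R}^3$ with exponential coordinates $p=\exp(x,y,t)$ and left-invariant frame $X=\frac{\partial}{\partial x}-\frac y2\frac{\partial}{\partial t}$, $Y=\frac{\partial}{\partial y}+\frac x2\frac{\partial}{\partial t}$, $T=\frac{\partial}{\partial t}$, which is declared orthonormal for the left-invariant Riemannian metric $\langle\cdot,\cdot\rangle$. $H=\mathrm{span}\{X,Y\}$ is the horizontal bundle, $\mathcal{P}_H$ the orthogonal projection onto $H$, $\nabla$ the Levi-Civita connection and $\nabla^H_ZW:=\mathcal{P}_H(\nabla_ZW)$ for horizontal $Z,W$ (so $X,Y$ are $\nabla^H$-parallel in horizontal directions). For a surface $S$ of class $\mathbf{C}^2$ with Riemannian unit normal $\nu$, $C_S:=\{p\in S:\mathcal{P}_H\nu(p)=0\}$ is the characteristic set; on $S\setminus C_S$, $\nu_H:=\mathcal{P}_H\nu/|\mathcal{P}_H\nu|$, and the horizontal mean curvature is $\mathcal{H}_H:=-\mathrm{div}_H\nu_H$, i.e. the trace over $HS:=H\cap TS$ of $B_H(Z,W):=\langle\nabla^H_ZW,\nu_H\rangle$. The condition $|\mathcal{H}_H|\ge C$ refers to points where $\mathcal{H}_H$ is defined. $\mathcal{P}_{xy}$ is the orthogonal projection $\exp(x,y,t)\mapsto(x,y)$ onto the $xy$-plane, $\mathcal{H}^i_{Eu}$ the Euclidean $i$-dimensional Hausdorff measure, and $C_r(\mathcal{T})=\{\exp(x,y,t): x^2+y^2<r^2\}$. A $\mathbf{C}^1$-smooth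 open set is one with $\mathbf{C}^1$ boundary. *)

(* Defs.v *)
(* MathComp-Analysis, over an arbitrary R : realType. *)
From mathcomp Require Import all_boot all_order all_algebra.
From mathcomp Require Import all_classical all_reals all_analysis.
From mathcomp Require Import ring lra.

Set Implicit Arguments.
Unset Strict Implicit.
Unset Printing Implicit Defensive.

Import Order.TTheory GRing.Theory Num.Theory numFieldNormedType.Exports.

Local Open Scope classical_set_scope.
Local Open Scope ring_scope.

Section Vectors.
Variables (R : realType) (n : nat).
Implicit Types v w : 'rV[R]_n.

Definition dotp v w : R := \sum_(i < n) v 0 i * w 0 i.

(* The library norm on 'rV[R]_n is the sup norm; it induces the same topology
   but not the Euclidean metric. *)
Definition norm2 v : R := Num.sqrt (dotp v v).

End Vectors.

Section Hausdorff.
Variables (R : realType) (n : nat).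
Implicit Types A : set 'rV[R]_n.
Local Open Scope ereal_scope.

Definition eucl_diam A : \bar R :=
  ereal_sup [set (norm2 (z.1 - z.2)%R)%:E | z in A `*` A].

(* Volume of the unit ball of R^i. *)
Fixpoint unit_ball_volume (i : nat) : R :=
  match i with
  | 0%N => 1%R
  | 1%N => 2%:R%R
  | j.+2 => (2%:R * pi / j.+2%:R * unit_ball_volume j)%R
  end.

(* The empty set is singled out because [eucl_diam set0 = -oo]. *)
Definition hausdorff_weight (i : nat) A : \bar R :=
  if A == set0 then 0
  else (unit_ball_volume i / 2%:R ^+ i)%R%:E * eucl_diam A ^+ i.

Definition hausdorff_content (i : nat) (delta : R) A : \bar R :=
  ereal_inf [set \sum_(0 <= k <oo) hausdorff_weight i (F k) | F in
    [set F : (set 'rV[R]_n)^nat |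
      A `<=` \bigcup_k F k /\ forall k, eucl_diam (F k) <= delta%:E]].

(* Normalized so that it agrees with Lebesgue measure when i = n. *)
Definition hausdorff (i : nat) A : \bar R :=
  ereal_sup [set hausdorff_content i delta A | delta in [set d : R | (0 < d)%R]].

End Hausdorff.

Section Regularity.
Variables (R : realType) (n : nat).

Definition partial (i : 'I_n) (g : 'rV[R]_n -> R) : 'rV[R]_n -> R :=
  fun x => 'D_(delta_mx 0 i) g x.

(* [class_C k V g]: g is of class C^k on the open set V. *)
Fixpoint class_C (k : nat) (V : set 'rV[R]_n) (g : 'rV[R]_n -> R) : Prop :=
  (forall x, V x -> {for x, continuous g}) /\
  match k with
  | 0%N => True
  | k'.+1 => forall i : 'I_n,
      (forall x, V x -> derivable g x (delta_mx 0 i)) /\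
      class_C k' V (partial i g)
  end.

End Regularity.

Section Heisenberg.
Variable R : realType.

(* exp(x, y, t), as a point of R^3. *)
Notation point := 'rV[R]_3.
(* Tangent vectors are given by their components in the frame (X, Y, T),
   so [dotp] is the left-invariant Riemannian metric; indices 0, 1, 2 of 'I_3
   stand for X, Y, T. *)
Notation tvector := 'rV[R]_3.
Notation vfield := (point -> tvector).

Definition vec3 (a b c : R) : 'rV[R]_3 := \row_(i < 3) [:: a; b; c]`_i.

(* Cartesian components of X, Y and T at p. *)
Definition frame (i : 'I_3) (p : point) : 'rV[R]_3 :=
  tnth [tuple vec3 1 0 (- (p 0 1 / 2%:R));
              vec3 0 1 (p 0 0 / 2%:R);
              vec3 0 0 1] i.

Definition frame_der (i : 'I_3) (phi : point -> R) : point -> R :=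
  fun p => 'D_(frame i p) phi p.

(* [E_i, E_j] = \sum_k (struct_cst i j k) E_k; only [X, Y] = - [Y, X] = T is
   nonzero. *)
Definition struct_cst (i j k : 'I_3) : R :=
  ((i == 0) && (j == 1) && (k == 2%:R))%:R
  - ((i == 1) && (j == 0) && (k == 2%:R))%:R.

Lemma lie_bracket_frame i j p :
  'D_(frame i p) (frame j) p - 'D_(frame j p) (frame i) p =
  \sum_(k < 3) struct_cst i j k *: frame k p.
Proof.
have DE (f : point -> 'rV[R]_3) (v w q : 'rV[R]_3) :
    (forall h : R, f (h *: v + q) - f q = h *: w) -> 'D_v f q = w.
  move=> fE; apply: cvg_lim => //.
  apply: cvg_near_cst.
  near=> h; rewrite fE scalerA mulVf ?scale1r//.
  by near: h; exact: nbhs_dnbhs_neq.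
have dframe (k : 'I_3) v q : 'D_v (frame k) q =
    vec3 0 0 (((k == 1)%:R * v 0 0 - (k == 0)%:R * v 0 1) / 2%:R).
  apply: DE => h; case: k => -[|[|[|//]]] klt; apply/rowP => l;
  rewrite /frame /tnth /= !mxE; case: l => -[|[|[|//]]] llt /=; by rewrite /=; field.
rewrite !dframe; apply/rowP => l; rewrite !mxE summxE !big_ord_recl big_ord0.
case: i => -[|[|[|//]]] ilt; case: j => -[|[|[|//]]] jlt;
case: l => -[|[|[|//]]] llt; rewrite /frame /tnth /struct_cst /= !mxE /=; by field.
Unshelve. all: by end_near.
Qed.

(* <nabla_{E_i} E_j, E_k>, from the Koszul formula for a left-invariant
   orthonormal frame. *)
Definition christoffel (i j k : 'I_3) : R :=
  (struct_cst i j k - struct_cst j k i + struct_cst k i j) / 2%:R.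

Lemma struct_cst_skew i j k : struct_cst i j k = - struct_cst j i k.
Proof.
by rewrite /struct_cst opprB (andbC (i == 0)) (andbC (i == 1)).
Qed.

Lemma christoffel_torsion_free i j k :
  christoffel i j k - christoffel j i k = struct_cst i j k.
Proof.
rewrite /christoffel (struct_cst_skew j i k) (struct_cst_skew i k j).
by rewrite (struct_cst_skew k j i); field.
Qed.

Lemma christoffel_metric i j k : christoffel i j k = - christoffel i k j.
Proof.
rewrite /christoffel (struct_cst_skew i k j) (struct_cst_skew k j i).
by rewrite (struct_cst_skew j i k); field.
Qed.

(* Levi-Civita connection, in frame components. *)
Definition nabla (Z W : vfield) : vfield := fun p =>
  \row_(k < 3) (\sum_(i < 3) Z p 0 i * frame_der i (fun q => W q 0 k) p
    + \sum_(i < 3) \sum_(j < 3) Z p 0 i * W p 0 j * christoffel i j k).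

Definition projH (v : tvector) : tvector :=
  \row_(i < 3) (if i == 2%:R then 0 else v 0 i).

Definition nablaH (Z W : vfield) : vfield := fun p => projH (nabla Z W p).

Definition frame_field (i : 'I_3) : vfield := fun=> delta_mx 0 i.

(* Trace over H of Z |-> nablaH Z W. *)
Definition divH (W : vfield) : point -> R := fun p =>
  \sum_(i < 3 | i != 2%:R) dotp (nablaH (frame_field i) W p) (frame_field i p).

Lemma divHE (W : vfield) p :
  divH W p = frame_der 0 (fun q => W q 0 0) p + frame_der 1 (fun q => W q 0 1) p.
Proof.
rewrite /divH big_mkcond !big_ord_recl big_ord0 /= !addr0.
rewrite /dotp !big_ord_recl !big_ord0 /nablaH /frame_field !mxE /=.
rewrite !big_ord_recl !big_ord0 !mxE /christoffel /struct_cst /=.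
have -> : lift ord0 ord0 = 1 :> 'I_3 by exact/val_inj.
have -> : ord0 = 0 :> 'I_3 by [].
by field.
Qed.

Definition grad (u : point -> R) : vfield := fun p => \row_(i < 3) frame_der i u p.

(* Riemannian unit normal to the level sets of u. *)
Definition unit_normal (u : point -> R) : vfield := fun p =>
  (norm2 (grad u p))^-1 *: grad u p.

Definition normalH (u : point -> R) : vfield := fun p =>
  (norm2 (projH (unit_normal u p)))^-1 *: projH (unit_normal u p).

(* Horizontal mean curvature of the level set of u through p.  [normalH u] is
   a unit horizontal field near every p where [projH (unit_normal u p)] is
   nonzero, so nablaH_Z (normalH u) is orthogonal to [normalH u]: the trace
   [divH] only involves derivatives tangent to the level set, and the value
   depends on the surface alone (up to its orientation). *)
Definition mean_curvatureH (u : point -> R) : point -> R :=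
  fun p => - divH (normalH u) p.

Definition proj_xy (p : point) : 'rV[R]_2 := \row_(i < 2) [:: p 0 0; p 0 1]`_i.

Definition vertical_cylinder (r : R) : set point :=
  [set p : point | p 0 0 ^+ 2 + p 0 1 ^+ 2 < r ^+ 2].

Section TGraph.
Variable f : 'rV[R]_2 -> R.

(* The T-graph of f is the zero set of [graph_fun]. *)
Definition graph_fun : point -> R := fun p => p 0 2%:R - f (proj_xy p).

Definition tgraph : set point := [set p : point | p 0 2%:R = f (proj_xy p)].

Definition charset : set point :=
  [set p : point | tgraph p /\ projH (unit_normal graph_fun p) = 0].

(* Openness, closure and boundary are relative to the surface S. *)
Definition rel_open (S U : set point) := exists2 O, open O & U = S `&` O.

Definition rel_closure (S U : set point) : set point := S `&` closure U.

Definition rel_boundary (S U : set point) : set point :=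
  rel_closure S U `&` rel_closure S (S `\` U).

(* C^1 boundary, read in the global chart [proj_xy] of the T-graph: near each
   boundary point, U is the sublevel set of a C^1 function without critical
   points. *)
Definition C1_boundary (U : set point) :=
  forall p : point, rel_boundary tgraph U p ->
  exists V : set 'rV[R]_2, exists g : 'rV[R]_2 -> R,
  [/\ open V, V (proj_xy p), class_C 1 V g,
      forall x, V x -> exists i, partial i g x != 0 &
      forall q, tgraph q -> V (proj_xy q) -> (U q <-> g (proj_xy q) < 0)].

Definition C1_relcompact_open (U : set point) :=
  [/\ rel_open tgraph U, compact (rel_closure tgraph U) & C1_boundary U].

End TGraph.

End Heisenberg.

(* Main.v *)
Require Import Defs.
From mathcomp Require Import all_boot all_order all_algebra.
From mathcomp Require Import all_classical all_reals all_analysis.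
From mathcomp Require Import ring lra.

(* No C^2 function on the whole plane satisfies the curvature hypothesis, so that
   both conclusions hold vacuously.

   The plane field E = (x/2 - f_y, y/2 + f_x) has divergence 1, and the mean
   curvature of the graph at a non-characteristic point is that of the integral
   curve of E: with N = E x (DE E) (a cross product), it is N / |E|^3.  The
   hypothesis thus reads C |E|^3 <= |N|; in particular N vanishes only where E
   does.

   Suppose N > 0 at some point and follow E from there.  As long as E does not
   vanish, neither does N, so the velocity turns counterclockwise; with the angle
   s of the velocity as parameter, the trajectory c satisfies
   c' = rho (cos s, sin s) with 0 < rho <= 1/C, and f along c has the derivative
   (c x c') / 2, since c lifts to a horizontal curve of the graph.  Hence c has no
   loop of total turning at most 2 pi: f would increase by the area of the loop.
   It follows that the sign of the position of c(s) relative to the tangent line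
   at c(s + 2 pi) changes at most once, so that c first spirals outwards and then
   inwards; this confines it to a disc of radius of order 1/C.

   The zeros of E repel the trajectory.  Let A be the derivative of E at a zero,
   which has trace 1.  If det A >= 1/4, a quadratic Lyapunov function increases
   along the flow.  If det A < 1/4, then A has real eigenvalues, the zero cannot be
   isolated because N would change sign without vanishing, and the set of zeros
   is a curve transverse to which E expands.

   So |E| is bounded below along the trajectory, hence rho is too, and the total
   turning is infinite.  Each turn of a spiral then sweeps an area bounded below,
   which contradicts the boundedness of f on a disc.  The case N < 0 reduces to
   this one by replacing f(x, y) by - f(x, - y), and N = 0 everywhere would give
   E = 0, of divergence 0. *)

Set Implicit Arguments.
Unset Strict Implicit.
Unset Printing Implicit Defensive.

Import Order.TTheory GRing.Theory Num.Theory numFieldNormedType.Exports.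

Local Open Scope classical_set_scope.
Local Open Scope ring_scope.

(** * Functions of one real variable *)

(** The second conclusion fails as soon as r > 2 / C, so the hypotheses have to be refuted in any
    case. Doing so through the first conclusion would mean integrating the divergence of [normalH]
    over a domain; the characteristic set obstructs this, since a priori it may contain curves and
    separate regions on which the curvature has opposite signs. Following one integral curve avoids
    both difficulties: it never meets a zero of E, and each sign of N is excluded from a single
    starting point, so that no constancy of sign is needed.

    With the angle as parameter, rho = |E|^3 / N is the radius of curvature, and the hypothesis says
    exactly that rho <= 1/C where N > 0. Every comparison with a tangent line then reduces to the
    sign of the sine of an angle difference. Confinement uses only the upper bound of rho; the areas
    need a lower bound, which comes from compactness and so is available only after confinement.

    The threshold det A = 1/4 is where the discriminant 1 - 4 det A of a matrix of trace 1 changes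
    sign. *)

Definition hidden (P : Prop) : Prop := P.

Ltac hide_hyps := repeat match goal with
  | H : is_true ?b |- _ => change (hidden (is_true b)) in H
  | H : ?a = ?b |- _ => change (hidden (a = b)) in H
  end.

Ltac unhide_hyps n := match n with
  | O => idtac
  | S ?m => try (match goal with H : hidden ?P |- _ => change P in H end; unhide_hyps m)
  end.

(* The running time of lra is dominated by the size of the context, and the
   hypotheses that it needs are usually among the latest ones. *)
Ltac qlra := first
  [ solve [intros; hide_hyps; unhide_hyps 5%nat; lra]
  | solve [intros; hide_hyps; unhide_hyps 12%nat; lra]
  | lra ].

Section Calculus.
Variable R : realType.
Implicit Types (f g : R -> R) (x a b c d : R).

(* [has_der] is not a class, which prevents instance resolution from choosing
   the shape of the derivative. *)
Definition has_der f x d := is_derive x 1 f d.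

Lemma der_cst c x : has_der (fun _ => c) x 0.
Proof. exact: is_derive_cst. Qed.

Lemma der_id x : has_der (fun t => t) x 1.
Proof. exact: is_derive_id. Qed.

Lemma derD f g x a b : has_der f x a -> has_der g x b ->
  has_der (fun t => f t + g t) x (a + b).
Proof. by rewrite /has_der => fa gb; exact: is_deriveD. Qed.

Lemma derN f x a : has_der f x a -> has_der (fun t => - f t) x (- a).
Proof. by rewrite /has_der => fa; exact: is_deriveN. Qed.

Lemma derM f g x a b : has_der f x a -> has_der g x b ->
  has_der (fun t => f t * g t) x (a * g x + f x * b).
Proof.
rewrite /has_der => fa gb; apply: is_derive_eq.
by rewrite /GRing.scale /=; ring.
Qed.

Lemma derX f (n : nat) x a : has_der f x a ->
  has_der (fun t => f t ^+ n.+1) x (n.+1%:R * f x ^+ n * a).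
Proof.
move=> fa; have -> : (fun t => f t ^+ n.+1) = f ^+ n.+1 by rewrite exprfctE.
apply: (is_derive_eq (is_deriveX n.+1 fa)).
by rewrite /GRing.scale /=; ring.
Qed.

Lemma derV f x a : f x != 0 -> has_der f x a ->
  has_der (fun t => (f t)^-1) x (- a / f x ^+ 2).
Proof.
move=> fx0 fa; apply: (is_derive_eq (is_deriveV fx0 fa)).
by rewrite /GRing.scale /=; field.
Qed.

Lemma der_comp f g x a b : has_der f (g x) a -> has_der g x b ->
  has_der (fun t => f (g t)) x (a * b).
Proof.
by rewrite /has_der => fa gb; exact: is_derive1_comp.
Qed.

Lemma der_cos g x b : has_der g x b ->
  has_der (fun t => cos (g t)) x (- sin (g x) * b).
Proof. by move=> gb; apply: der_comp gb; exact: is_derive_cos. Qed.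

Lemma der_sin g x b : has_der g x b ->
  has_der (fun t => sin (g t)) x (cos (g x) * b).
Proof. by move=> gb; apply: der_comp gb; exact: is_derive_sin. Qed.

Lemma der_expR g x b : has_der g x b ->
  has_der (fun t => expR (g t)) x (expR (g x) * b).
Proof. by move=> gb; apply: der_comp gb; exact: is_derive_expR. Qed.

Lemma der_cont f x a : has_der f x a -> {for x, continuous f}.
Proof. by rewrite /has_der => fa; exact/differentiable_continuous/derivable1_diffP. Qed.

Lemma der_eq f x d d' : has_der f x d' -> d' = d -> has_der f x d.
Proof. by move=> fd <-. Qed.

End Calculus.

Ltac der1 := first
  [ eassumption
  | apply: der_cst | apply: der_id
  | apply: derD | apply: derN
  | apply: derX
  | apply: derM
  | apply: der_cos | apply: der_sin | apply: der_expR ].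
Ltac der := apply: der_eq; [by repeat der1 | cbv beta].

(** * Monotonicity, intermediate values and sign changes *)

Section Monotone.
Variable R : realType.
Implicit Types (f g dg : R -> R) (x a b c d : R).

Lemma cont_within g a b :
  (forall x, a <= x <= b -> {for x, continuous g}) ->
  {within `[a, b], continuous g}.
Proof.
move=> gc; apply: continuous_in_subspaceT => x; rewrite inE /= in_itv /=.
exact: gc.
Qed.

Lemma der_mvt g dg a b : a <= b ->
  (forall x, a <= x <= b -> has_der g x (dg x)) ->
  exists2 c, a <= c <= b & g b - g a = dg c * (b - a).
Proof.
move=> ab gd; have [|x xab|c] := @MVT_segment R g dg a b ab.
- by move=> x; rewrite in_itv /= => /andP[/ltW ax /ltW xb]; apply: gd; rewrite ax.
- by apply: cont_within x xab => x xab; exact: (der_cont (gd _ xab)).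
- by rewrite in_itv /= => cab e; exists c.
Qed.

Lemma der_ge0_le g dg a b : a <= b ->
  (forall x, a <= x <= b -> has_der g x (dg x)) ->
  (forall x, a <= x <= b -> 0 <= dg x) -> g a <= g b.
Proof.
move=> ab gd dg0; have [c cab e] := der_mvt ab gd.
by rewrite -subr_ge0 e mulr_ge0 ?dg0// subr_ge0.
Qed.

Lemma der_gt0_lt g dg a b : a < b ->
  (forall x, a <= x <= b -> has_der g x (dg x)) ->
  (forall x, a < x < b -> 0 < dg x) -> g a < g b.
Proof.
move=> ab gd dg0; have [|x xab|c] := @MVT R g dg a b ab.
- by move=> x; rewrite in_itv /= => /andP[/ltW ax /ltW xb]; apply: gd; rewrite ax.
- by apply: cont_within x xab => x xab; exact: (der_cont (gd _ xab)).
- rewrite in_itv /= => cab e.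
  by rewrite -subr_gt0 e mulr_gt0 ?dg0// subr_gt0.
Qed.

Lemma der_eq0_cst g a b : a <= b ->
  (forall x, a <= x <= b -> has_der g x 0) -> g a = g b.
Proof.
move=> ab gd; have [c cab e] := @der_mvt g (fun=> 0) a b ab gd.
by apply/esym/eqP; rewrite -subr_eq0 e mul0r.
Qed.

Lemma ivt_zero g a b : a <= b ->
  (forall x, a <= x <= b -> {for x, continuous g}) ->
  g a * g b <= 0 -> exists2 c, a <= c <= b & g c = 0.
Proof.
move=> ab gc gab; have [|c] := @IVT R g a b 0 ab (cont_within gc).
  rewrite ge_min le_max; case: (ltP 0 (g a)) => ga; case: (ltP (g b) 0) => gb.
  - by rewrite (ltW gb) (ltW ga) orbT.
  - have gb' : g b <= 0 by rewrite -(pmulr_rle0 _ ga).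
    by rewrite gb' (ltW ga) orbT.
  - have ga' : 0 <= g a by rewrite -(nmulr_lle0 _ gb).
    by rewrite ga' (ltW gb) orbT.
  - by rewrite ?ga ?gb ?orbT.
by rewrite in_itv /= => cab e; exists c.
Qed.

Lemma cont_eps g x e : {for x, continuous g} -> 0 < e ->
  exists2 d, 0 < d & forall y, `|y - x| < d -> `|g y - g x| < e.
Proof.
move=> gc e0; move/cvgrPdist_lt/(_ e e0): gc => /nbhs_ballP[d /= d0 H].
exists d => // y yx; rewrite distrC; apply: H.
by rewrite /ball /= distrC.
Qed.

(** The infimum of the points where [g <= 0]: by continuity [g] can be neither positive nor negative
    there. *)
Lemma first_zero g a b : a <= b ->
  (forall x, a <= x <= b -> {for x, continuous g}) ->
  0 < g a -> g b <= 0 ->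
  exists s, [/\ a < s <= b, g s = 0 & forall x, a <= x < s -> 0 < g x].
Proof.
move=> ab gc ga gb; pose S := [set x | a <= x <= b /\ g x <= 0].
have Sb : S b by rewrite /S /= lexx ab.
have lbS : lbound S a by move=> x [/andP[]].
have Si : has_inf S by split; [exists b | exists a].
pose s := inf S.
have as_ : a <= s by apply: lb_le_inf; [exists b|].
have sb : s <= b by apply: ge_inf => //; exists a.
have pos x : a <= x < s -> 0 < g x.
  move=> /andP[ax xs]; rewrite ltNge; apply/negP => gx.
  suff : s <= x by rewrite leNgt xs.
  apply: ge_inf; first by exists a.
  by split => //; rewrite ax (le_trans (ltW xs) sb).
have sab : a <= s <= b by rewrite as_ sb.
have gs0 : g s <= 0.
  rewrite leNgt; apply/negP => gs.
  have [d d0 H] := cont_eps (gc _ sab) gs.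
  have [x Sx xs] := inf_adherent d0 Si.
  have gx := Sx.2; have sx : s <= x by apply: ge_inf Sx; exists a.
  have := H x; rewrite ger0_norm ?subr_ge0// ltrBlDl => /(_ xs).
  rewrite ltr_norml => /andP[]; qlra.
have as' : a < s by rewrite lt_neqAle as_ andbT; apply/eqP => e; move: ga; rewrite e ltNge gs0.
exists s; split => //; first by rewrite as'.
apply/eqP; rewrite eq_le gs0 /= leNgt; apply/negP => gs.
have ngs : 0 < - g s by rewrite oppr_gt0.
have [d d0 H] := cont_eps (gc _ sab) ngs.
pose x := Num.max a (s - d / 2).
have xs : x < s by rewrite /x gt_max as' /=; qlra.
have ax : a <= x by rewrite /x le_max lexx.
have := H x; rewrite ltr0_norm ?subr_lt0// => /(_ _)/wrap[].
  have : s - d / 2 <= x by rewrite /x le_max lexx orbT.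
  qlra.
rewrite ltr_norml => /andP[_]; have := pos x; rewrite ax xs => /(_ isT); qlra.
Qed.

Lemma der_pos_local g x d : has_der g x d -> 0 < d ->
  exists2 e, 0 < e & forall h, 0 < h < e -> g x < g (x + h) /\ g (x - h) < g x.
Proof.
move=> gd d0.
have [h [hE hc hx]] := (is_derive1_caratheodory g x d).1 gd.
have hx0 : 0 < h x by rewrite hx.
have [e e0 H] := cont_eps hc hx0.
exists e => // k /andP[k0 ke].
have p y : `|y - x| < e -> 0 < h y.
  by move=> /H; rewrite ltr_norml => /andP[]; qlra.
split.
  rewrite -subr_gt0 hE addrAC subrr add0r mulr_gt0//; apply: p.
  by rewrite addrAC subrr add0r gtr0_norm.
rewrite -subr_lt0 hE addrAC subrr add0r mulrN oppr_lt0 mulr_gt0//; apply: p.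
by rewrite addrAC subrr add0r normrN gtr0_norm.
Qed.

(** Zeros are only crossed upwards: [g] is positive just after [a], and a first return to zero would
    have to be reached from above. Applied to [gap], this yields the single change of sign. *)
Lemma pos_after_upcrossing g dg a b : a < b ->
  (forall x, a <= x <= b -> has_der g x (dg x)) ->
  (forall x, a <= x <= b -> g x = 0 -> 0 < dg x) ->
  0 <= g a -> 0 < g b.
Proof.
move=> ab gd up ga; rewrite ltNge; apply/negP => gb.
have aab : a <= a <= b by rewrite lexx ltW.
have [c /andP[ac cb] gc] : exists2 c, a <= c < b & 0 < g c.
  move: ga; rewrite le_eqVlt => /predU1P[/esym ga|ga]; last by exists a => //; rewrite lexx.
  have [e e0 H] := der_pos_local (gd _ aab) (up _ aab ga).
  pose h := Num.min (e / 2) ((b - a) / 2).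
  have h0 : 0 < h by rewrite /h lt_min; apply/andP; split; qlra.
  have he : h <= e / 2 by rewrite /h ge_min lexx.
  have hb : h <= (b - a) / 2 by rewrite /h ge_min lexx orbT.
  exists (a + h); first by apply/andP; split; qlra.
  by rewrite -ga; apply: (H h _).1; rewrite h0 /=; qlra.
have cont x : c <= x <= b -> {for x, continuous g}.
  by move=> /andP[cx xb]; apply: der_cont (gd x _); rewrite xb (le_trans ac).
have [s [/andP[cs sb] gs pos]] := first_zero (ltW cb) cont gc gb.
have sab : a <= s <= b by rewrite sb (le_trans ac (ltW cs)).
have [e e0 H] := der_pos_local (gd _ sab) (up _ sab gs).
pose h := Num.min (e / 2) (s - c).
have h0 : 0 < h by rewrite /h lt_min; apply/andP; split; qlra.
have he : h <= e / 2 by rewrite /h ge_min lexx.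
have hc : h <= s - c by rewrite /h ge_min lexx orbT.
have h1 : 0 < h < e by rewrite h0 /=; qlra.
have := (H h h1).2; rewrite gs; apply/negP; rewrite -leNgt; apply/ltW/pos.
by apply/andP; split; qlra.
Qed.

(** After a last instant at level [l], [g] would stay below [l], hence be nondecreasing.
    Monotonicity is required only below [l] because a Lyapunov function is controlled only near a
    zero of the field. *)
Lemma barrier g l b : 0 <= b ->
  (forall x, 0 <= x <= b -> {for x, continuous g}) ->
  (forall s t, 0 <= s -> s <= t -> t <= b ->
    (forall u, s <= u <= t -> g u <= l) -> g s <= g t) ->
  l <= g 0 -> l <= g b.
Proof.
move=> b0 gc mono g0; rewrite leNgt; apply/negP => gb.
(* Time runs backwards in [k], so that [first_zero] finds the last instant at level [l]. *)
pose k := fun t => l - g (b - t).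
have kc x : 0 <= x <= b -> {for x, continuous k}.
  move=> /andP[x0 xb]; apply: (@continuousB _ _ _ (fun=> l)); first exact: cst_continuous.
  apply: (@continuous_comp _ _ _ (fun t => b - t) g).
    by apply: (@continuousB _ _ _ (fun=> b)); [exact: cst_continuous|exact: cvg_id].
  by apply: gc; apply/andP; split; qlra.
have k0 : 0 < k 0 by rewrite /k subr0 subr_gt0.
have kb : k b <= 0 by rewrite /k subrr subr_le0.
have [s [/andP[s0 sb] ks pos]] := first_zero b0 kc k0 kb.
have e : g (b - s) = l by move: ks; rewrite /k => /eqP; rewrite subr_eq0 => /eqP.
suff : g (b - s) <= g b by rewrite e leNgt gb.
apply: mono; [qlra|qlra|by []|move=> u /andP[su ub]].
move: su; rewrite le_eqVlt => /predU1P[<-|su]; first by rewrite e.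
have := pos (b - u); rewrite /k subKr => /(_ _)/wrap[]; first by apply/andP; split; qlra.
by rewrite subr_gt0 => /ltW.
Qed.

End Monotone.

(** * Points of equal height on the two sides of an arch *)

Section SameHeight.
Variable R : realType.
Implicit Types (X Y : R -> R) (p q m : R).

Lemma incr_inverse Y p q : p <= q ->
  (forall u, p <= u <= q -> {for u, continuous Y}) ->
  (forall u v, p <= u -> u < v -> v <= q -> Y u < Y v) ->
  exists2 g : R -> R, {within `[Y p, Y q], continuous g} &
    forall h, Y p <= h <= Y q -> p <= g h <= q /\ Y (g h) = h.
Proof.
move=> pq Yc inc.
have le u v : p <= u -> u <= v -> v <= q -> Y u <= Y v.
  move=> pu; rewrite le_eqVlt => /predU1P[->//|uv] vq.
  by apply/ltW/inc.
have inj u v : p <= u <= q -> p <= v <= q -> Y u = Y v -> u = v.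
  move=> /andP[pu uq] /andP[pv vq] e; case: (ltgtP u v) => // uv.
    by have := inc _ _ pu uv vq; rewrite e ltxx.
  by have := inc _ _ pv uv uq; rewrite e ltxx.
have ex h : exists u, Y p <= h <= Y q -> p <= u <= q /\ Y u = h.
  case: (boolP (Y p <= h <= Y q)) => [/andP[h1 h2]|_]; last by exists p.
  have [||u uI u0] := @ivt_zero R (fun u => Y u - h) p q pq.
  - move=> u uI; apply: (@continuousB _ _ _ Y (fun=> h)); first exact: Yc.
    exact: cst_continuous.
  - by rewrite mulr_le0_ge0 ?subr_ge0 ?subr_le0.
  - by exists u => _; split => //; apply/eqP; rewrite -subr_eq0 u0.
have [g gP] := choice ex; exists g => //.
apply: (@segment_can_le_continuous R p q Y g pq); first exact: cont_within.
move=> u; rewrite in_itv /= => uI; have /andP[pu uq] := uI.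
have [|gI e] := gP (Y u); first by rewrite !le.
exact: inj.
Qed.

Lemma comp_within X (g : R -> R) c d :
  {within `[c, d], continuous g} ->
  (forall h, c <= h <= d -> {for g h, continuous X}) ->
  {within `[c, d], continuous (X \o g)}.
Proof.
move=> gc Xc; apply/subspace_continuousP => h hI.
have gh := (subspace_continuousP _ g).1 gc h hI.
have Xg : X @ g h --> X (g h) by apply: Xc; move: hI; rewrite /= in_itv.
exact: (cvg_comp g X gh Xg).
Qed.

(** On each of the two branches, rising and falling, the abscissa is a continuous function of the
    height. The difference of these two functions changes sign between the heights [Y p] and
    [Y p1]. *)
Lemma same_height X Y p p1 m q1 q : p <= p1 -> p1 < m -> m < q1 -> q1 <= q ->
  (forall u, p <= u <= q -> {for u, continuous X}) ->
  (forall u, p <= u <= q -> {for u, continuous Y}) ->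
  (forall u v, p <= u -> u < v -> v <= m -> Y u < Y v) ->
  (forall u v, m <= u -> u < v -> v <= q -> Y v < Y u) ->
  Y p = Y q -> Y p1 = Y q1 -> X p < X q -> X q1 <= X p1 ->
  exists u v, [/\ p <= u, u < v, v <= q, X u = X v & Y u = Y v].
Proof.
move=> pp1 p1m mq1 q1q Xc Yc inc dec Ypq Ypq1 Xpq Xpq1.
have p1q : p1 <= q by qlra.
have pm : p <= m by exact: le_trans pp1 (ltW p1m).
have mq : m <= q by exact: le_trans (ltW mq1) q1q.
have le u v : p <= u -> u <= v -> v <= m -> Y u <= Y v.
  move=> pu; rewrite le_eqVlt => /predU1P[->//|uv] vq.
  by apply/ltW/inc.
have [g1 g1c g1P] : exists2 g : R -> R, {within `[Y p, Y p1], continuous g} &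
    forall h, Y p <= h <= Y p1 -> p <= g h <= p1 /\ Y (g h) = h.
  apply: incr_inverse => //.
    by move=> u /andP[pu up1]; apply: Yc; rewrite pu; qlra.
  by move=> u v pu uv vp1; apply: inc => //; qlra.
have [g2 g2c g2P] : exists2 g : R -> R, {within `[Y p, Y p1], continuous g} &
    forall h, Y p <= h <= Y p1 -> q1 <= g h <= q /\ Y (g h) = h.
  (* Read backwards, the falling branch is increasing. *)
  have [| | |g gc gP] := @incr_inverse (fun u => Y (- u)) (- q) (- q1).
  - qlra.
  - move=> u uI; apply: (@continuous_comp _ _ _ (fun u => - u) Y).
      exact: opp_continuous.
    by apply: Yc; apply/andP; split; move: uI => /andP[]; qlra.
  - by move=> u v u1 uv v1; apply: dec; qlra.
  exists (fun h => - g h).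
    have gc' : {within `[Y p, Y p1], continuous g}.
      by move: gc; rewrite !opprK Ypq Ypq1.
    by move=> h /=; apply/continuousN/gc'.
  move=> h; rewrite Ypq Ypq1 => hI; have := gP h; rewrite !opprK => /(_ hI)[/andP[g1' g2'] e].
  by split => //; apply/andP; split; qlra.
pose k := (X \o g2) \- (X \o g1).
have kc : {within `[Y p, Y p1], continuous k}.
  move=> h; apply: continuousB; move: h.
    apply: comp_within => // h hI; apply: Xc; have [/andP[a1 a2] _] := g2P _ hI.
    by apply/andP; split; qlra.
  apply: comp_within => // h hI; apply: Xc; have [/andP[a1 a2] _] := g1P _ hI.
  by apply/andP; split; qlra.
have Yp1 : Y p <= Y p1 by apply: le => //; qlra.
have ip : Y p <= Y p <= Y p1 by rewrite lexx.
have ip1 : Y p <= Y p1 <= Y p1 by rewrite lexx Yp1.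
have inj1 u v : p <= u <= m -> p <= v <= m -> Y u = Y v -> u = v.
  move=> /andP[pu uq] /andP[pv vq] e; case: (ltgtP u v) => // uv.
    by have := inc _ _ pu uv vq; rewrite e ltxx.
  by have := inc _ _ pv uv uq; rewrite e ltxx.
have inj2 u v : m <= u <= q -> m <= v <= q -> Y u = Y v -> u = v.
  move=> /andP[pu uq] /andP[pv vq] e; case: (ltgtP u v) => // uv.
    by have := dec _ _ pu uv vq; rewrite e ltxx.
  by have := dec _ _ pv uv uq; rewrite e ltxx.
have kp : 0 <= k (Y p).
  have [/andP[a1 a2] e1] := g1P _ ip; have [/andP[b1 b2] e2] := g2P _ ip.
  have -> : k (Y p) = X q - X p.
    rewrite /k /=; congr (X _ - X _).
      by apply: inj2; rewrite -?Ypq// ?b2 ?(le_trans (ltW mq1) b1) ?lexx ?mq.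
    by apply: inj1 => //; rewrite ?a1 ?(le_trans a2 (ltW p1m)) ?lexx ?pm.
  by rewrite subr_ge0 ltW.
have kp1 : k (Y p1) <= 0.
  have [/andP[a1 a2] e1] := g1P _ ip1; have [/andP[b1 b2] e2] := g2P _ ip1.
  have -> : k (Y p1) = X q1 - X p1.
    rewrite /k /=; congr (X _ - X _).
      by apply: inj2; rewrite -?Ypq1// ?b2 ?(le_trans (ltW mq1) b1) ?q1q ?(ltW mq1).
    by apply: inj1 => //; rewrite ?a1 ?(le_trans a2 (ltW p1m)) ?pp1 ?(ltW p1m).
  by rewrite subr_le0.
have [|h hI k0] := @IVT R k (Y p) (Y p1) 0 Yp1 kc.
  by rewrite ge_min le_max kp kp1 orbT.
move: hI; rewrite in_itv /= => hI.
have [/andP[a1 a2] e1] := g1P _ hI; have [/andP[b1 b2] e2] := g2P _ hI.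
exists (g1 h), (g2 h); split => //; [qlra | | by rewrite e1].
by move: k0; rewrite /k /= => /eqP; rewrite subr_eq0 => /eqP.
Qed.

End SameHeight.

(** * Plane curves parametrised by the angle of their velocity *)

Section Trigo.
Variable R : realType.
Implicit Types t : R.

Lemma pi_lt4 : @pi R < 4.
Proof. by have := pihalf_lt2 R; qlra. Qed.

Lemma sin_le0_pi2pi t : pi <= t <= 2 * pi -> sin t <= 0.
Proof.
move=> /andP[t1 t2]; rewrite -(subrK pi t) sinDpi oppr_le0.
by apply: sin_ge0_pi; apply/andP; split; qlra.
Qed.

Lemma sin_lt0_pi2pi t : pi < t < 2 * pi -> sin t < 0.
Proof.
move=> /andP[t1 t2]; rewrite -(subrK pi t) sinDpi oppr_lt0.
by apply: sin_gt0_pi; apply/andP; split; qlra.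
Qed.

Lemma sinD2pi' t : sin (t + 2 * pi) = sin t.
Proof. by rewrite mulr_natl sinD2pi. Qed.

Lemma cosD2pi' t : cos (t + 2 * pi) = cos t.
Proof. by rewrite mulr_natl cosD2pi. Qed.

Lemma cos_le0_pihalf t : pi / 2 <= t <= 3 / 2 * pi -> cos t <= 0.
Proof.
move=> /andP[t1 t2]; rewrite -(subrK pi t) cosDpi oppr_le0.
by apply: cos_ge0_pihalf; apply/andP; split; qlra.
Qed.

End Trigo.

(** * Position of a counterclockwise curve relative to its tangent lines *)

Section Curve.
Variables (R : realType) (x y rho z : R -> R) (a b K : R).
Hypothesis xE : forall u, a <= u <= b -> has_der x u (rho u * cos u).
Hypothesis yE : forall u, a <= u <= b -> has_der y u (rho u * sin u).
Hypothesis rho_gt0 : forall u, a <= u <= b -> 0 < rho u.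
Hypothesis rho_le : forall u, a <= u <= b -> rho u <= K.
Hypothesis zE : forall u, a <= u <= b ->
  has_der z u (rho u * (x u * sin u - y u * cos u) / 2).
Hypothesis z_fun : forall s t, a <= s <= b -> a <= t <= b ->
  x s = x t -> y s = y t -> z s = z t.

Let pi0 : 0 < @pi R. Proof. exact: pi_gt0 R. Qed.
Let pi4 : @pi R < 4. Proof. exact: pi_lt4 R. Qed.
Let pi2 : 2 <= @pi R. Proof. exact: pi_ge2 R. Qed.

(* lra ignores section variables. *)
Local Ltac plra := move: (pi0) (pi4) (pi2) => ? ? ?; qlra.

Implicit Types s t u v w : R.

Local Notation "2pi" := (2 * pi).

(* The distance from the point of parameter u to the tangent line of parameter
   s, counted positively to the left of the latter. *)
Definition above s u := (x s - x u) * sin s - (y s - y u) * cos s.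

Definition behind s u := (x s - x u) * cos s + (y s - y u) * sin s.

(* The area swept by the segment from the point of parameter v, as the derivative
   of z is (x y' - y x') / 2. *)
Definition area s v := z s - z v - (x v * y s - y v * x s) / 2.

Lemma above_id s : above s s = 0.
Proof. by rewrite /above; ring. Qed.

Lemma above_der s u : a <= u <= b ->
  has_der (above s) u (rho u * sin (u - s)).
Proof.
move=> uI; have dx := xE uI; have dy := yE uI.
by rewrite /above; der; rewrite sinB; ring.
Qed.

Lemma behind_der s u : a <= u <= b ->
  has_der (behind s) u (- (rho u * cos (u - s))).
Proof.
move=> uI; have dx := xE uI; have dy := yE uI.
by rewrite /behind; der; rewrite cosB; ring.
Qed.

Lemma area_der v u : a <= u <= b ->
  has_der (area ^~ v) u (rho u * above u v / 2).
Proof.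
move=> uI; have dx := xE uI; have dy := yE uI; have dz := zE uI.
by rewrite /area /above; der; field.
Qed.

Lemma above_le s u v : a <= u -> u <= v -> v <= b ->
  (forall w, u <= w <= v -> 0 <= sin (w - s)) -> above s u <= above s v.
Proof.
move=> au uv vb sn; have h w : u <= w <= v -> a <= w <= b by move=> /andP[]; plra.
apply: (der_ge0_le uv (fun w wI => above_der s (h w wI))) => w wI.
by rewrite mulr_ge0 ?sn// ltW// rho_gt0// h.
Qed.

Lemma above_ge s u v : a <= u -> u <= v -> v <= b ->
  (forall w, u <= w <= v -> sin (w - s) <= 0) -> above s v <= above s u.
Proof.
move=> au uv vb sn; have h w : u <= w <= v -> a <= w <= b by move=> /andP[]; plra.
rewrite -lerN2.
apply: (der_ge0_le uv (fun w wI => derN (above_der s (h w wI)))) => w wI.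
by rewrite oppr_ge0 mulr_ge0_le0 ?sn// ltW// rho_gt0// h.
Qed.

Lemma above_lt s u v : a <= u -> u < v -> v <= b ->
  (forall w, u < w < v -> 0 < sin (w - s)) -> above s u < above s v.
Proof.
move=> au uv vb sn; have h w : u <= w <= v -> a <= w <= b by move=> /andP[]; plra.
apply: (der_gt0_lt uv (fun w wI => above_der s (h w wI))) => w wI.
by rewrite mulr_gt0 ?sn// rho_gt0// h//; move: wI => /andP[]; plra.
Qed.

Lemma above_gt s u v : a <= u -> u < v -> v <= b ->
  (forall w, u < w < v -> sin (w - s) < 0) -> above s v < above s u.
Proof.
move=> au uv vb sn; have h w : u <= w <= v -> a <= w <= b by move=> /andP[]; plra.
rewrite -ltrN2.
apply: (der_gt0_lt uv (fun w wI => derN (above_der s (h w wI)))) => w wI.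
rewrite oppr_gt0 pmulr_rlt0 ?sn// rho_gt0// h//; move: wI => /andP[]; plra.
Qed.

(** [above s] has derivative [rho u * sin (u - s)], so it grows away from [s] in both directions for
    half a turn. *)
Lemma above_gt0 s u : a <= s <= b -> a <= u <= b -> s != u ->
  - pi <= u - s -> u - s <= pi -> 0 < above s u.
Proof.
move=> /andP[as_ sb] /andP[au ub]; rewrite -(above_id s) neq_lt => /orP[su|us] h1 h2.
  apply: above_lt => // w /andP[w1 w2]; apply: sin_gt0_pi; plra.
apply: above_gt => // w /andP[w1 w2]; rewrite -opprB sinN oppr_lt0.
by apply: sin_gt0_pi; plra.
Qed.

Lemma x_lip u v : a <= u -> u <= v -> v <= b -> `|x v - x u| <= K * (v - u).
Proof.
move=> au uv vb; have h w : u <= w <= v -> a <= w <= b by move=> /andP[]; plra.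
have [c cI ->] := der_mvt uv (fun w wI => xE (h w wI)).
rewrite !normrM (ger0_norm (_ : 0 <= v - u)) ?subr_ge0// ler_wpM2r ?subr_ge0//.
rewrite gtr0_norm ?rho_gt0 ?h// -[K]mulr1 ler_pM ?rho_le ?h ?cos_max//.
by rewrite ltW// rho_gt0// h.
Qed.

Lemma y_lip u v : a <= u -> u <= v -> v <= b -> `|y v - y u| <= K * (v - u).
Proof.
move=> au uv vb; have h w : u <= w <= v -> a <= w <= b by move=> /andP[]; plra.
have [c cI ->] := der_mvt uv (fun w wI => yE (h w wI)).
rewrite !normrM (ger0_norm (_ : 0 <= v - u)) ?subr_ge0// ler_wpM2r ?subr_ge0//.
rewrite gtr0_norm ?rho_gt0 ?h// -[K]mulr1 ler_pM ?rho_le ?h ?sin_max//.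
by rewrite ltW// rho_gt0// h.
Qed.

(** [above] and [behind] are the coordinates of one chord in an orthonormal frame. *)
Lemma eq_point s t : above s t = 0 -> behind s t = 0 -> x s = x t /\ y s = y t.
Proof.
rewrite /above /behind => e1 e2; have cs := cos2Dsin2 s.
split; apply/eqP; rewrite -subr_eq0; apply/eqP.
  have -> : x s - x t = ((x s - x t) * sin s - (y s - y t) * cos s) * sin s +
    ((x s - x t) * cos s + (y s - y t) * sin s) * cos s.
    by transitivity ((x s - x t) * (cos s ^+ 2 + sin s ^+ 2));
      [rewrite cs mulr1 | ring].
  by rewrite e1 e2 !mul0r addr0.
have -> : y s - y t = ((x s - x t) * cos s + (y s - y t) * sin s) * sin s -
   ((x s - x t) * sin s - (y s - y t) * cos s) * cos s.
  by transitivity ((y s - y t) * (cos s ^+ 2 + sin s ^+ 2));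
    [rewrite cs mulr1 | ring].
by rewrite e1 e2 !mul0r subr0.
Qed.

(* A loop of total turning at most 2pi would sweep a positive area, whereas the
   area swept is a function of the endpoints. *)
Lemma no_loop s t : a <= s -> s < t -> t <= s + 2pi -> t <= b ->
  x s = x t -> y s = y t -> False.
Proof.
move=> as_ st ts tb ex ey.
have sI : a <= s <= b by plra.
have tI : a <= t <= b by plra.
have h w : s <= w <= t -> a <= w <= b by move=> /andP[]; plra.
suff : area s s < area t s by rewrite /area (z_fun sI tI ex ey) ex ey ltxx.
apply: (der_gt0_lt st (fun w wI => area_der s (h w wI))) => w wI.
have wI' : a <= w <= b by apply: h; move: wI => /andP[]; plra.
move: wI => /andP[w1 w2].
rewrite divr_gt0// mulr_gt0 ?rho_gt0//.
(* The ends of the loop are the same point, and one of the parameters [s] and [t] is at most half a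
   turn away from [w]. *)
case: (leP (w - s) pi) => ws.
  by apply: above_gt0 => //; rewrite ?gt_eqF//; plra.
have -> : above w s = above w t by rewrite /above ex ey.
by apply: above_gt0 => //; rewrite ?lt_eqF//; plra.
Qed.

(** The sign tells how the curve spirals during the next turn: inwards if positive, outwards if
    negative. *)
Definition gap s := above s (s + 2pi).

(** Both velocities are parallel to the tangent at [s] and contribute nothing; only the rotation of
    the frame does. *)
Lemma gap_der s : a <= s -> s + 2pi <= b -> has_der gap s (behind s (s + 2pi)).
Proof.
move=> as_ sb.
have dx : has_der x s (rho s * cos s) by apply: xE; plra.
have dy : has_der y s (rho s * sin s) by apply: yE; plra.
have ds : has_der (fun t => t + 2pi) s (1 + 0) by do 2 der1.
have dx2 : has_der (fun t => x (t + 2pi)) s (rho (s + 2pi) * cos (s + 2pi) * (1 + 0)).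
  by apply: (@der_comp _ x (fun t => t + 2pi)) => //; apply: xE; plra.
have dy2 : has_der (fun t => y (t + 2pi)) s (rho (s + 2pi) * sin (s + 2pi) * (1 + 0)).
  by apply: (@der_comp _ y (fun t => t + 2pi)) => //; apply: yE; plra.
by rewrite /gap /above /behind; der; rewrite cosD2pi' sinD2pi'; ring.
Qed.

(* If gap s = 0, both ends of the turn lie on one tangent line.  Were the end not
   behind the start, same_height would provide a loop. *)
Lemma gap_up s : a <= s -> s + 2pi <= b -> gap s = 0 -> 0 < behind s (s + 2pi).
Proof.
move=> as_ sb gs; rewrite ltNge le_eqVlt; apply/negP => /predU1P[e|bh].
  have [ex ey] := eq_point gs e.
  by apply: (no_loop as_ _ _ sb ex ey); plra.
have /and4P[r1 r2 r3 r4] : [&& s < s + pi / 2, s + pi / 2 < s + pi,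
    s + pi < s + 3 / 2 * pi & s + 3 / 2 * pi < s + 2pi] by plra.
(* Coordinates of the turn in the frame of its initial tangent: [Y] rises during half a turn, then
   falls. *)
pose X := fun u => - behind s u; pose Y := above s.
have h u : s <= u <= s + 2pi -> a <= u <= b by move=> /andP[]; plra.
have Xd u : s <= u <= s + 2pi -> has_der X u (rho u * cos (u - s)).
  by move=> /h uI; have := derN (behind_der s uI); rewrite opprK.
have Yd u : s <= u <= s + 2pi -> has_der Y u (rho u * sin (u - s)).
  by move=> /h uI; exact: above_der.
have Xc u : s <= u <= s + 2pi -> {for u, continuous X} by move=> /Xd /der_cont.
have Yc u : s <= u <= s + 2pi -> {for u, continuous Y} by move=> /Yd /der_cont.
have Yinc u v : s <= u -> u < v -> v <= s + pi -> Y u < Y v.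
  move=> su uv vs; apply: above_lt; [plra|by []|plra|move=> w /andP[w1 w2]].
  by apply: sin_gt0_pi; plra.
have Ydec u v : s + pi <= u -> u < v -> v <= s + 2pi -> Y v < Y u.
  move=> su uv vs; apply: above_gt; [plra|by []|plra|move=> w /andP[w1 w2]].
  by apply: sin_lt0_pi2pi; plra.
have Xdec u v : s + pi / 2 <= u -> u <= v -> v <= s + 3 / 2 * pi -> X v <= X u.
  move=> su uv vs; rewrite -lerN2.
  have h2 w : u <= w <= v -> s <= w <= s + 2pi by move=> /andP[]; plra.
  apply: (der_ge0_le uv (fun w wI => derN (Xd _ (h2 w wI)))) => w wI.
  rewrite oppr_ge0 mulr_ge0_le0//; first by rewrite ltW// rho_gt0// h// h2.
  by apply: cos_le0_pihalf; move: wI => /andP[]; plra.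
have Ys : Y s = 0 by exact: above_id.
have Y2 : Y (s + 2pi) = 0 by [].
have Xs : X s = 0 by rewrite /X /behind; ring.
have Xs2 : X s < X (s + 2pi) by rewrite Xs oppr_gt0.
have XE u : X u = - behind s u by [].
have YE u : Y u = above s u by [].
clearbody X Y.
have Ypi : 0 < Y (s + pi) by rewrite -Ys; apply: Yinc => //; exact: lt_trans r1 r2.
have Y1 : 0 < Y (s + pi / 2) by rewrite -Ys; apply: Yinc => //; exact: ltW.
have Y3 : 0 < Y (s + 3 / 2 * pi) by rewrite -Y2; apply: Ydec => //; exact: ltW.
have Y1' : Y (s + pi / 2) < Y (s + pi) by apply: Yinc => //; exact: ltW.
have Y3' : Y (s + 3 / 2 * pi) < Y (s + pi) by apply: Ydec => //; exact: ltW.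
(* Take the higher of the points at a quarter and at three quarters of the turn; the opposite branch
   has a point of the same height between the other one and the top. Both parameters lie in the
   range where [X] decreases. *)
have [p1 [q1 [[p1s p1p] [q1p q1s] eY eX]]] : exists p1 q1,
    [/\ s <= p1 /\ p1 < s + pi, s + pi < q1 /\ q1 <= s + 2pi, Y p1 = Y q1 & X q1 <= X p1].
  case: (leP (Y (s + pi / 2)) (Y (s + 3 / 2 * pi))) => Y13.
    have [| | |p1 /andP[p1a p1b] e] := @ivt_zero R (fun u =>
      Y u - Y (s + 3 / 2 * pi)) (s + pi / 2) (s + pi).
    - plra.
    - move=> u uI; apply: (@continuousB _ _ _ Y (fun=> _)); last exact: cst_continuous.
      by apply: Yc; move: uI => /andP[]; plra.
    - by rewrite mulr_le0_ge0 ?subr_ge0 ?subr_le0// ltW.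
    have e' : Y p1 = Y (s + 3 / 2 * pi) by apply/eqP; rewrite -subr_eq0 e.
    have p1n : p1 < s + pi.
      by rewrite lt_neqAle p1b andbT; apply/eqP => ep; move: e'; rewrite ep; plra.
    exists p1, (s + 3 / 2 * pi); split=> //; [|by split; rewrite ?ltW|].
      by split=> //; exact: le_trans (ltW r1) p1a.
    by apply: Xdec => //; exact: le_trans p1b (ltW r3).
  have [| | |q1 /andP[q1a q1b] e] := @ivt_zero R (fun u =>
    Y u - Y (s + pi / 2)) (s + pi) (s + 3 / 2 * pi).
  - plra.
  - move=> u uI; apply: (@continuousB _ _ _ Y (fun=> _)); last exact: cst_continuous.
    by apply: Yc; move: uI => /andP[]; plra.
  - by rewrite mulr_ge0_le0 ?subr_ge0 ?subr_le0// ltW.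
  have e' : Y q1 = Y (s + pi / 2) by apply/eqP; rewrite -subr_eq0 e.
  have q1n : s + pi < q1.
    by rewrite lt_neqAle q1a andbT; apply/eqP => ep; move: e'; rewrite -ep; plra.
  exists (s + pi / 2), q1; split=> //; [by split; rewrite ?ltW| |].
    by split=> //; exact: le_trans q1b (ltW r4).
  by apply: Xdec => //; exact: le_trans (ltW r2) q1a.
have [u [v [su uv vs eXuv eYuv]]] := same_height p1s p1p q1p q1s Xc Yc Yinc Ydec
  (etrans Ys (esym Y2)) eY Xs2 eX.
have [ex ey] : x u = x v /\ y u = y v.
  have cs := cos2Dsin2 s; move: eXuv eYuv; rewrite !XE !YE /above /behind => /oppr_inj e1 e2.
  have f1 : (x u - x v) * cos s + (y u - y v) * sin s = 0 by plra.
  have f2 : (x u - x v) * sin s - (y u - y v) * cos s = 0 by plra.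
  split; apply/eqP; rewrite -subr_eq0; apply/eqP.
    transitivity ((x u - x v) * (cos s ^+ 2 + sin s ^+ 2)); first by rewrite cs mulr1.
    transitivity (((x u - x v) * cos s + (y u - y v) * sin s) * cos s +
      ((x u - x v) * sin s - (y u - y v) * cos s) * sin s); first by ring.
    by rewrite f1 f2 !mul0r addr0.
  transitivity ((y u - y v) * (cos s ^+ 2 + sin s ^+ 2)); first by rewrite cs mulr1.
  transitivity (((x u - x v) * cos s + (y u - y v) * sin s) * sin s -
    ((x u - x v) * sin s - (y u - y v) * cos s) * cos s); first by ring.
  by rewrite f1 f2 !mul0r subr0.
by apply: (no_loop (le_trans as_ su) uv _ (le_trans vs sb) ex ey);
  rewrite (le_trans vs)// lerD2r.
Qed.

Lemma gap_pos_after s t : a <= s -> s < t -> t + 2pi <= b -> 0 <= gap s -> 0 < gap t.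
Proof.
move=> as_ st tb; apply: (@pos_after_upcrossing _ gap (fun w => behind w (w + 2pi)) _ _ st).
  by move=> w /andP[w1 w2]; apply: gap_der; plra.
by move=> w /andP[w1 w2]; apply: gap_up; plra.
Qed.

(** The tangent lines at [s] and [s + 2pi] are parallel, at signed distance [gap s]. *)
Lemma above_period s t : above s t = gap s + above (s + 2pi) t.
Proof. by rewrite /gap /above sinD2pi' cosD2pi'; ring. Qed.

Lemma exists_turns (r : R) : exists n : nat, r <= n%:R * 2pi.
Proof.
exists (Num.bound `|r|); have h := archi_boundP (normr_ge0 r).
have h1 := ler_norm r; have h2 : 0 <= (Num.bound `|r|)%:R :> R by rewrite ler0n.
by move: (pi2) => h3; nra.
Qed.

Lemma above_ge0 s u : a <= s <= b -> a <= u <= b ->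
  - pi <= u - s -> u - s <= pi -> 0 <= above s u.
Proof.
move=> sI uI h1 h2; have [<-|su] := eqVneq s u; first by rewrite above_id.
exact/ltW/above_gt0.
Qed.

(** Induction on the number of turns from [s] to [t]: replacing the tangent at [s] by the one a turn
    later moves it inwards by a gap. Within one turn, [above s] increases for half a turn, then
    decreases to [gap s], which is still nonnegative. *)
Lemma inward_above s0 s t : a <= s0 ->
  (forall w, s0 <= w -> w + 2pi <= b -> 0 <= gap w) ->
  s0 <= s -> s <= t -> t + 2pi <= b -> 0 <= above s t.
Proof.
move=> as0 gap0; have [n] := exists_turns (t - s).
elim: n s => [|n IHn] s tn s0s st tb.
  have -> : s = t by move: tn; rewrite mul0r; qlra.
  by rewrite above_id.
case: (leP t (s + pi)) => [tpi|pit]; first by apply: above_ge0; plra.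
case: (leP t (s + 2pi)) => [t2pi|pi2t].
  apply: le_trans (gap0 s s0s _) _; first by plra.
  apply: above_ge => //; [plra|plra|move=> w wI].
  by apply: sin_le0_pi2pi; plra.
rewrite above_period addr_ge0 ?gap0//; first by plra.
apply: IHn => //; [|plra|plra].
by move: tn; rewrite -natr1 mulrDl mul1r; qlra.
Qed.

(** The same induction backwards in time: the tangent at [t] lies outside the one at [t - 2pi]. The
    margin [a + 2pi <= s] keeps these earlier tangents in the domain. *)
Lemma outward_above t0 s t : t0 + 2pi <= b ->
  (forall w, a <= w -> w <= t0 -> gap w <= 0) ->
  a + 2pi <= s -> s <= t -> t <= t0 + 2pi -> 0 <= above t s.
Proof.
move=> t0b gap0; have [n] := exists_turns (t - s).
elim: n t => [|n IHn] t tn as_ st tt0.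
  have -> : s = t by move: tn; rewrite mul0r; qlra.
  by rewrite above_id.
have per := above_period (t - 2pi); rewrite subrK in per.
case: (leP t (s + pi)) => [tpi|pit]; first by apply: above_ge0; plra.
have g0 : gap (t - 2pi) <= 0 by apply: gap0; plra.
case: (leP t (s + 2pi)) => [t2pi|pi2t].
  apply: (@le_trans _ _ (above t (t - 2pi))).
    by have := per (t - 2pi); rewrite above_id; qlra.
  apply: above_le; [plra|plra|plra|move=> w wI].
  by rewrite -sinD2pi'; apply: sin_ge0_pi; plra.
have : 0 <= above (t - 2pi) s.
  apply: IHn => //; [|plra|plra].
  by move: tn; rewrite -natr1 mulrDl mul1r; qlra.
by rewrite per; qlra.
Qed.

Lemma norm_mul_le (p c : R) : `|c| <= 1 -> `|p * c| <= `|p|.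
Proof. by move=> c1; rewrite normrM ler_piMr. Qed.

Hypothesis K0 : 0 <= K.

(* Opposite tangent lines are at a distance of at most 8 K, and the point of
   parameter u lies between them. *)
Lemma left_of_all_close s u : a <= s -> s + 3 / 2 * pi <= b -> a <= u <= b ->
  0 <= above s u -> 0 <= above (s + pi / 2) u -> 0 <= above (s + pi) u ->
  0 <= above (s + 3 / 2 * pi) u ->
  `|x s - x u| <= 24 * K /\ `|y s - y u| <= 24 * K.
Proof.
move=> as_ sb uI a1 a2 a3 a4.
(* Half a turn moves each coordinate by at most [K * pi <= 4 * K]. Two coordinates give 8 K for
   [above]; one more chord gives 16 K for [behind], and 24 K is the sum. *)
have lip (f : R -> R) : (forall v w,
  a <= v -> v <= w -> w <= b -> `|f w - f v| <= K * (w - v)) ->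
    [/\ `|f s - f (s + pi)| <= 4 * K, `|f (s + pi / 2) - f (s + 3 / 2 * pi)| <= 4 * K
      & `|f s - f (s + pi / 2)| <= 4 * K].
  move=> fl; split; rewrite distrC.
  - apply: le_trans (fl _ _ _ _ _) _; [plra|plra|plra|].
    by rewrite [s + pi]addrC addrK mulrC ler_wpM2r// ltW.
  - rewrite distrC distrC; apply: le_trans (fl _ _ _ _ _) _; [plra|plra|plra|].
    by rewrite mulrC ler_wpM2r//; plra.
  - apply: le_trans (fl _ _ _ _ _) _; [plra|plra|plra|].
    by rewrite mulrC ler_wpM2r//; plra.
have [x1 x2 x3] := lip x x_lip; have [y1 y2 y3] := lip y y_lip.
have S := sin_max s; have Co := cos_max s.
have M (p c B : R) : `|c| <= 1 -> `|p| <= B -> - B <= p * c <= B.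
  by move=> c1 pB; move: (le_trans (norm_mul_le p c1) pB); rewrite ler_norml.
have p8 : above s u <= 8 * K.
  have : above s u + above (s + pi) u =
      (x s - x (s + pi)) * sin s - (y s - y (s + pi)) * cos s.
    by rewrite /above sinDpi cosDpi; ring.
  by have /andP[? ?] := M _ _ _ S x1; have /andP[? ?] := M _ _ _ Co y1; qlra.
have sc : sin (s + pi / 2) = cos s by rewrite sinDpihalf.
have cc : cos (s + pi / 2) = - sin s by rewrite cosDpihalf.
have q8 : above (s + pi / 2) u <= 8 * K.
  have : above (s + pi / 2) u + above (s + 3 / 2 * pi) u =
      (x (s + pi / 2) - x (s + 3 / 2 * pi)) * cos s + (y (s + pi / 2) - y (s + 3 / 2 * pi)) *
        sin s.
    have -> : s + 3 / 2 * pi = s + pi / 2 + pi by field.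
    by rewrite /above sinDpi cosDpi sc cc; ring.
  by have /andP[? ?] := M _ _ _ Co x2; have /andP[? ?] := M _ _ _ S y2; qlra.
have r12 : `|behind s u| <= 16 * K.
  have -> : behind s u = above (s + pi / 2) u + ((x s - x (s + pi / 2)) * cos s + (y s - y (s
    + pi / 2)) * sin s).
    by rewrite /behind /above sc cc; ring.
  rewrite ler_norml.
  have /andP[? ?] := M _ _ _ Co x3; have /andP[? ?] := M _ _ _ S y3; qlra.
have p8' : `|above s u| <= 8 * K by rewrite ger0_norm.
have cs := cos2Dsin2 s.
have ex : x s - x u = above s u * sin s + behind s u * cos s.
  by rewrite /above /behind; transitivity ((x s - x u) * (cos s ^+ 2 + sin s ^+ 2));
    [rewrite cs mulr1|ring].
have ey : y s - y u = behind s u * sin s - above s u * cos s.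
  by rewrite /above /behind; transitivity ((y s - y u) * (cos s ^+ 2 + sin s ^+ 2));
    [rewrite cs mulr1|ring].
have /andP[? ?] := M _ _ _ S p8'; have /andP[? ?] := M _ _ _ Co p8'.
have /andP[? ?] := M _ _ _ S r12; have /andP[? ?] := M _ _ _ Co r12.
have k0 := K0; by split; rewrite ?ex ?ey ler_norml; qlra.
Qed.

Lemma lip_close (c : R) s t : a <= s -> s <= t -> t <= b -> t - s <= c * pi ->
  0 <= c -> `|x t - x s| <= 4 * c * K /\ `|y t - y s| <= 4 * c * K.
Proof.
move=> as_ st tb ts c0; have h : K * (t - s) <= 4 * c * K.
  rewrite mulrC ler_wpM2r// (le_trans ts)// mulrC ler_wpM2r//.
  exact: ltW.
by split; [apply: le_trans (x_lip as_ st tb) h|apply: le_trans (y_lip as_ st tb) h].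
Qed.

Lemma close_trans (p q r B1 B2 : R) : `|p - q| <= B1 -> `|q - r| <= B2 -> `|p - r| <= B1 + B2.
Proof. by move=> h1 h2; have := ler_distD q p r; qlra. Qed.

(** The point at [b - 2pi], the last one that [inward_above] covers, is to the left of four tangents
    a quarter turn apart starting at [s0]: this gives 24 K, and the final turn adds 8 K. *)
Lemma inward_close s0 : a <= s0 -> s0 <= b ->
  (forall w, s0 <= w -> w + 2pi <= b -> 0 <= gap w) ->
  `|x b - x s0| <= 32 * K /\ `|y b - y s0| <= 32 * K.
Proof.
move=> as0 s0b gap0; have k0 := K0.
case: (leP (b - s0) (4 * pi)) => [bs|bs].
  have [] := @lip_close 4 s0 b as0 s0b (lexx b) bs (ler0n _ 4); qlra.
have [x1 y1] := @lip_close 2 (b - 2pi) b ltac:(plra) ltac:(plra) (lexx b) ltac:(plra) (ler0n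
  _ 2).
have ab u v : s0 <= u -> u <= v -> v + 2pi <= b -> 0 <= above u v.
  exact: (inward_above as0 gap0).
have [x2 y2] : `|x s0 - x (b - 2pi)| <= 24 * K /\ `|y s0 - y (b - 2pi)| <= 24 * K.
  by apply: left_of_all_close; first [apply: ab; plra | plra].
rewrite distrC in x2; rewrite distrC in y2.
have := close_trans x1 x2; have := close_trans y1 y2; split; qlra.
Qed.

(** Here the four tangents start at [t0], and it is the first turn that is left out and adds 8 K. *)
Lemma outward_close t0 : a <= t0 -> t0 + 2pi <= b ->
  (forall w, a <= w -> w <= t0 -> gap w <= 0) ->
  `|x t0 - x a| <= 32 * K /\ `|y t0 - y a| <= 32 * K.
Proof.
move=> at0 t0b gap0; have k0 := K0.
case: (leP (t0 - a) 2pi) => [ta|ta].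
  have [] := @lip_close 2 a t0 (lexx a) at0 ltac:(plra) ta (ler0n _ 2); qlra.
have [x1 y1] := @lip_close 2 a (a + 2pi) (lexx a) ltac:(plra) ltac:(plra) ltac:(plra) (ler0n
  _ 2).
have ab u v : a + 2pi <= u -> u <= v -> v <= t0 + 2pi -> 0 <= above v u.
  exact: (outward_above t0b gap0).
have [x2 y2] : `|x t0 - x (a + 2pi)| <= 24 * K /\ `|y t0 - y (a + 2pi)| <= 24 * K.
  by apply: left_of_all_close; first [apply: ab; plra | plra].
have := close_trans x2 x1; have := close_trans y2 y1; split; qlra.
Qed.

(** Since [gap] changes sign at most once, there is at most one outward phase followed by one inward
    phase, of 32 K each. *)
Lemma displacement_le : a <= b ->
  `|x b - x a| <= 64 * K /\ `|y b - y a| <= 64 * K.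
Proof.
move=> ab; have k0 := K0.
case: (leP (b - a) 2pi) => [ba|ba].
  have [] := @lip_close 2 a b (lexx a) ab (lexx b) ba (ler0n _ 2); qlra.
have gd w : a <= w <= b - 2pi -> has_der gap w (behind w (w + 2pi)).
  by move=> wI; apply: gap_der; plra.
have before w v : a <= w -> w < v -> v + 2pi <= b -> gap v <= 0 -> gap w <= 0.
  move=> aw wv vb gv; rewrite leNgt; apply/negP => /ltW gw.
  by have := gap_pos_after aw wv vb gw; qlra.
case: (leP 0 (gap a)) => [ga|ga].
  have [| | |? ?] := @inward_close a; [plra|plra| |split; qlra].
  move=> w; rewrite le_eqVlt => /predU1P[<-//|aw] wb.
  exact/ltW/(gap_pos_after (lexx a) aw wb ga).
case: (leP (gap (b - 2pi)) 0) => [gb|gb].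
  have [| | |x1 y1] := @outward_close (b - 2pi); [plra|plra| |].
    move=> w aw; rewrite le_eqVlt => /predU1P[->//|wb].
    by apply: before aw wb _ gb; plra.
  have [x2 y2] := @lip_close 2 (b - 2pi) b ltac:(plra) ltac:(plra) (lexx b) ltac:(plra)
    (ler0n _ 2).
  have := close_trans x2 x1; have := close_trans y2 y1; split; qlra.
have [| | |t0 /andP[at0 t0b] gt0] := @ivt_zero R gap a (b - 2pi); [plra| | |].
- by move=> w /gd /der_cont.
- by rewrite ltW// nmulr_rlt0.
have [| | |x1 y1] := @outward_close t0; [plra|plra| |].
  move=> w aw; rewrite le_eqVlt => /predU1P[->|wb]; first by rewrite gt0.
  by apply: before aw wb _ _; [plra|rewrite gt0].
have [| | |x2 y2] := @inward_close t0; [plra|plra| |].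
  move=> w; rewrite le_eqVlt => /predU1P[<-|tw] wb; first by rewrite gt0.
  by apply/ltW/(gap_pos_after _ tw wb); rewrite ?gt0.
have := close_trans x2 x1; have := close_trans y2 y1; split; qlra.
Qed.

(** * Area swept by spirals whose radius of curvature is bounded below *)

Section Area.
Variable r0 : R.
Hypothesis r0_gt0 : 0 < r0.
Hypothesis rho_ge : forall u, a <= u <= b -> r0 <= rho u.

(** Comparison with the circle of radius [r0], for which [above] is [r0 * (1 - cos (u - s))]. *)
Lemma above_ge_r0 s u : a <= s <= b -> a <= u <= b ->
  pi / 2 <= `|u - s| <= pi -> r0 <= above s u.
Proof.
move=> sI uI usI; have r0p := r0_gt0.
pose g w := above s w - r0 * (1 - cos (w - s)).
have gd w : a <= w <= b -> has_der g w ((rho w - r0) * sin (w - s)).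
  move=> wI; have d1 := above_der s wI; rewrite /g.
  have d2 : has_der (fun w => w - s) w (1 + - 0) by apply: derD; [exact: der_id|apply: derN;
    exact: der_cst].
  by der; ring.
have gs : g s = 0 by rewrite /g above_id subrr cos0; ring.
have cu : cos (u - s) <= 0.
  by rewrite -cos_norm; apply: cos_le0_pihalf; plra.
suff : 0 <= g u by rewrite /g; nra.
rewrite -gs; case: (leP s u) => su.
  apply: (der_ge0_le su (fun w wI => gd w ltac:(qlra))) => w wI.
  rewrite mulr_ge0 ?subr_ge0 ?rho_ge//; first by qlra.
  by apply: sin_ge0_pi; move: usI; rewrite ger0_norm; qlra.
rewrite -lerN2; apply: (der_ge0_le (ltW su) (fun w wI => derN (gd w ltac:(qlra)))) => w wI.
rewrite -mulrN -sinN mulr_ge0 ?subr_ge0 ?rho_ge//; first by qlra.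
by apply: sin_ge0_pi; move: usI; rewrite ltr0_norm; qlra.
Qed.

Lemma turns_ge0 (n : nat) : 0 <= n%:R * (2 * @pi R).
Proof. by apply: mulr_ge0; [exact: ler0n|apply: mulr_ge0; [exact: ler0n|exact: ltW]]. Qed.

Lemma succ_mulr (n : nat) (c : R) : n.+1%:R * c = n%:R * c + c.
Proof. by rewrite -[n.+1%:R]natr1 mulrDl mul1r. Qed.

Lemma above_periods n s v :
  above s v = \sum_(i < n) gap (s + i%:R * 2pi) + above (s + n%:R * 2pi) v.
Proof.
elim: n => [|n IHn]; first by rewrite big_ord0 add0r mul0r addr0.
rewrite IHn big_ord_recr /= (succ_mulr n 2pi) (above_period (s + n%:R * 2pi)).
by rewrite !addrA.
Qed.

Lemma area_incr v s t (m : R) : a <= s -> s <= t -> t <= b -> 0 <= m ->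
  (forall w, s <= w <= t -> m <= above w v) ->
  r0 * m / 2 * (t - s) <= area t v - area s v.
Proof.
move=> as_ st tb m0 h; have r0p := r0_gt0.
have [c cI ->] := der_mvt st (fun w wI => area_der v (u := w) ltac:(qlra)).
rewrite ler_wpM2r ?subr_ge0// ler_wpM2r ?invr_ge0//.
by apply: ler_pM; [exact: ltW|exact: m0|apply: rho_ge; qlra|exact: h].
Qed.

Lemma window_gain : r0 ^+ 2 / 2 <= r0 * r0 / 2 * (pi / 2).
Proof. have h := pi2; have := sqr_ge0 r0; rewrite expr2; nra. Qed.

(** The area never decreases during the turn, and the window of a quarter turn alone yields
    [r0 ^+ 2 * pi / 4], where [pi >= 2]. *)
Lemma area_turn v s c : a <= s -> s <= c -> c + pi / 2 <= s + 2pi -> s + 2pi <= b ->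
  (forall w, s <= w -> w <= s + 2pi -> 0 <= above w v) ->
  (forall w, c <= w -> w <= c + pi / 2 -> r0 <= above w v) ->
  r0 ^+ 2 / 2 <= area (s + 2pi) v - area s v.
Proof.
move=> as_ sc cs sb pos far.
have /and3P[ac c2 cb] : [&& a <= c, c <= c + pi / 2 & c + pi / 2 <= b] by plra.
have e1 : 0 <= area c v - area s v.
  apply: le_trans (area_incr (m := 0) as_ sc _ _ _); rewrite ?mulr0 ?mul0r//.
    exact: le_trans c2 cb.
  by move=> w /andP[sw wc]; apply: pos => //; apply: le_trans wc _; exact: le_trans c2 cs.
have e3 : 0 <= area (s + 2pi) v - area (c + pi / 2) v.
  apply: le_trans (area_incr (m := 0) _ cs sb _ _); rewrite ?mulr0 ?mul0r//.
    exact: le_trans ac c2.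
  by move=> w /andP[cw ws]; apply: pos => //; apply: le_trans cw; exact: le_trans sc c2.
have e2 : r0 ^+ 2 / 2 <= area (c + pi / 2) v - area c v.
  apply: le_trans (area_incr (m := r0) ac c2 cb (ltW r0_gt0) _).
    by rewrite [c + _]addrC addrK; exact: window_gain.
  by move=> w /andP[cw wc]; exact: far.
qlra.
Qed.

Lemma turns_lt (i n : nat) : (i < n)%N -> i%:R * 2pi + 2pi <= n%:R * 2pi :> R.
Proof. by move=> iN; rewrite -succ_mulr ler_wpM2r ?mulr_ge0 ?(ltW pi0)// ler_nat. Qed.

(** The base point is the last one, as an inward spiral keeps it to the left of all earlier
    tangents; the area counted back from it is negative. *)
Lemma inward_area s0 n v : a <= s0 ->
  (forall w, s0 <= w -> w + 2pi <= b -> 0 <= gap w) ->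
  v + 2pi <= b -> s0 <= v - n%:R * 2pi ->
  area (v - n%:R * 2pi) v <= - (n%:R * (r0 ^+ 2 / 2)).
Proof.
move=> as0 gap0 vb; elim: n => [|n IHn] sv.
  by rewrite !mul0r subr0 /area; qlra.
have n0 := turns_ge0 n.
move: sv; rewrite (succ_mulr n 2pi) ?(succ_mulr n (r0 ^+ 2 / 2)) => sv.
have {}IHn := IHn ltac:(plra).
suff : r0 ^+ 2 / 2 <= area (v - n%:R * 2pi) v - area (v - (n%:R * 2pi + 2pi)) v by qlra.
have <- : v - (n%:R * 2pi + 2pi) + 2pi = v - n%:R * 2pi by ring.
have lt_n (i : 'I_n) := turns_lt (ltn_ord i); have per := above_periods n.
move: n0 sv lt_n per {IHn}; move: (n%:R * 2pi) => N n0 sv lt_n per.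
(* Shifted by [N], the window lies between half a turn and a quarter turn before [v], where
   [above_ge_r0] applies; the gaps of the turns in between only increase [above]. *)
apply: (@area_turn v _ (v - N - pi)); [plra|plra|plra|plra| |].
  by move=> w sw wv; apply: (inward_above as0 gap0 _ _ vb); plra.
move=> w cw wc; rewrite per; apply: (@le_trans _ _ (above (w + N) v)).
  by apply: above_ge_r0; [plra|plra|rewrite ger0_norm; plra].
rewrite lerDr; apply: sumr_ge0 => i _; have iN := lt_n i.
by have i0 := turns_ge0 i; apply: gap0; plra.
Qed.

Lemma outward_area t0 n v : t0 + 2pi <= b ->
  (forall w, a <= w -> w <= t0 -> gap w <= 0) ->
  a + 2pi <= v -> v + n%:R * 2pi <= t0 + 2pi ->
  n%:R * (r0 ^+ 2 / 2) <= area (v + n%:R * 2pi) v.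
Proof.
move=> t0b gap0 av; elim: n => [|n IHn] vt.
  by rewrite !mul0r addr0 /area; qlra.
have n0 := turns_ge0 n.
move: vt; rewrite (succ_mulr n 2pi) ?(succ_mulr n (r0 ^+ 2 / 2)) => vt.
have {}IHn := IHn ltac:(plra).
suff : r0 ^+ 2 / 2 <= area (v + (n%:R * 2pi + 2pi)) v - area (v + n%:R * 2pi) v by qlra.
rewrite addrA.
have lt_n (i : 'I_n) := turns_lt (ltn_ord i);
  have per := fun w => above_periods n (w - n%:R * 2pi) v.
move: n0 vt lt_n per {IHn}; move: (n%:R * 2pi) => N n0 vt lt_n per.
apply: (@area_turn v _ (v + N + pi / 2)); [plra|plra|plra|plra| |].
  by move=> w sw wv; apply: (outward_above t0b gap0 av); plra.
move=> w cw wc; have := per w; rewrite subrK => {}per.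
apply: (@le_trans _ _ (above (w - N) v)).
  by apply: above_ge_r0; [plra|plra|rewrite ler0_norm; plra].
rewrite per gerDr; apply: sumr_le0 => i _; have iN := lt_n i.
by have i0 := turns_ge0 i; apply: gap0; plra.
Qed.

(** The sign of [gap] at the midpoint decides: either the whole second half spirals inwards or the
    whole first half outwards. Each half has [n] turns and one more as a margin for [gap]. *)
Lemma area_unbounded n : 2 * ((n%:R + 1) * 2pi) <= b - a ->
  exists u v, [/\ a <= u <= b, a <= v <= b & n%:R * (r0 ^+ 2 / 2) <= `|area u v|].
Proof.
move=> ba; have n0 := turns_ge0 n.
move: ba; rewrite mulrDl mul1r => ba; pose m := (a + b) / 2.
case: (leP 0 (gap m)) => gm.
  have : area (b - 2pi - n%:R * 2pi) (b - 2pi) <= - (n%:R * (r0 ^+ 2 / 2)).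
    apply: (@inward_area m); [rewrite /m; plra| |plra|rewrite /m; plra].
    move=> w; rewrite le_eqVlt => /predU1P[<-//|mw] wb.
    by apply/ltW/(gap_pos_after _ mw wb gm); rewrite /m; plra.
  move=> h; exists (b - 2pi - n%:R * 2pi), (b - 2pi); split; [plra|plra|].
  by rewrite -normrN (le_trans _ (ler_norm _))//; qlra.
have : n%:R * (r0 ^+ 2 / 2) <= area (a + 2pi + n%:R * 2pi) (a + 2pi).
  apply: (@outward_area m); [rewrite /m; plra| |plra|rewrite /m; plra].
  move=> w aw; rewrite le_eqVlt => /predU1P[->|wm]; first exact: ltW.
  rewrite leNgt; apply/negP => /ltW gw.
  by have := gap_pos_after aw wm (_ : m + 2pi <= b) gw; rewrite /m; plra.
move=> h; exists (a + 2pi + n%:R * 2pi), (a + 2pi); split; [plra|plra|].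
exact: le_trans h (ler_norm _).
Qed.

End Area.

End Curve.

(** * Functions of two real variables *)

Section PlaneCalculus.
Variable R : realType.
Implicit Types (f g gx gy : R -> R -> R) (u v : R -> R) (e k h : R).

(** Functions of the plane are curried, which makes partial derivatives derivatives of sections;
    continuity is joint. *)
Definition cont2 g := continuous (fun p : R * R => g p.1 p.2).

Definition C1 g gx gy := [/\ forall x y, has_der (g ^~ y) x (gx x y),
  forall x y, has_der (g x) y (gy x y), cont2 gx & cont2 gy].

Lemma cont2_eps g x y e : cont2 g -> 0 < e ->
  exists2 d, 0 < d & forall x' y', `|x' - x| < d -> `|y' - y| < d ->
    `|g x' y' - g x y| < e.
Proof.
move=> /(_ (x, y)) gc e0; move/cvgrPdist_lt/(_ e e0): gc => /nbhs_ballP[d /= d0 H].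
exists d => // x' y' xx yy; rewrite distrC; apply: (H (x', y')).
by split; rewrite /= /ball /= distrC.
Qed.

Lemma cont2D g f : cont2 g -> cont2 f -> cont2 (fun x y => g x y + f x y).
Proof. by move=> gc fc p; apply: continuousD; [exact: gc|exact: fc]. Qed.

Lemma cont2M g f : cont2 g -> cont2 f -> cont2 (fun x y => g x y * f x y).
Proof. by move=> gc fc p; apply: continuousM; [exact: gc|exact: fc]. Qed.

Lemma cont2N g : cont2 g -> cont2 (fun x y => - g x y).
Proof. by move=> gc p; apply: continuousN; exact: gc. Qed.

Lemma cont2_cst c : cont2 (fun _ _ => c).
Proof. by move=> p; exact: cst_continuous. Qed.

Lemma cont2_fst : cont2 (fun x _ => x).
Proof. by move=> p; exact: cvg_fst. Qed.

Lemma cont2_snd : cont2 (fun _ y => y).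
Proof. by move=> p; exact: cvg_snd. Qed.

Lemma cont2_comp g u v t : cont2 g -> {for t, continuous u} ->
  {for t, continuous v} -> {for t, continuous (fun s => g (u s) (v s))}.
Proof.
move=> gc uc vc.
apply: (@continuous_comp _ _ _ (fun s => (u s, v s)) (fun p : R * R => g p.1 p.2)).
  exact: (cvg_pair uc vc).
exact: gc.
Qed.

Lemma cont2_bounded g (x0 y0 r : R) : cont2 g ->
  exists2 L, 0 < L & forall x y, `|x - x0| <= r -> `|y - y0| <= r -> `|g x y| <= L.
Proof.
move=> gc; pose A := `[x0 - r, x0 + r] `*` `[y0 - r, y0 + r].
have cA : compact A by apply: compact_setX; exact: segment_compact.
have := compact_bounded (continuous_compact (continuous_subspaceT gc) cA).
move=> [M [_ HM]]; exists (`|M| + 1).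
  by rewrite ltr_wpDl.
have M1 : M < `|M| + 1 by rewrite (le_lt_trans (ler_norm M))// ltrDl.
move=> x y xx yy; apply: (HM _ M1); exists (x, y) => //.
by move: xx yy; rewrite !ler_norml => xx yy; split; rewrite /= in_itv /=; qlra.
Qed.

Lemma has_derP u t d : has_der u t d <->
  forall e, 0 < e -> exists2 k, 0 < k &
    forall h, `|h| < k -> `|u (t + h) - u t - d * h| <= e * `|h|.
Proof.
split=> [ud e e0|H].
  have [q [qE qc qt]] := (is_derive1_caratheodory u t d).1 ud.
  have [k k0 H] := cont_eps qc e0; exists k => // h hk.
  rewrite qE addrAC subrr add0r -mulrBl normrM ler_wpM2r//.
  by rewrite -qt ltW// H// addrAC subrr add0r.
apply/is_derive1_caratheodory.
exists (fun z => if z == t then d else (u z - u t) / (z - t)); rewrite eqxx; split => //.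
  by move=> z; case: eqP => [->|/eqP zt]; rewrite ?subrr ?mulr0// divfK// subr_eq0.
apply/cvgrPdist_lt => e e0; have e2 : 0 < e / 2 by qlra.
have [k k0 kH] := H _ e2; apply/nbhs_ballP; exists k => //= z; rewrite /ball /= eqxx => zt.
case: eqP => [_|/eqP zt0]; first by rewrite subrr normr0.
have zt1 : z - t != 0 by rewrite subr_eq0.
have zt2 : 0 < `|z - t| by rewrite normr_gt0.
have tz : t + (z - t) = z by ring.
have := kH (z - t); rewrite distrC => /(_ zt); rewrite tz.
have -> : u z - u t - d * (z - t) = ((u z - u t) / (z - t) - d) * (z - t).
  by field.
rewrite distrC normrM distrC ler_pM2r// distrC; qlra.
Qed.

Lemma mvt_near u du p q m k : (forall x, has_der u x (du x)) ->
  `|p - m| < k -> `|q - m| < k ->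
  exists2 c, `|c - m| < k & u p - u q = du c * (p - q).
Proof.
move=> ud; rewrite !ltr_norml => pm qm; case: (leP q p) => qp.
  have [c cI e] := der_mvt qp (fun x _ => ud x).
  by exists c => //; rewrite ltr_norml; qlra.
have [c cI e] := der_mvt (ltW qp) (fun x _ => ud x).
exists c; first by rewrite ltr_norml; qlra.
by rewrite -opprB e; ring.
Qed.

(** The mean value theorem along the two sides of a right angle. The form with two moving points is
    what allows comparing neighbours near a zero of the field, and not only a point with that
    zero. *)
Lemma strict_diff g gx gy x y e : C1 g gx gy -> 0 < e ->
  exists2 k, 0 < k & forall x1 y1 x2 y2,
    `|x1 - x| < k -> `|y1 - y| < k -> `|x2 - x| < k -> `|y2 - y| < k ->
    `|g x1 y1 - g x2 y2 - gx x y * (x1 - x2) - gy x y * (y1 - y2)|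
      <= e * (`|x1 - x2| + `|y1 - y2|).
Proof.
move=> [dx dy cx cy] e0.
have [k1 k10 H1] := cont2_eps x y cx e0.
have [k2 k20 H2] := cont2_eps x y cy e0.
exists (Num.min k1 k2); first by rewrite lt_min k10.
move=> x1 y1 x2 y2; rewrite !lt_min => /andP[a1 a2] /andP[b1 b2] /andP[c1 c2] /andP[d1 d2].
have [c cx' ec] := mvt_near (fun s => dx s y1) a1 c1.
have [c' cy' ec'] := mvt_near (dy x2) b2 d2.
have -> : g x1 y1 - g x2 y2 - gx x y * (x1 - x2) - gy x y * (y1 - y2) =
  (gx c y1 - gx x y) * (x1 - x2) + (gy x2 c' - gy x y) * (y1 - y2).
  have -> : g x1 y1 - g x2 y2 = (g x1 y1 - g x2 y1) + (g x2 y1 - g x2 y2) by ring.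
  by rewrite ec ec'; ring.
rewrite [e * _]mulrDr; apply: le_trans (ler_normD _ _) _; rewrite !normrM.
by apply: lerD; apply: ler_wpM2r => //; apply/ltW; [exact: H1|exact: H2].
Qed.

Lemma C1_cont g gx gy : C1 g gx gy -> cont2 g.
Proof.
move=> gC [x y]; apply/cvgrPdist_lt => e e0.
have [k k0 H] := strict_diff x y gC ltr01.
pose M := `|gx x y| + `|gy x y| + 2.
have M0 : 0 < M by rewrite /M ltr_wpDl// addr_ge0.
have k1 : 0 < Num.min k (e / (2 * M)) by rewrite lt_min k0 divr_gt0// mulr_gt0.
apply: filterS (nbhsx_ballx (x, y) _ k1) => -[x' y'] [/=].
rewrite /ball /= !lt_min => /andP[xx xe] /andP[yy ye].
rewrite distrC in xx; rewrite distrC in yy; rewrite distrC in xe; rewrite distrC in ye.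
have := H x' y' x y xx yy; rewrite !subrr !normr0 => /(_ k0 k0).
rewrite mul1r => h; rewrite distrC.
have -> : g x' y' - g x y = (g x' y' - g x y - gx x y * (x' - x) - gy x y * (y' - y))
   + (gx x y * (x' - x) + gy x y * (y' - y)) by ring.
apply: le_lt_trans (ler_normD _ _) _; apply: le_lt_trans (lerD h (ler_normD _ _)) _.
rewrite !normrM; set p := `|x' - x| in xe *; set q := `|y' - y| in ye *.
have xe' : p * (2 * M) < e by rewrite -ltr_pdivlMr// mulr_gt0.
have ye' : q * (2 * M) < e by rewrite -ltr_pdivlMr// mulr_gt0.
have p0 : 0 <= p by rewrite normr_ge0.
have q0 : 0 <= q by rewrite normr_ge0.
have gx0 := normr_ge0 (gx x y); have gy0 := normr_ge0 (gy x y).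
by rewrite /M in xe' ye'; nra.
Qed.

Lemma chain2 g gx gy u v t a b : C1 g gx gy -> has_der u t a -> has_der v t b ->
  has_der (fun s => g (u s) (v s)) t (gx (u t) (v t) * a + gy (u t) (v t) * b).
Proof.
move=> gC ua vb; apply/has_derP => e e0.
set p := gx _ _; set q := gy _ _.
pose M := `|a| + `|b| + 2 + `|p| + `|q|.
have M0 : 0 < M by rewrite /M; have := (normr_ge0 a, normr_ge0 b, normr_ge0 p,
  normr_ge0 q) => -[[[]]]; qlra.
pose e1 := Num.min 1 (e / M).
have e10 : 0 < e1 by rewrite lt_min ltr01 divr_gt0.
have e1M : e1 * M <= e by rewrite -ler_pdivlMr// ge_min lexx orbT.
have e11 : e1 <= 1 by rewrite ge_min lexx.
have [k k0 H] := strict_diff (u t) (v t) gC e10.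
have [k1 k10 H1] := (has_derP u t a).1 ua _ e10.
have [k2 k20 H2] := (has_derP v t b).1 vb _ e10.
have [k3 k30 H3] := cont_eps (der_cont ua) k0.
have [k4 k40 H4] := cont_eps (der_cont vb) k0.
exists (Num.min (Num.min k1 k2) (Num.min k3 k4)); first by rewrite !lt_min k10 k20 k30 k40.
move=> h; rewrite !lt_min => /andP[/andP[h1 h2] /andP[h3 h4]].
have th : t + h - t = h by ring.
have := H3 (t + h); have := H4 (t + h); rewrite !th => /(_ h4) v3 /(_ h3) u3.
have := H _ _ (u t) (v t) u3 v3; rewrite !subrr !normr0 => /(_ k0 k0) A.
have B := H1 h h1; have C := H2 h h2; rewrite -/p -/q in A.
set U := u (t + h) - u t in A B *; set V := v (t + h) - v t in A C *.
have U' : `|U| <= (`|a| + 1) * `|h|.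
  rewrite -[U in leLHS](subrK (a * h)); apply: le_trans (ler_normD _ _) _.
  by rewrite normrM (le_trans (lerD B (lexx _)))// -mulrDl ler_wpM2r// addrC lerD2l.
have V' : `|V| <= (`|b| + 1) * `|h|.
  rewrite -[V in leLHS](subrK (b * h)); apply: le_trans (ler_normD _ _) _.
  by rewrite normrM (le_trans (lerD C (lexx _)))// -mulrDl ler_wpM2r// addrC lerD2l.
have -> : g (u (t + h)) (v (t + h)) - g (u t) (v t) - (p * a + q * b) * h =
  (g (u (t + h)) (v (t + h)) - g (u t) (v t) - p * U - q * V) +
  (p * (U - a * h) + q * (V - b * h)) by ring.
apply: le_trans (ler_normD _ _) _; apply: le_trans (lerD A (ler_normD _ _)) _.
rewrite !normrM.
have p0 := normr_ge0 p; have q0 := normr_ge0 q; have hh := normr_ge0 h.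
have S1 : `|p| * `|U - a * h| <= `|p| * (e1 * `|h|) by rewrite ler_wpM2l.
have S2 : `|q| * `|V - b * h| <= `|q| * (e1 * `|h|) by rewrite ler_wpM2l.
have S3 : e1 * (`|U| + `|V|) <= e1 * ((`|a| + `|b| + 2) * `|h|).
  rewrite ler_wpM2l ?(ltW e10)//; have -> : `|a| + `|b| + 2 = (`|a| + 1) + (`|b| + 1) by ring.
  by rewrite mulrDl lerD.
apply: (@le_trans _ _ (e1 * M * `|h|)); last by rewrite ler_wpM2r.
have -> : e1 * M * `|h| = e1 * ((`|a| + `|b| + 2) * `|h|) +
  (`|p| * (e1 * `|h|) + `|q| * (e1 * `|h|)) by rewrite /M; ring.
by rewrite !lerD.
Qed.

Lemma C1_lip g gx gy (x0 y0 r : R) : C1 g gx gy ->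
  exists2 L, 0 < L & forall x y x' y',
    `|x - x0| <= r -> `|y - y0| <= r -> `|x' - x0| <= r -> `|y' - y0| <= r ->
    `|g x y - g x' y'| <= L * (`|x - x'| + `|y - y'|).
Proof.
move=> [dx dy cx cy].
have [L1 L10 H1] := cont2_bounded x0 y0 r cx.
have [L2 L20 H2] := cont2_bounded x0 y0 r cy.
exists (L1 + L2); first exact: addr_gt0.
move=> x y x' y' xr yr xr' yr'.
have near z z' w0 c : `|z - w0| <= r -> `|z' - w0| <= r ->
    Num.min z z' <= c <= Num.max z z' -> `|c - w0| <= r.
  by rewrite !ler_norml; case: (leP z z'); qlra.
have mvt (u du : R -> R) z z' : (forall s, has_der u s (du s)) ->
    exists2 c, Num.min z z' <= c <= Num.max z z' & u z - u z' = du c * (z - z').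
  move=> ud; case: (leP z z') => zz.
    have [c cI e] := der_mvt zz (fun s _ => ud s).
    by exists c => //; rewrite -opprB e; ring.
  by have [c cI e] := der_mvt (ltW zz) (fun s _ => ud s); exists c.
have [c cI ec] := mvt _ _ x x' (fun s => dx s y).
have [c' cI' ec'] := mvt _ _ y y' (dy x').
have -> : g x y - g x' y' = (g x y - g x' y) + (g x' y - g x' y') by ring.
rewrite ec ec'; apply: le_trans (ler_normD _ _) _; rewrite !normrM.
have A : `|gx c y| <= L1 by apply: H1 => //; apply: near cI.
have B : `|gy x' c'| <= L2 by apply: H2 => //; apply: near cI'.
have := normr_ge0 (x - x'); have := normr_ge0 (y - y'); nra.
Qed.

(** The second difference of [f] over a small square, evaluated by the mean value theorem in both
    orders. *)
Lemma schwarz f fx fy fxy fyx :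
  (forall x y, has_der (f ^~ y) x (fx x y)) -> (forall x y, has_der (f x) y (fy x y)) ->
  (forall x y, has_der (fx x) y (fxy x y)) -> (forall x y, has_der (fy ^~ y) x (fyx x y)) ->
  cont2 fxy -> cont2 fyx -> forall x y, fxy x y = fyx x y.
Proof.
move=> dx dy dxy dyx cxy cyx x y.
apply/eqP; rewrite -subr_eq0 -normr_le0; apply/ler_addgt0Pl => e e0; rewrite addr0.
have e2 : 0 < e / 2 by qlra.
have [k1 k10 H1] := cont2_eps x y cxy e2.
have [k2 k20 H2] := cont2_eps x y cyx e2.
pose k := Num.min k1 k2; pose h := k / 2.
have k0 : 0 < k by rewrite lt_min k10.
have h0 : 0 < h by rewrite /h; qlra.
have hk1 : h < k1.
  by apply: (@lt_le_trans _ _ k); [rewrite /h; qlra|rewrite /k ge_min lexx].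
have hk2 : h < k2.
  by apply: (@lt_le_trans _ _ k); [rewrite /h; qlra|rewrite /k ge_min lexx orbT].
clearbody h; have near (z w l : R) : z <= w <= z + h -> h < l -> `|w - z| < l.
  move=> /andP[zw wh] hl; rewrite ger0_norm ?subr_ge0// ltrBlDl.
  by apply: le_lt_trans wh _; rewrite ltrD2l.
have xh : x <= x + h by qlra.
have yh : y <= y + h by qlra.
have [c cI ec] := @der_mvt _ (fun s => f s (y + h) - f s y) (fun s =>
  fx s (y + h) - fx s y) _ _ xh
  (fun s _ => derD (dx s (y + h)) (derN (dx s y))).
have [c' cI' ec'] := der_mvt yh (fun s _ => dxy c s).
have [d dI ed] := @der_mvt _ (fun s => f (x + h) s - f x s) (fun s =>
  fy (x + h) s - fy x s) _ _ yh
  (fun s _ => derD (dy (x + h) s) (derN (dy x s))).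
have [d' dI' ed'] := der_mvt xh (fun s _ => dyx s d).
have E : fxy c c' = fyx d' d.
  have hh : h * h != 0 by rewrite mulf_neq0// gt_eqF.
  have xx : x + h - x = h by ring.
  have yy : y + h - y = h by ring.
  rewrite /= xx in ec ed'; rewrite /= yy in ec' ed.
  have E1 : fxy c c' * (h * h) = fyx d' d * (h * h).
    by rewrite !mulrA -ec' -ed' -ec -ed; ring.
  exact: mulIf hh _ _ E1.
have A : `|fxy c c' - fxy x y| < e / 2 by apply: H1; exact: near.
have B : `|fyx d' d - fyx x y| < e / 2 by apply: H2; exact: near.
rewrite E in A; rewrite distrC in A.
by have := ler_distD (fyx d' d) (fxy x y) (fyx x y); qlra.
Qed.

End PlaneCalculus.

(** * Picard's existence theorem *)

Section Antiderivative.
Variable R : realType.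

(** Integrating from -1 makes 0 an interior point, so that derivatives at the initial time are
    two-sided. *)
Lemma antiderivative (g : R -> R) : continuous g ->
  exists G, forall t, -1 < t -> has_der G t (g t).
Proof.
move=> gc; exists (fun t => (\int[lebesgue_measure]_(s in `[-1, t]) g s)%R) => t t1.
have tt : t < t + 1 by rewrite ltrDl.
have gi : lebesgue_measure.-integrable `[-1, t + 1] (EFin \o g).
  apply: continuous_compact_integrable; first exact: segment_compact.
  exact: continuous_subspaceT.
have [d dE] := continuous_FTC1_closed tt gi t1 (gc t).
apply: DeriveDef; first exact: d.
by rewrite -derive1E; exact: dE.
Qed.

(** Nested intervals around the terms; the explicit rate makes the limit of the Picard iterates
    locally uniform. *)
Lemma geometric_limit (u : nat -> R) c : 0 <= c ->
  (forall n, `|u n.+1 - u n| <= c / 2 ^+ n) ->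
  exists l, forall n, `|l - u n| <= 2 * c / 2 ^+ n.
Proof.
move=> c0 uc; pose v n := u n - 2 * c / 2 ^+ n; pose w n := u n + 2 * c / 2 ^+ n.
have half n : 2 * c / 2 ^+ n.+1 = c / 2 ^+ n.
  by rewrite exprS; field; rewrite expf_neq0.
have dbl n : 2 * c / 2 ^+ n = c / 2 ^+ n + c / 2 ^+ n by rewrite -mulrA mulr_natl mulr2n.
have vS n : v n <= v n.+1.
  by rewrite /v half dbl; have := uc n; rewrite ler_norml => /andP[]; qlra.
have wS n : w n.+1 <= w n.
  by rewrite /w half dbl; have := uc n; rewrite ler_norml => /andP[]; qlra.
have vn : nondecreasing_seq v by apply/nondecreasing_seqP.
have wn : nonincreasing_seq w by apply/nonincreasing_seqP.
have vw n : v n <= w n.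
  have : 0 <= 2 * c / 2 ^+ n by rewrite divr_ge0 ?mulr_ge0// exprn_ge0.
  by rewrite /v /w; qlra.
have vwm n m : v n <= w m.
  apply: (le_trans (vn _ _ (leq_maxl n m))); apply: (le_trans (vw _)).
  exact: (wn _ _ (leq_maxr n m)).
have hs : has_sup (range v).
  by split; [exists (v 0%N); exists 0%N | exists (w 0%N) => _ [n _ <-]].
exists (sup (range v)) => n; rewrite ler_norml.
have h1 : v n <= sup (range v) by apply: ub_le_sup; [exact: hs.2|exists n].
have h2 : sup (range v) <= w n by apply: ge_sup; [exact: hs.1|move=> _ [m _ <-]].
by move: h1 h2; rewrite /v /w; qlra.
Qed.

Lemma small_geometric (c e : R) : 0 <= c -> 0 < e -> exists n, c / 2 ^+ n < e.
Proof.
move=> c0 e0; exists (Num.bound (c / e)).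
have h := archi_boundP (divr_ge0 c0 (ltW e0)).
set n := Num.bound _ in h *.
have h2 : (n%:R : R) <= 2 ^+ n by rewrite -natrX ler_nat ltnW// ltn_expl.
rewrite ltr_pdivrMr ?exprn_gt0// mulrC -ltr_pdivrMr//.
exact: lt_le_trans h h2.
Qed.

Lemma eq_of_geometric (a b c : R) : 0 <= c -> (forall n, `|a - b| <= c / 2 ^+ n) -> a = b.
Proof.
move=> c0 h; apply/eqP; rewrite -subr_eq0 -normr_le0; apply/ler_addgt0Pl => e e0.
by rewrite addr0; have [n /ltW hn] := small_geometric c0 e0; apply: le_trans hn.
Qed.

(** Integrating an exponential bound gains a factor [K^-1]. In the norm weighted by
    [expR (4 * L * t)], the Picard operator is therefore a contraction on the whole half-line, and
    no local solutions have to be glued. *)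
Lemma exp_growth (f df : R -> R) (M K t : R) : 0 <= t -> 0 < K -> f 0 = 0 ->
  0 <= M ->
  (forall s, 0 <= s -> has_der f s (df s)) ->
  (forall s, 0 <= s -> `|df s| <= M * expR (K * s)) ->
  `|f t| <= M / K * expR (K * t).
Proof.
move=> t0 K0 f0 M0 fd fb.
have ed s : has_der (fun s => M / K * expR (K * s)) s (M * expR (K * s)).
  by apply: der_eq; [do !der1|cbv beta; field; rewrite gt_eqF].
have st s : 0 <= s <= t -> 0 <= s by case/andP.
have h1 := @der_ge0_le R (fun s => M / K * expR (K * s) - f s) (fun s =>
  M * expR (K * s) - df s) _ _ t0
  (fun s sI => derD (ed s) (derN (fd s (st _ sI)))).
have h2 := @der_ge0_le R (fun s => M / K * expR (K * s) + f s) (fun s =>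
  M * expR (K * s) + df s) _ _ t0
  (fun s sI => derD (ed s) (fd s (st _ sI))).
have MK : 0 <= M / K by rewrite divr_ge0// ltW.
have {}h1 := h1 (fun s sI => ltac:(by have := fb s (st _ sI);
  rewrite ler_norml subr_ge0 => /andP[])).
have {}h2 := h2 (fun s sI => ltac:(by have := fb s (st _ sI); rewrite ler_norml => /andP[];
  qlra)).
move: h1 h2; rewrite f0 mulr0 expR0 mulr1 ler_norml; qlra.
Qed.

Lemma max0_cont : continuous (fun t : R => Num.max t 0).
Proof.
move=> t; apply: (@continuous_max _ _ id (fun=> 0)); first exact: cvg_id.
exact: cst_continuous.
Qed.

End Antiderivative.

Section Picard.
Variables (R : realType) (P Q : R -> R -> R) (L x0 y0 : R).
Hypothesis L0 : 0 < L.
Hypothesis Plip : forall x y x' y',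
  `|P x y - P x' y'| <= L * (`|x - x'| + `|y - y'|).
Hypothesis Qlip : forall x y x' y',
  `|Q x y - Q x' y'| <= L * (`|x - x'| + `|y - y'|).

Local Notation pos t := (Num.max (t : R) (0 : R)).
Implicit Types s t r : R.

Lemma lip_cont2 (F : R -> R -> R) : (forall x y x' y',
  `|F x y - F x' y'| <= L * (`|x - x'| + `|y - y'|)) -> cont2 F.
Proof.
move=> Flip [x y]; apply/cvgrPdist_lt => e e0.
have l0 := L0.
have k1 : 0 < e / (2 * L) by rewrite divr_gt0// mulr_gt0.
apply: filterS (nbhsx_ballx (x, y) _ k1) => -[x' y'] [/=].
rewrite /ball /= => h1 h2; apply: le_lt_trans (Flip _ _ _ _) _.
move: h1 h2; rewrite !ltr_pdivlMr ?mulr_gt0//; nra.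
Qed.

(** [w'] is the Picard iterate of [w]. Evaluating at [pos t] extends [w] to the left of 0 by its
    initial value, which makes the integrand continuous on the whole line. *)
Let step (w w' : (R -> R) * (R -> R)) :=
  [/\ w'.1 0 = x0, w'.2 0 = y0 &
   forall t, -1 < t -> has_der w'.1 t (P (w.1 (pos t)) (w.2 (pos t))) /\
     has_der w'.2 t (Q (w.1 (pos t)) (w.2 (pos t)))].

Let posc (w : (R -> R) * (R -> R)) :=
  continuous (fun t : R => w.1 (pos t)) /\ continuous (fun t : R => w.2 (pos t)).

Let step_ex w : exists w', posc w -> step w w'.
Proof.
have [[c1 c2]|nc] := pselect (posc w); last by exists w.
have cP : continuous (fun t : R => P (w.1 (pos t)) (w.2 (pos t))).
  by move=> t; apply: (@cont2_comp _ P (fun s => w.1 (pos s)) (fun s => w.2 (pos s)));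
    [exact: lip_cont2|exact: c1|exact: c2].
have cQ : continuous (fun t : R => Q (w.1 (pos t)) (w.2 (pos t))).
  by move=> t; apply: (@cont2_comp _ Q (fun s => w.1 (pos s)) (fun s => w.2 (pos s)));
    [exact: lip_cont2|exact: c1|exact: c2].
have [F FE] := antiderivative cP; have [G GE] := antiderivative cQ.
exists (fun t => x0 - F 0 + F t, fun t => y0 - G 0 + G t) => _.
split; [exact: subrK|exact: subrK|move=> t t1; split].
  by apply: der_eq; [apply: derD; [exact: der_cst|exact: FE]|rewrite add0r].
by apply: der_eq; [apply: derD; [exact: der_cst|exact: GE]|rewrite add0r].
Qed.

Let step_posc w w' : step w w' -> posc w'.
Proof.
move=> [_ _ H]; split=> t.
  apply: (@continuous_comp _ _ _ (fun t : R => pos t) w'.1); first exact: max0_cont.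
  have p1 : -1 < pos t by rewrite lt_max ltrN10 orbT.
  exact: (der_cont (H _ p1).1).
apply: (@continuous_comp _ _ _ (fun t : R => pos t) w'.2); first exact: max0_cont.
have p1 : -1 < pos t by rewrite lt_max ltrN10 orbT.
exact: (der_cont (H _ p1).2).
Qed.

(** Contraction by 1/2: the Lipschitz bound over two coordinates costs [2 * L], the integration of
    the weight gains [4 * L]. *)
Let step_close w1 w1' w2 w2' M : step w1 w1' -> step w2 w2' -> 0 <= M ->
  (forall t, 0 <= t -> `|w1.1 t - w2.1 t| <= M * expR (4 * L * t) /\
     `|w1.2 t - w2.2 t| <= M * expR (4 * L * t)) ->
  forall t, 0 <= t -> `|w1'.1 t - w2'.1 t| <= M / 2 * expR (4 * L * t) /\
     `|w1'.2 t - w2'.2 t| <= M / 2 * expR (4 * L * t).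
Proof.
move=> [x1 y1 d1] [x2 y2 d2] M0 H t t0; have l0 := L0.
have K0 : 0 < 4 * L by rewrite mulr_gt0.
have ML : M / 2 = 2 * L * M / (4 * L) by field; rewrite gt_eqF.
have M0' : 0 <= 2 * L * M by rewrite mulr_ge0// mulr_ge0// ltW.
have s1 (s : R) : 0 <= s -> -1 < s by qlra.
have bound (F : R -> R -> R) s : (forall x y x' y',
    `|F x y - F x' y'| <= L * (`|x - x'| + `|y - y'|)) -> 0 <= s ->
    `|F (w1.1 (pos s)) (w1.2 (pos s)) - F (w2.1 (pos s)) (w2.2 (pos s))|
      <= 2 * L * M * expR (4 * L * s).
  move=> Flip s0; have -> : pos s = s by apply/max_idPl.
  apply: le_trans (Flip _ _ _ _) _; have [h1 h2] := H s s0.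
  have -> : 2 * L * M * expR (4 * L * s) =
    L * (M * expR (4 * L * s) + M * expR (4 * L * s)) by ring.
  by rewrite ler_wpM2l ?lerD// ltW.
rewrite ML; split.
  apply: (@exp_growth R (fun s => w1'.1 s - w2'.1 s)
  (fun s => P (w1.1 (pos s)) (w1.2 (pos s)) - P (w2.1 (pos s)) (w2.2 (pos s))) _ _ _ t0 K0 _ M0'
  (fun s hs => derD (d1 s (s1 s hs)).1 (derN (d2 s (s1 s hs)).1))).
    by rewrite x1 x2 subrr.
  by move=> s; exact: bound.
apply: (@exp_growth R (fun s => w1'.2 s - w2'.2 s)
  (fun s => Q (w1.1 (pos s)) (w1.2 (pos s)) - Q (w2.1 (pos s)) (w2.2 (pos s))) _ _ _ t0 K0 _ M0'
  (fun s hs => derD (d1 s (s1 s hs)).2 (derN (d2 s (s1 s hs)).2))).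
  by rewrite y1 y2 subrr.
by move=> s; exact: bound.
Qed.

Lemma picard : exists x y : R -> R, [/\ x 0 = x0, y 0 = y0 &
  forall t, 0 <= t -> has_der x t (P (x t) (y t)) /\ has_der y t (Q (x t) (y t))].
Proof.
have l0 := L0; have [Phi PhiE] := choice step_ex.
pose w n := iter n Phi (fun=> x0, fun=> y0).
have wc n : posc (w n).
  elim: n => [|n IHn]; first by split=> t; exact: cst_continuous.
  exact: step_posc (PhiE _ IHn).
have wS n : step (w n) (w n.+1) by exact: PhiE (wc n).
pose B := `|P x0 y0| + `|Q x0 y0|; pose B4 := B / (4 * L).
have K0 : 0 < 4 * L by rewrite mulr_gt0.
have B0 : 0 <= B by rewrite addr_ge0.
have B40 : 0 <= B4 by rewrite divr_ge0// ltW.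
have E1 s : 0 <= s -> 1 <= expR (4 * L * s).
  by move=> s0; rewrite -[X in X <= _]expR0 ler_expR mulr_ge0// ltW.
have E0 s : 0 <= expR (4 * L * s) by exact: expR_ge0.
have s1 (s : R) : 0 <= s -> -1 < s by qlra.
have wd n t : 0 <= t -> `|(w n.+1).1 t - (w n).1 t| <= B4 / 2 ^+ n * expR (4 * L * t) /\
    `|(w n.+1).2 t - (w n).2 t| <= B4 / 2 ^+ n * expR (4 * L * t).
  elim: n t => [|n IHn] t t0.
    have [X Y H] := wS 0%N; rewrite expr0 divr1; split.
      apply: (@exp_growth R (fun s => (w 1%N).1 s - x0)
        (fun s => P x0 y0 - 0) _ _ _ t0 K0 _ B0
        (fun s hs => derD (H s (s1 s hs)).1 (derN (der_cst x0 s)))).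
        by rewrite X subrr.
      move=> s s0 /=; rewrite subr0 -[X in X <= _]mulr1.
      by apply: ler_pM => //; [rewrite lerDl|exact: E1].
    apply: (@exp_growth R (fun s => (w 1%N).2 s - y0)
        (fun s => Q x0 y0 - 0) _ _ _ t0 K0 _ B0
        (fun s hs => derD (H s (s1 s hs)).2 (derN (der_cst y0 s)))).
      by rewrite Y subrr.
    move=> s s0 /=; rewrite subr0 -[X in X <= _]mulr1.
    by apply: ler_pM => //; [rewrite lerDr|exact: E1].
  have -> : B4 / 2 ^+ n.+1 = B4 / 2 ^+ n / 2.
    by rewrite exprS; field; rewrite expf_neq0.
  apply: (step_close (wS n.+1) (wS n) _ IHn t0).
  by rewrite divr_ge0// exprn_ge0.
have lim t : exists l : R * R, 0 <= t -> forall n,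
    `|l.1 - (w n).1 t| <= 2 * (B4 * expR (4 * L * t)) / 2 ^+ n /\
    `|l.2 - (w n).2 t| <= 2 * (B4 * expR (4 * L * t)) / 2 ^+ n.
  case: (leP 0 t) => [t0|]; last by exists (0, 0).
  have c0 : 0 <= B4 * expR (4 * L * t) by rewrite mulr_ge0.
  have [|l1 h1] := @geometric_limit R (fun n => (w n).1 t) _ c0.
    by move=> n; rewrite mulrAC; exact: (wd n t t0).1.
  have [|l2 h2] := @geometric_limit R (fun n => (w n).2 t) _ c0.
    by move=> n; rewrite mulrAC; exact: (wd n t t0).2.
  by exists (l1, l2).
have [l lE] := choice lim.
pose v := (fun t => (l t).1, fun t => (l t).2).
(* A locally uniform limit of continuous functions; [T] bounds the weight near [t]. *)
have vc : posc v.
  have gen (p : nat -> R -> R) (q : R -> R) :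
      (forall n t, 0 <= t -> `|q t - p n t| <= 2 * (B4 * expR (4 * L * t)) / 2 ^+ n) ->
      (forall n, continuous (fun t : R => p n (pos t))) -> continuous (fun t : R => q (pos t)).
    move=> qp pc t; apply/cvgrPdist_lt => e e0.
    pose T := pos t + 1.
    have c0 : 0 <= 2 * (B4 * expR (4 * L * T)) by rewrite mulr_ge0// mulr_ge0.
    have e3 : 0 < e / 3 by qlra.
    have [n hn] := small_geometric c0 e3.
    have [k k0 H] := cont_eps (pc n t) e3.
    have [k2 k20 H2] := cont_eps (@max0_cont R t) ltr01.
    apply/nbhs_ballP; exists (Num.min k k2) => //=; first by rewrite lt_min k0.
    move=> s; rewrite /ball /= lt_min distrC => /andP[sk sk2].
    have near r : `|pos r - pos t| < 1 -> `|q (pos r) - p n (pos r)| < e / 3.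
      move=> rt; apply: le_lt_trans hn; apply: le_trans (qp n (pos r) _) _.
        by rewrite le_max lexx orbT.
      rewrite ler_wpM2r ?invr_ge0 ?exprn_ge0// ler_wpM2l// ler_wpM2l//.
      rewrite ler_expR ler_wpM2l//; first exact: ltW.
      by move: rt; rewrite ltr_norml /T; qlra.
    have h1 := near t; rewrite subrr normr0 in h1; have {}h1 := h1 ltr01.
    have h2 := near s (H2 s sk2); have h3 := H s sk.
    rewrite ltr_norml in h1; rewrite ltr_norml in h2; rewrite ltr_norml in h3.
    by rewrite ltr_norml; qlra.
  split.
    apply: (gen (fun n => (w n).1)) => [n t t0|n]; first exact: (lE t t0 n).1.
    exact: (wc n).1.
  apply: (gen (fun n => (w n).2)) => [n t t0|n]; first exact: (lE t t0 n).2.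
  exact: (wc n).2.
(* One further step from the limit is differentiable and, by contraction, equal to the limit. *)
have [v' v'S] := step_ex v; have {}v'S := v'S vc.
have vv' t : 0 <= t -> v'.1 t = v.1 t /\ v'.2 t = v.2 t.
  move=> t0.
  have cl n : `|v'.1 t - (w n.+1).1 t| <= 2 * B4 / 2 ^+ n / 2 * expR (4 * L * t) /\
      `|v'.2 t - (w n.+1).2 t| <= 2 * B4 / 2 ^+ n / 2 * expR (4 * L * t).
    apply: (step_close v'S (wS n) _ _ t0); first by apply: divr_ge0;
      [rewrite mulr_ge0|rewrite exprn_ge0].
    move=> s s0; have [h1 h2] := lE s s0 n.
    have e : 2 * B4 / 2 ^+ n * expR (4 * L * s) = 2 * (B4 * expR (4 * L * s)) / 2 ^+ n by ring.
    by rewrite e.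
  have c0 : 0 <= B4 * expR (4 * L * t) by rewrite mulr_ge0.
  have e1 n : 2 * B4 / 2 ^+ n / 2 * expR (4 * L * t) = B4 * expR (4 * L * t) / 2 ^+ n.
    by field; rewrite expf_neq0.
  have e2 n : 2 * (B4 * expR (4 * L * t)) / 2 ^+ n.+1 = B4 * expR (4 * L * t) / 2 ^+ n.
    by rewrite exprS; field; rewrite expf_neq0.
  have e3 n : 2 * (B4 * expR (4 * L * t)) / 2 ^+ n =
    B4 * expR (4 * L * t) / 2 ^+ n + B4 * expR (4 * L * t) / 2 ^+ n by ring.
  have c20 : 0 <= 2 * (B4 * expR (4 * L * t)) by rewrite mulr_ge0.
  split; apply: (eq_of_geometric c20) => n; have [h1 h2] := cl n;
    have [h3 h4] := lE t t0 n.+1; rewrite e1 in h1; rewrite e1 in h2;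
    rewrite e2 in h3; rewrite e2 in h4; rewrite e3.
    rewrite distrC in h3; exact: le_trans (ler_distD _ _ _) (lerD h1 h3).
  rewrite distrC in h4; exact: le_trans (ler_distD _ _ _) (lerD h2 h4).
exists v'.1, v'.2; have [X Y H] := v'S; split => // t t0.
have [ex ey] := vv' t t0; have [d1 d2] := H t (s1 t t0).
have pt : pos t = t by apply/max_idPl.
by rewrite pt in d1 d2; rewrite ex ey.
Qed.

End Picard.

Lemma cont2_vert (R : realType) (g : R -> R -> R) (a b : R) :
  cont2 g -> {for b, continuous (g a)}.
Proof.
move=> gc; apply: (@cont2_comp _ g (fun=> a) id) => //; exact: cst_continuous.
Qed.

(** * Zeros of the field *)

Section DominatedSign.
Variable R : realType.
Implicit Types a u v x w l c s : R.

(** [u] keeps the sign of [a], [v] has the sign of [s], and [x] is close enough to [c * (u * v)] to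
    share its sign. They stand for [al], [be] and [n] at distance [w] above or below a zero of
    [be]. *)
Lemma dominated_sign a u v x w l c s : 0 < l -> 0 < w -> w = `|a| -> c != 0 -> `|s| = 1 ->
  `|u - a| <= w / 2 -> `|v - l * (s * w)| <= l / 4 * w ->
  `|x - c * (u * v)| <= `|c| * l / 8 * w ^+ 2 -> 0 < s * (c * a) * x.
Proof.
move=> l0 w0 wE c0 s1 hu hv hx.
have ss : s * s = 1 by rewrite -expr2 -real_normK ?num_real// s1 expr1n.
have aw : a * a = w * w by rewrite wE -!expr2 real_normK ?num_real.
have cc : `|c| * `|c| = c * c by rewrite -!expr2 real_normK ?num_real.
have c1 : 0 < `|c| by rewrite normr_gt0.
have U : w * w / 2 <= a * u.
  have h1 := ler_norm (- (a * (u - a))); rewrite normrN normrM -wE in h1.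
  have h2 : w * `|u - a| <= w * (w / 2) by rewrite ler_wpM2l// ltW.
  have -> : a * u = a * a + a * (u - a) by ring.
  by rewrite aw; qlra.
have V : 3 / 4 * l * w <= s * v.
  have h1 := ler_norm (- (s * (v - l * (s * w)))); rewrite normrN normrM s1 mul1r in h1.
  have -> : s * v = s * s * (l * w) + s * (v - l * (s * w)) by ring.
  by rewrite ss; qlra.
have lw : 0 < l * w by exact: mulr_gt0.
have ww : 0 < w * w by exact: mulr_gt0.
have UV : w * w / 2 * (3 / 4 * l * w) <= (a * u) * (s * v).
  by apply: ler_pM => //; [qlra|rewrite -mulrA; qlra].
have Y : - (`|c| * w * (`|c| * l / 8 * w ^+ 2)) <= s * (c * a) * (x - c * (u * v)).
  rewrite lerNl; apply: le_trans (ler_norm _) _; rewrite normrN !normrM s1 mul1r -wE.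
  by rewrite ler_wpM2l// mulr_ge0// ltW.
have -> : s * (c * a) * x = c * c * ((a * u) * (s * v)) + s * (c * a) * (x - c * (u * v)).
  by ring.
have Z : c * c * (w * w / 2 * (3 / 4 * l * w)) <= c * c * ((a * u) * (s * v)).
  by rewrite ler_wpM2l// -expr2 sqr_ge0.
have T : 0 < c * c * (l * (w * (w * w))) by rewrite -cc !mulr_gt0.
have Y' : `|c| * w * (`|c| * l / 8 * w ^+ 2) = c * c * (l * (w * (w * w))) / 8.
  by rewrite -cc; field.
rewrite Y' in Y; clear -Y Z T; qlra.
Qed.

End DominatedSign.

Section Slopes.
Variable R : realType.

(** As [r] does not vanish, it keeps a sign [sg]; then [sg * b + 4 * a] and [sg * b - 4 * a] are
    nondecreasing, and the curve stays in a cone about the direction of [b]. *)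
Lemma slope_mono (a b p r : R -> R) (s t : R) : s <= t ->
  (forall u, s <= u <= t -> has_der a u (p u)) ->
  (forall u, s <= u <= t -> has_der b u (r u)) ->
  (forall u, s <= u <= t -> {for u, continuous r}) ->
  (forall u, s <= u <= t -> 4 * `|p u| <= `|r u| /\ r u != 0) ->
  exists sg : R, [/\ sg = 1 \/ sg = -1, 0 < sg * r s & 4 * `|a t - a s| <= sg * (b t - b s)].
Proof.
move=> st aE bE rc pr; have ss : s <= s <= t by rewrite lexx.
have const u : s <= u <= t -> 0 < r s * r u.
  move=> /andP[su ut]; rewrite ltNge; apply/negP => h.
  have [|q /andP[sq qu] q0] := @ivt_zero R r s u su _ h.
    by move=> q /andP[q1 q2]; apply: rc; rewrite q1 (le_trans q2 ut).
  have qI : s <= q <= t by rewrite sq (le_trans qu ut).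
  by have [_] := pr q qI; rewrite q0 eqxx.
have [sg sg1 sgr] : exists2 sg : R, sg = 1 \/ sg = -1 & forall u, s <= u <= t -> 0 < sg * r u.
  have [_ rs] := pr s ss; case: (ltP 0 (r s)) => hs.
    by exists 1; [left|move=> u uI; rewrite mul1r -(pmulr_rgt0 _ hs) const].
  have {}hs : r s < 0 by rewrite lt_neqAle rs.
  exists (-1); first by right.
  by move=> u uI; rewrite mulN1r oppr_gt0 -(nmulr_rgt0 _ hs) const.
exists sg; split => //; first exact: sgr.
have mono (q : R) : `|q| = 4 -> sg * b s + q * a s <= sg * b t + q * a t.
  move=> q4; apply: (der_ge0_le st (g := fun t => sg * b t + q * a t)
    (dg := fun t => sg * r t + q * p t)) => u uI.
    by have dA := aE u uI; have dB := bE u uI; der; ring.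
  have [h _] := pr u uI; have h2 := sgr u uI.
  have h3 : sg * r u = `|r u|.
    by rewrite -[LHS]gtr0_norm// normrM; case: sg1 => ->; rewrite ?normrN normr1 mul1r.
  have := ler_norm (- (q * p u)); rewrite normrN normrM q4; qlra.
have m4 := mono 4 (normr_nat _ 4); have m4' := mono (-4) (etrans (normrN _) (normr_nat _ 4)).
by rewrite -lter_pdivlMl// ler_norml; qlra.
Qed.

(** A curve in such a cone cannot go from the boundary of the square of half-side [k / 2] into the
    one of half-side [k / 8]. The cone limits the variation of [a], so the start has [|b0| = k / 2];
    there [r] has the sign of [b0] and drives [b] outwards. *)
Lemma no_entry (k l a1 b1 a0 b0 r sg : R) : 0 < k -> 0 < l -> sg = 1 \/ sg = -1 ->
  Num.max `|a0| `|b0| = k / 2 -> `|a1| < k / 8 -> `|b1| < k / 8 ->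
  4 * `|a1 - a0| <= sg * (b1 - b0) -> 0 < sg * r ->
  `|r - l * b0| <= l / 8 * (`|a0| + `|b0|) -> False.
Proof.
move=> k0 l0 sg1 m ha hb sl rs rl.
have [a0k b0k] : `|a0| <= k / 2 /\ `|b0| <= k / 2 by rewrite -m !le_max !lexx orbT.
have lk := mulr_gt0 l0 k0.
have rl' : `|r - l * b0| <= l * k / 8.
  apply: le_trans rl _; have -> : l * k / 8 = l / 8 * (k / 2 + k / 2) by field.
  by rewrite ler_wpM2l ?lerD// divr_ge0// ltW.
have a0k' : `|a0| < k / 2.
  have h1 : `|a0| <= `|a1| + `|a1 - a0|.
    by have := ler_normB a1 (a1 - a0); rewrite subKr.
  have h2 : sg * (b1 - b0) <= `|b1| + `|b0|.
    apply: le_trans (ler_norm _) _; rewrite normrM.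
    have -> : `|sg| = 1 by case: sg1 => ->; rewrite ?normrN normr1.
    by rewrite mul1r ler_normB.
  qlra.
have b0E : `|b0| = k / 2.
  by move: m a0k'; case: (leP `|a0| `|b0|) => // _ -> ; rewrite ltxx.
move: hb rl'; rewrite ltr_norml ler_norml => /andP[hb1 hb2] /andP[rl1 rl2].
have na := normr_ge0 (a1 - a0).
case: (leP 0 b0) => hb0; [rewrite ger0_norm// in b0E|rewrite ltr0_norm// in b0E].
  by case: sg1 => e; rewrite e b0E in rs sl rl1 rl2; qlra.
have {}b0E : b0 = - (k / 2) by qlra.
by case: sg1 => e; rewrite e b0E in rs sl rl1 rl2; qlra.
Qed.
End Slopes.

(** * A zero with real eigenvalues, in eigencoordinates *)

Section Saddle.
Variables (R : realType) (al be n : R -> R -> R) (la lb c : R).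
Implicit Types a b e k t s q r : R.
Hypothesis lb_gt0 : 0 < lb.
Hypothesis c_neq0 : c != 0.
Hypothesis al00 : al 0 0 = 0.
Hypothesis be00 : be 0 0 = 0.

(** In this section [al] and [be] are the components of the field in an eigenbasis, [la] and [lb]
    the eigenvalues at the zero, and [n] is the bending, close to [c * (al * be)]. *)
Definition strict_der_at0 (g : R -> R -> R) (ga gb e k : R) := forall a1 b1 a2 b2,
  `|a1| < k -> `|b1| < k -> `|a2| < k -> `|b2| < k ->
  `|g a1 b1 - g a2 b2 - (ga * (a1 - a2) + gb * (b1 - b2))| <=
    e * (`|a1 - a2| + `|b1 - b2|).

Hypothesis al_diff : forall e, 0 < e -> exists2 k, 0 < k & strict_der_at0 al la 0 e k.
Hypothesis be_diff : forall e, 0 < e -> exists2 k, 0 < k & strict_der_at0 be 0 lb e k.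
Hypothesis n_near : forall e, 0 < e -> exists2 k, 0 < k & forall a b,
  `|a| < k -> `|b| < k ->
  `|n a b - c * (al a b * be a b)| <= e * (al a b ^+ 2 + be a b ^+ 2).
Hypothesis n_cont : cont2 n.
Hypothesis be_cont : cont2 be.
Hypothesis n_eq0 : forall a b, n a b = 0 -> al a b = 0 /\ be a b = 0.

Lemma strict_der_le g ga gb e k k' : k' <= k ->
  strict_der_at0 g ga gb e k -> strict_der_at0 g ga gb e k'.
Proof. by move=> kk H a1 b1 a2 b2 *; apply: H; exact: lt_le_trans kk. Qed.

Lemma common_nbhd e e' k0 : 0 < e -> 0 < e' -> 0 < k0 -> exists k, [/\ 0 < k <= k0,
  strict_der_at0 al la 0 e k, strict_der_at0 be 0 lb e k & forall a b,
  `|a| < k -> `|b| < k ->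
  `|n a b - c * (al a b * be a b)| <= e' * (al a b ^+ 2 + be a b ^+ 2)].
Proof.
move=> e0 e'0 k00.
have [k1 k10 A] := al_diff e0; have [k2 k20 B] := be_diff e0.
have [k3 k30 N] := n_near e'0.
exists (Num.min (Num.min k0 k1) (Num.min k2 k3)); split.
- by rewrite !lt_min k00 k10 k20 k30 /= !ge_min lexx.
- by apply: strict_der_le A; rewrite !ge_min lexx !orbT.
- by apply: strict_der_le B; rewrite !ge_min lexx !orbT.
- move=> a b; rewrite !lt_min => /andP[_ /andP[_ ak]] /andP[_ /andP[_ bk]].
  exact: N.
Qed.

Lemma strict_der_val g ga gb e k a b : g 0 0 = 0 -> 0 < k ->
  strict_der_at0 g ga gb e k -> `|a| < k -> `|b| < k ->
  `|g a b - (ga * a + gb * b)| <= e * (`|a| + `|b|).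
Proof.
move=> g0 k0 H ak bk; have := H a b 0 0 ak bk.
by rewrite g0 !subr0; apply; rewrite normr0.
Qed.

Lemma strict_der_vert g ga gb e k a b b' : strict_der_at0 g ga gb e k ->
  `|a| < k -> `|b| < k -> `|b'| < k ->
  `|g a b' - g a b - gb * (b' - b)| <= e * `|b' - b|.
Proof.
move=> H ak bk bk'; have := H a b' a b ak bk' ak bk.
by rewrite subrr mulr0 normr0 !add0r.
Qed.

(* If al did not vanish where be does, n would change sign on a segment a = cst
   on which al does not vanish. *)
Lemma zero_curve : exists2 k, 0 < k & forall a, `|a| < k ->
  exists b, [/\ `|b| <= `|a|, al a b = 0 & be a b = 0].
Proof.
have lb0 := lb_gt0; have c0 : 0 < `|c| by rewrite normr_gt0.
have [e [e0 e2 e4]] : exists e, [/\ 0 < e, e <= 1 / 2 & e <= lb / 4].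
  exists (Num.min (1 / 2) (lb / 4)); split; rewrite ?ge_min ?lexx ?orbT//.
  by rewrite lt_min !divr_gt0.
have D0 : 0 < 8 * (9 / 4 + 4 * lb ^+ 2) by have := sqr_ge0 lb; qlra.
(* At the test points [al] is at most [3 / 2 * w] and [be] at most [2 * lb * w] in absolute value,
   so that this [e'] turns the error on [n] into the one allowed by [dominated_sign]. *)
have [e' e'0 e'E] : exists2 e', 0 < e' & e' * (8 * (9 / 4 + 4 * lb ^+ 2)) = `|c| * lb.
  exists (`|c| * lb / (8 * (9 / 4 + 4 * lb ^+ 2))); last by rewrite divfK// gt_eqF.
  by rewrite divr_gt0// mulr_gt0.
have [k [/andP[k0 _] A B N]] := common_nbhd e0 e'0 ltr01.
have l0 := normr_ge0 la; have M0 : 0 < 2 * `|la| + 3 by qlra.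
(* The test points are at distance [w] from [b], with [w] at most [2 * (|la| + 1) * |a|]; the
   divisor keeps them in the neighbourhood. *)
exists (k / (2 * `|la| + 3)); first exact: divr_gt0.
move=> a; rewrite ltr_pdivlMr// => ak.
have a0 := normr_ge0 a; have la_a : 0 <= `|a| * `|la| by exact: mulr_ge0.
have ak' : `|a| < k by apply: le_lt_trans ak; qlra.
have nn b : `|b| <= `|a| -> `|b| < k by move=> h; apply: le_lt_trans h ak'.
have beB b : `|b| <= `|a| -> `|be a b - lb * b| <= lb / 2 * `|a|.
  move=> ba; have := strict_der_val be00 k0 B ak' (nn _ ba).
  rewrite mul0r add0r => h; apply: le_trans h _.
  apply: (@le_trans _ _ (lb / 4 * (`|a| + `|a|))); last by qlra.
  by apply: ler_pM; rewrite ?addr_ge0 ?lerD2l// ltW.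
have [| | |b /andP[b1 b2] bb] := @ivt_zero R (be a) (- `|a|) `|a|.
- by qlra.
- by move=> b _; exact: cont2_vert.
- have := beB `|a|; rewrite normr_id => /(_ (lexx _)).
  have := beB (- `|a|); rewrite normrN normr_id => /(_ (lexx _)).
  have lba := mulr_ge0 (ltW lb0) a0.
  rewrite !ler_norml => /andP[h1 h2] /andP[h3 h4].
  apply: mulr_le0_ge0; first by qlra.
  by qlra.
have ba : `|b| <= `|a| by rewrite ler_norml b1.
have bk := nn _ ba.
exists b; split => //; apply/eqP; apply: contraT => al0.
(* Moving by [w] up or down changes [al] by at most [w / 2], yet makes [be] of size about [lb * w],
   with opposite signs. *)
have [w wE] : exists w, w = `|al a b| by exists `|al a b|.
have w0 : 0 < w by rewrite wE normr_gt0.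
have wM : w <= (`|la| + 1) * (2 * `|a|).
  have := strict_der_val al00 k0 A ak' bk; rewrite mul0r addr0 => h.
  have := ler_normD (al a b - la * a) (la * a); rewrite subrK normrM -wE => h2.
  have h3 : e * (`|a| + `|b|) <= 1 / 2 * (`|a| + `|a|).
    by apply: ler_pM; rewrite ?addr_ge0 ?lerD2l// ltW.
  have -> : (`|la| + 1) * (2 * `|a|) = 2 * (`|a| * `|la|) + 2 * `|a| by ring.
  by rewrite [`|la| * _]mulrC in h2; qlra.
have wk b' : `|b' - b| <= w -> `|b'| < k.
  move=> h; have := ler_normD (b' - b) b; rewrite subrK => h2.
  have e1 : (`|la| + 1) * (2 * `|a|) = 2 * (`|a| * `|la|) + 2 * `|a| by ring.
  have e3 : `|a| * (2 * `|la| + 3) = 2 * (`|a| * `|la|) + 3 * `|a| by ring.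
  by rewrite e1 in wM; rewrite e3 in ak; qlra.
have alB b' : `|b' - b| <= w -> `|al a b' - al a b| <= 1 / 2 * `|b' - b|.
  move=> h; have := strict_der_vert A ak' bk (wk _ h).
  by rewrite mul0r subr0 => h2; apply: le_trans h2 _; rewrite ler_wpM2r.
have beB' b' : `|b' - b| <= w -> `|be a b' - lb * (b' - b)| <= lb / 4 * `|b' - b|.
  move=> h; have := strict_der_vert B ak' bk (wk _ h).
  by rewrite bb subr0 => h2; apply: le_trans h2 _; rewrite ler_wpM2r.
have nz b' : `|b' - b| <= w -> n a b' != 0.
  move=> h; apply/eqP => /n_eq0[h0 _]; have := alB _ h; rewrite h0 sub0r normrN -wE.
  by qlra.
have sgn (s : R) : `|s| = 1 -> 0 < s * (c * al a b) * n a (b + s * w).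
  move=> s1; have sb : b + s * w - b = s * w by ring.
  have hw : `|b + s * w - b| = w by rewrite sb normrM s1 mul1r gtr0_norm.
  have h : `|b + s * w - b| <= w by rewrite hw.
  have hk := wk _ h; have ha := alB _ h; have hb := beB' _ h.
  have hn := N a (b + s * w) ak' hk.
  rewrite hw in ha hb; rewrite sb in hb.
  move: ha hb hn wE; move: (al a (b + s * w)) (be a (b + s * w)) (n a (b + s * w)) (al a b).
  move=> u v x a1 ha hb hn wE.
  have hu : `|u - a1| <= w / 2 by qlra.
  apply: (dominated_sign lb0 w0 wE c_neq0 s1 hu hb); apply: le_trans hn _.
  have u2 : u ^+ 2 <= 9 / 4 * w ^+ 2.
    have h1 : `|u| <= 3 / 2 * w.
      by have := ler_normD (u - a1) a1; rewrite subrK -wE; qlra.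
    rewrite -[u ^+ 2]real_normK ?num_real//.
    have -> : 9 / 4 * w ^+ 2 = (3 / 2 * w) ^+ 2 by field.
    by rewrite ler_sqr ?nnegrE// mulr_ge0// ltW.
  have lbw := mulr_gt0 lb0 w0.
  have v2 : v ^+ 2 <= 4 * lb ^+ 2 * w ^+ 2.
    have h1 : `|v| <= 2 * (lb * w).
      have := ler_normD (v - lb * (s * w)) (lb * (s * w)); rewrite subrK !normrM s1 mul1r.
      by rewrite (gtr0_norm lb0) (gtr0_norm w0); qlra.
    rewrite -[v ^+ 2]real_normK ?num_real//.
    have -> : 4 * lb ^+ 2 * w ^+ 2 = (2 * (lb * w)) ^+ 2 by ring.
    by rewrite ler_sqr ?nnegrE//; qlra.
  apply: (@le_trans _ _ (e' * ((9 / 4 + 4 * lb ^+ 2) * w ^+ 2))).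
    by rewrite ler_wpM2l ?(ltW e'0)//; qlra.
  by rewrite -e'E; qlra.
have P1 := sgn 1 (normr1 _); have P2 := sgn (-1) (normrN1 _).
rewrite !mul1r in P1; rewrite !mulN1r in P2.
have bw : b - w <= b + w by qlra.
have [|q /andP[q1 q2] nq] := @ivt_zero R (n a) (b - w) (b + w) bw (fun q _ =>
  cont2_vert n_cont).
  have : 0 < (c * al a b) ^+ 2 * (- (n a (b - w) * n a (b + w))).
    have -> : (c * al a b) ^+ 2 * - (n a (b - w) * n a (b + w)) =
      (c * al a b * n a (b + w)) * (- (c * al a b) * n a (b - w)) by ring.
    exact: mulr_gt0.
  rewrite pmulr_rgt0; first by rewrite oppr_gt0 => /ltW.
  by rewrite lt_neqAle sqr_ge0 eq_sym sqrf_eq0 mulf_neq0.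
have qb : `|q - b| <= w by rewrite ler_norml; qlra.
by have := nz q qb; rewrite nq eqxx.
Qed.

(* The zeros given by zero_curve accumulate at the origin, where (al, be) would be
   locally injective. *)
Lemma saddle_degenerate : la = 0.
Proof.
apply/eqP; apply: contraT => la0; have l0 : 0 < `|la| by rewrite normr_gt0.
have e0 : 0 < `|la| / 4 by qlra.
have [k1 k10 H] := zero_curve.
have [k [/andP[k0 kk1] A _ _]] := common_nbhd e0 ltr01 k10.
have [a [a0 ak]] : exists a, 0 < a /\ a < k by exists (k / 2); qlra.
have na : `|a| = a by rewrite gtr0_norm.
have ak' : `|a| < k by rewrite na.
have [b [ba al0 _]] := H a (lt_le_trans ak' kk1).
have := strict_der_val al00 k0 A ak' (le_lt_trans ba ak').
rewrite al0 sub0r normrN mul0r addr0 normrM na => h; rewrite na in ba.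
have h2 : `|la| / 4 * (a + `|b|) <= `|la| / 4 * (a + a).
  by rewrite ler_wpM2l ?lerD2l// ltW.
have := mulr_gt0 l0 a0; qlra.
Qed.

(** Measured vertically from the curve of zeros, [be] grows at rate close to [lb], whereas [al] has
    vertical derivative 0 at the origin and stays much smaller. Hence the cone condition of
    [slope_mono], which [no_entry] shows to be incompatible with coming close to the zero. *)
Lemma saddle_avoid (a b : R -> R) :
  (forall t, 0 <= t -> has_der a t (al (a t) (b t))) ->
  (forall t, 0 <= t -> has_der b t (be (a t) (b t))) ->
  (forall t, 0 <= t -> al (a t) (b t) = 0 -> be (a t) (b t) = 0 -> False) ->
  exists2 d, 0 < d & forall t, 0 <= t -> d <= `|a t| \/ d <= `|b t|.
Proof.
move=> aE bE ab0; have lb0 := lb_gt0; have la0 := saddle_degenerate.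
have e0 : 0 < lb / 8 by qlra.
have [k1 k10 H] := zero_curve.
have m0 : 0 < Num.max `|a 0| `|b 0|.
  rewrite lt_max !normr_gt0 -negb_and; apply/negP => /andP[/eqP a00 /eqP b00].
  by apply: (ab0 0 (lexx 0)); rewrite a00 b00.
(* [k] is at most the initial distance, so that the trajectory starts outside the square of
   half-side [k / 2]. *)
have mk : 0 < Num.min k1 (Num.max `|a 0| `|b 0|) by rewrite lt_min k10.
have [k [/andP[k0]]] := common_nbhd e0 ltr01 mk; rewrite le_min => /andP[kk1 kk4] A B _.
exists (k / 8) => [|t1 t10]; first by rewrite divr_gt0.
case: (leP (k / 8) `|a t1|) => [|at1]; first by left.
case: (leP (k / 8) `|b t1|) => [|bt1]; first by right.
exfalso.
pose g t := Num.max `|a t| `|b t|.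
have gc t : 0 <= t -> {for t, continuous g}.
  move=> t0; apply: (@continuous_max _ _ (fun t => `|a t|) (fun t => `|b t|)).
    apply: (@continuous_comp _ _ _ a (fun r => `|r|)); last exact: norm_continuous.
    exact: (der_cont (aE t t0)).
  apply: (@continuous_comp _ _ _ b (fun r => `|r|)); last exact: norm_continuous.
  exact: (der_cont (bE t t0)).
(* In reversed time, the first zero is the last passage through the boundary of the square before
   [t1]. *)
pose h t := k / 2 - g (t1 - t).
have hc t : 0 <= t <= t1 -> {for t, continuous h}.
  move=> /andP[t0 tt1]; apply: (@continuousB _ _ _ (fun=> k / 2)); first exact: cst_continuous.
  apply: (@continuous_comp _ _ _ (fun t => t1 - t) g); last by apply: gc; qlra.
  by apply: (@continuousB _ _ _ (fun=> t1)); [exact: cst_continuous|exact: cvg_id].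
have g0 : 0 < h 0.
  by rewrite subr_gt0 /g subr0 gt_max; apply/andP; split; qlra.
have g1 : h t1 <= 0 by rewrite /h subr_le0 subrr; apply: le_trans kk4; qlra.
have [s' [/andP[s'0 s't1] gs pos]] := first_zero t10 hc g0 g1.
have [s [s0 st1 sE]] : exists s, [/\ 0 <= s, s < t1 & s' = t1 - s] by exists (t1 - s');
  split; qlra.
have gs' : Num.max `|a s| `|b s| = k / 2.
  by move: gs; rewrite /h sE subKr => /eqP; rewrite subr_eq0 => /eqP.
have gk t : s <= t <= t1 -> `|a t| < k /\ `|b t| < k.
  move=> /andP[st tt1].
  have : Num.max `|a t| `|b t| <= k / 2.
    move: st; rewrite le_eqVlt => /predU1P[<-|st]; first by rewrite gs'.
    have := pos (t1 - t); rewrite /h /g subKr subr_gt0 => hh; apply/ltW/hh.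
    by rewrite sE; qlra.
  by rewrite ge_max => /andP[? ?]; split; qlra.
clear gc hc g0 g1 gs pos h g.
have tI t : s <= t <= t1 -> 0 <= t by move=> /andP[]; qlra.
have albe t : s <= t <= t1 -> 4 * `|al (a t) (b t)| <= `|be (a t) (b t)| /\ be (a t) (b t) != 0.
  move=> tst; have [ak bk] := gk t tst; have t0 := tI _ tst.
  have [b' [ba al0 be0]] := H (a t) (lt_le_trans ak kk1).
  have b'k := le_lt_trans ba ak.
  have hA := strict_der_vert A ak b'k bk; have hB := strict_der_vert B ak b'k bk.
  move: hA hB; rewrite al0 be0 mul0r !subr0 => hA hB.
  have n0 := normr_ge0 (b t - b'); have ln0 := mulr_ge0 (ltW lb0) n0.
  have hB' : 7 / 8 * (lb * `|b t - b'|) <= `|be (a t) (b t)|.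
    have := ler_normB (be (a t) (b t)) (be (a t) (b t) - lb * (b t - b')).
    by rewrite subKr normrM (gtr0_norm lb0); qlra.
  split; first by qlra.
  apply/eqP => be_0; move: hB'; rewrite be_0 normr0 => h.
  have : `|b t - b'| <= 0 by rewrite -(pmulr_rle0 _ lb0); qlra.
  rewrite normr_le0 subr_eq0 => /eqP e.
  by apply: (ab0 t t0) => //; rewrite e.
have bec t : s <= t <= t1 -> {for t, continuous (fun t => be (a t) (b t))}.
  move=> tst; apply: (cont2_comp be_cont); first exact: (der_cont (aE t (tI t tst))).
  exact: (der_cont (bE t (tI t tst))).
have [sg [sg1 sgs sl]] := slope_mono (ltW st1) (fun t tst => aE t (tI t tst))
  (fun t tst => bE t (tI t tst)) bec albe.
have [as_ bs_] := gk s ltac:(by rewrite lexx ltW).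
apply: (no_entry k0 lb0 sg1 gs' at1 bt1 sl sgs).
by have := strict_der_val be00 k0 B as_ bs_; rewrite mul0r add0r.
Qed.

End Saddle.

Lemma sqr_lt_norm (R : realType) (X k : R) : 0 < k -> X ^+ 2 < k ^+ 2 -> `|X| < k.
Proof.
move=> k0; apply: contraTT; rewrite -!leNgt => kX.
by rewrite -[X ^+ 2]real_normK ?num_real// !expr2 ler_pM// ltW.
Qed.

(** * Two by two matrices of trace 1 *)

Section LinearAlgebra.
Variable R : realType.
Implicit Types p q r s X Y : R.

(* |v|^2 + 2 (r - q) (v x A v), where v = (X, Y) and A = [[p, q], [r, s]]. *)
Definition lyapunov p q r s X Y :=
  X ^+ 2 + Y ^+ 2 + 2 * (r - q) * (r * X ^+ 2 + (s - p) * (X * Y) - q * Y ^+ 2).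

(** With B = A - I/2, which has trace 0 and det B = det A - 1/4 >= 0, the form is |v|^2 + 2 |B v|^2
    + 2 (det B) |v|^2. *)
Lemma lyapunov_ge p q r s X Y : p + s = 1 -> 1 <= 4 * (p * s - q * r) ->
  X ^+ 2 + Y ^+ 2 <= lyapunov p q r s X Y.
Proof.
move=> ps D; have sE : s = 1 - p by rewrite -ps; ring.
have -> : lyapunov p q r s X Y = X ^+ 2 + Y ^+ 2 +
  ((2 * (p - 1 / 2) * X + 2 * q * Y) ^+ 2 + (2 * r * X + (s - p) * Y) ^+ 2) / 2 +
  (4 * (p * s - q * r) - 1) / 2 * (X ^+ 2 + Y ^+ 2).
  by rewrite /lyapunov sE; field.
rewrite -addrA lerDl addr_ge0 ?divr_ge0 ?addr_ge0 ?sqr_ge0//.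
by apply: mulr_ge0; [rewrite divr_ge0// subr_ge0|rewrite addr_ge0 ?sqr_ge0].
Qed.

(** The right-hand side is the derivative of [lyapunov] along v' = A v, equal to |v|^2 / 2 + |v + 2
    B v|^2 / 2 + 2 (det B) |v|^2 with B = A - I/2. *)
Lemma lyapunov_der_ge p q r s X Y : p + s = 1 -> 1 <= 4 * (p * s - q * r) ->
  (X ^+ 2 + Y ^+ 2) / 2 <=
  (2 * X + 2 * (r - q) * (2 * r * X + (s - p) * Y)) * (p * X + q * Y) +
  (2 * Y + 2 * (r - q) * ((s - p) * X - 2 * q * Y)) * (r * X + s * Y).
Proof.
move=> ps D; have sE : s = 1 - p by rewrite -ps; ring.
have -> : (2 * X + 2 * (r - q) * (2 * r * X + (s - p) * Y)) * (p * X + q * Y) +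
  (2 * Y + 2 * (r - q) * ((s - p) * X - 2 * q * Y)) * (r * X + s * Y) =
  (X ^+ 2 + Y ^+ 2) / 2 + ((X + 2 * ((p - 1 / 2) * X + q * Y)) ^+ 2 +
    (Y + 2 * (r * X + (1 / 2 - p) * Y)) ^+ 2) / 2 +
  (4 * (p * s - q * r) - 1) / 2 * (X ^+ 2 + Y ^+ 2).
  by rewrite sE; field.
rewrite -addrA lerDl addr_ge0 ?divr_ge0 ?addr_ge0 ?sqr_ge0//.
by apply: mulr_ge0; [rewrite divr_ge0// subr_ge0|rewrite addr_ge0 ?sqr_ge0].
Qed.

(* The matrix is (1/2 - h) I + 2 h w l^T, with eigenvalues 1/2 - h and 1/2 + h. *)
Lemma rank_one_split p q r s : p + s = 1 -> 4 * (p * s - q * r) < 1 ->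
  exists h w1 w2 l1 l2, [/\ 0 < h, l1 * w1 + l2 * w2 = 1,
    p = 1 / 2 - h + 2 * h * (w1 * l1) /\ q = 2 * h * (w1 * l2) &
    r = 2 * h * (w2 * l1) /\ s = 1 / 2 - h + 2 * h * (w2 * l2)].
Proof.
move=> ps D; have sE : s = 1 - p by rewrite -ps; ring.
(* The right-hand side is the discriminant of the characteristic polynomial. *)
have [h h0 hh] : exists2 h, 0 < h & 4 * h ^+ 2 = 1 - 4 * (p * s - q * r).
  exists (Num.sqrt ((1 - 4 * (p * s - q * r)) / 4)).
    by rewrite sqrtr_gt0 divr_gt0// subr_gt0.
  by rewrite sqr_sqrtr; [field|rewrite divr_ge0// subr_ge0 ltW].
have h2 : 2 * h != 0 by rewrite mulf_neq0// gt_eqF.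
have [P PE] : exists P, p = 1 / 2 - h + 2 * h * P.
  by exists ((p - 1 / 2 + h) / (2 * h)); field; rewrite gt_eqF.
have [q' qE] : exists q', q = 2 * h * q'.
  by exists (q / (2 * h)); field; rewrite gt_eqF.
have [r' rE] : exists r', r = 2 * h * r'.
  by exists (r / (2 * h)); field; rewrite gt_eqF.
have det : P * (1 - P) = q' * r'.
  have h4 : 4 * h ^+ 2 != 0 by rewrite mulf_neq0// expf_neq0// gt_eqF.
  apply: (mulfI h4); rewrite sE PE qE rE in hh; clear -hh; qlra.
have s' : s = 1 / 2 - h + 2 * h * (1 - P) by rewrite sE PE; field.
(* The matrix with rows [P, q'] and [r', 1 - P] has determinant 0, hence rank one: it is factored
   through its second row and column if [P = 0], through the first ones otherwise. *)
have [P0|P0] := eqVneq P 0.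
  have qr : q' * r' = 0 by rewrite -det P0 mul0r.
  exists h, q', 1, r', 1; split => //.
  - by rewrite mulrC qr; ring.
  - by rewrite qr PE P0 qE; split; field.
  - by rewrite s' rE P0; split; field.
exists h, P, r', 1, (q' / P); split => //.
- have -> : 1 * P + q' / P * r' = P + q' * r' / P by ring.
  by rewrite -det; field.
- by rewrite PE qE; split; field.
- rewrite s' rE; split; first by field.
  have -> : r' * (q' / P) = q' * r' / P by ring.
  by rewrite -det; field.
Qed.

End LinearAlgebra.

Section LinearBounds.
Variable R : realType.
Implicit Types K c u v : R.

Lemma lin_bound K c1 c2 u v : `|c1| <= K -> `|c2| <= K ->
  `|c1 * u + c2 * v| <= K * (`|u| + `|v|).
Proof.
move=> h1 h2; apply: le_trans (ler_normD _ _) _; rewrite !normrM mulrDr.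
by apply: lerD; apply: ler_wpM2r.
Qed.

Lemma cont2_lin K c1 c2 : cont2 (fun u v => K + (c1 * u + c2 * v)).
Proof.
apply: cont2D; first exact: cont2_cst.
by apply: cont2D; apply: cont2M;
  [exact: cont2_cst|exact: cont2_fst|exact: cont2_cst|exact: cont2_snd].
Qed.

Lemma cont2_comp2 (g X Y : R -> R -> R) : cont2 g -> cont2 X -> cont2 Y ->
  cont2 (fun a b => g (X a b) (Y a b)).
Proof.
move=> gc Xc Yc p.
apply: (@continuous_comp _ _ _ (fun p : R * R => (X p.1 p.2, Y p.1 p.2)) (fun p : R * R =>
  g p.1 p.2)).
  exact: (cvg_pair (Xc p) (Yc p)).
exact: gc.
Qed.
End LinearBounds.

(** * Trajectories stay away from each zero of the field *)

Section Field.
Variables (R : realType) (E1 E2 E1x E1y E2x E2y : R -> R -> R).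
Hypothesis E1C : C1 E1 E1x E1y.
Hypothesis E2C : C1 E2 E2x E2y.
Hypothesis divE : forall x y, E1x x y + E2y x y = 1.

(* The curvature of the integral curves of (E1, E2) times the cube of the speed. *)
Definition bending x y := E1 x y * (E2x x y * E1 x y + E2y x y * E2 x y) -
  E2 x y * (E1x x y * E1 x y + E1y x y * E2 x y).

Hypothesis bend_eq0 : forall x y, bending x y = 0 -> E1 x y = 0 /\ E2 x y = 0.

Lemma bend_cont : cont2 bending.
Proof.
have [_ _ c1x c1y] := E1C; have [_ _ c2x c2y] := E2C.
have c1 := C1_cont E1C; have c2 := C1_cont E2C.
apply: cont2D; first by apply: cont2M c1 (cont2D (cont2M c2x c1) (cont2M c2y c2)).
by apply/cont2N/(cont2M c2 (cont2D (cont2M c1x c1) (cont2M c1y c2))).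
Qed.

Section Zero.
Variables (zx zy : R) (x y : R -> R).
Hypothesis E1z : E1 zx zy = 0.
Hypothesis E2z : E2 zx zy = 0.
Hypothesis xE : forall t, 0 <= t -> has_der x t (E1 (x t) (y t)).
Hypothesis yE : forall t, 0 <= t -> has_der y t (E2 (x t) (y t)).
Hypothesis E_neq0 : forall t, 0 <= t -> E1 (x t) (y t) = 0 -> E2 (x t) (y t) = 0 -> False.

Let p := E1x zx zy.
Let q := E1y zx zy.
Let r := E2x zx zy.
Let s := E2y zx zy.

(** The linear part makes the Lyapunov function grow at least at rate |v|^2 / 2, and near the zero
    the remainder costs no more; [barrier] then bounds the function from below. *)
Lemma node_avoid : 1 <= 4 * (p * s - q * r) -> exists2 d, 0 < d &
  forall t, 0 <= t -> d <= `|x t - zx| \/ d <= `|y t - zy|.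
Proof.
move=> D; have ps : p + s = 1 by exact: divE.
have [m m1 [mX mY]] : exists2 m, 1 <= m & (forall X Y,
    `|2 * X + 2 * (r - q) * (2 * r * X + (s - p) * Y)| <= m * (`|X| + `|Y|)) /\ (forall X Y,
    `|2 * Y + 2 * (r - q) * ((s - p) * X - 2 * q * Y)| <= m * (`|X| + `|Y|)).
  exists (2 + 2 * `|r - q| * (2 * `|r| + `|s - p| + 2 * `|q|)).
    rewrite -[1]addr0 lerD ?mulr_ge0 ?addr_ge0 ?mulr_ge0//; qlra.
  split=> X Y; apply: le_trans (ler_normD _ _) _; rewrite !normrM normr_nat [leRHS]mulrDl;
    apply: lerD.
  - by rewrite ler_wpM2l// lerDl.
  - rewrite -!mulrA ler_wpM2l// ler_wpM2l//.
    apply: le_trans (ler_normD _ _) _; rewrite !normrM normr_nat.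
    have := mulr_ge0 (normr_ge0 r) (normr_ge0 Y);
      have := mulr_ge0 (normr_ge0 (s - p)) (normr_ge0 X).
    by have := mulr_ge0 (normr_ge0 q) (addr_ge0 (normr_ge0 X) (normr_ge0 Y)); qlra.
  - by rewrite ler_wpM2l// lerDr.
  - rewrite -!mulrA ler_wpM2l// ler_wpM2l//.
    apply: le_trans (ler_normB _ _) _; rewrite !normrM normr_nat.
    have := mulr_ge0 (normr_ge0 q) (normr_ge0 X);
      have := mulr_ge0 (normr_ge0 (s - p)) (normr_ge0 Y).
    by have := mulr_ge0 (normr_ge0 r) (addr_ge0 (normr_ge0 X) (normr_ge0 Y)); qlra.
have m0 : 0 < m by qlra.
(* [m] bounds the partial derivatives of the quadratic form; with this precision each of the two
   error terms is at most |v|^2 / 4. *)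
have e0 : 0 < 1 / (8 * m) by rewrite divr_gt0// mulr_gt0.
have [k1 k10 S1] := strict_diff zx zy E1C e0.
have [k2 k20 S2] := strict_diff zx zy E2C e0.
have [k [k0 kk1 kk2]] : exists k, [/\ 0 < k, k <= k1 & k <= k2].
  by exists (Num.min k1 k2); rewrite lt_min k10 !ge_min !lexx orbT.
pose g t := lyapunov p q r s (x t - zx) (y t - zy).
pose dg t := (2 * (x t - zx) + 2 * (r - q) * (2 * r * (x t - zx) + (s - p) * (y t - zy))) *
  E1 (x t) (y t) +
  (2 * (y t - zy) + 2 * (r - q) * ((s - p) * (x t - zx) - 2 * q * (y t - zy))) * E2 (x t) (y t).
have gE t : 0 <= t -> has_der g t (dg t).
  move=> t0; have dx := xE t0; have dy := yE t0.
  by rewrite /g /lyapunov /dg; der; ring.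
have dg0 t : `|x t - zx| < k -> `|y t - zy| < k -> 0 <= dg t.
  move=> xk yk; have z0 (w : R) : `|w - w| < k by rewrite subrr normr0.
  have h1 := S1 (x t) (y t) zx zy (lt_le_trans xk kk1) (lt_le_trans yk kk1)
    (lt_le_trans (z0 zx) kk1) (lt_le_trans (z0 zy) kk1).
  have h2 := S2 (x t) (y t) zx zy (lt_le_trans xk kk2) (lt_le_trans yk kk2)
    (lt_le_trans (z0 zx) kk2) (lt_le_trans (z0 zy) kk2).
  rewrite E1z subr0 -/p -/q in h1; rewrite E2z subr0 -/r -/s in h2; rewrite /dg.
  move: (x t - zx) (y t - zy) (E1 (x t) (y t)) (E2 (x t) (y t)) h1 h2 => X Y u v h1 h2.
  have := lyapunov_der_ge X Y ps D; have := mX X Y; have := mY X Y.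
  move: (2 * X + _) (2 * Y + _) => P Q hQ hP main.
  have err (P' w : R) : `|P'| <= m * (`|X| + `|Y|) -> `|w| <= 1 / (8 * m) * (`|X| + `|Y|) ->
      `|P' * w| <= (X ^+ 2 + Y ^+ 2) / 4.
    move=> hP' hw; rewrite normrM; apply: le_trans (ler_pM _ _ hP' hw) _ => //.
    have -> : m * (`|X| + `|Y|) * (1 / (8 * m) * (`|X| + `|Y|)) = (`|X| + `|Y|) ^+ 2 / 8.
      by field; rewrite gt_eqF.
    have := sqr_ge0 (`|X| - `|Y|).
    by rewrite sqrrB sqrrD !real_normK ?num_real//; qlra.
  have := err _ _ hP h1; have := err _ _ hQ h2.
  rewrite !ler_norml => /andP[a1 _] /andP[a2 _].
  have -> : P * u + Q * v = P * (p * X + q * Y) + Q * (r * X + s * Y) +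
    (P * (u - p * X - q * Y) + Q * (v - r * X - s * Y)) by ring.
  qlra.
have g0 : 0 < g 0.
  have h : 0 < (x 0 - zx) ^+ 2 + (y 0 - zy) ^+ 2.
    rewrite lt_neqAle addr_ge0 ?sqr_ge0// andbT eq_sym paddr_eq0 ?sqr_ge0//.
    rewrite !sqrf_eq0 !subr_eq0; apply/negP => /andP[/eqP ex /eqP ey].
    by apply: (E_neq0 (lexx 0)); rewrite ex ey.
  exact: lt_le_trans h (lyapunov_ge _ _ ps D).
(* Since [g] dominates |v|^2, the region [g <= l] lies inside the square where [g] is known to be
   nondecreasing. *)
have [l [l0 lg lk]] : exists l, [/\ 0 < l, l <= g 0 & l < k ^+ 2].
  exists (Num.min (g 0) (k ^+ 2 / 2)); have kk : 0 < k ^+ 2 by rewrite exprn_gt0.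
  rewrite lt_min g0 divr_gt0// !ge_min lexx; split => //.
  by rewrite gt_min; apply/orP; right; qlra.
have gl t : 0 <= t -> l <= g t.
  move=> t0; apply: (barrier t0 _ _ lg) => [w /andP[w0 _]|u v u0 uv vt hl];
    first exact: (der_cont (gE w w0)).
  apply: (der_ge0_le uv (fun w wI => gE w (le_trans u0 (andP wI).1))) => w wI.
  have h := le_lt_trans (hl w wI) lk.
  have {}h : (x w - zx) ^+ 2 + (y w - zy) ^+ 2 < k ^+ 2
    by apply: le_lt_trans (lyapunov_ge _ _ ps D) h.
  have X2 := sqr_ge0 (x w - zx); have Y2 := sqr_ge0 (y w - zy).
  by apply: dg0; apply: sqr_lt_norm => //; qlra.
pose M := 1 + 2 * `|r - q| * (`|r| + `|s - p| + `|q|).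
have M0 : 0 < M by rewrite /M ltr_wpDr// !mulr_ge0// !addr_ge0.
have [d [d0 d1 dl]] : exists d, [/\ 0 < d, d <= 1 & 4 * M * d < l].
  exists (Num.min 1 (l / (8 * M))); rewrite lt_min ltr01 divr_gt0 ?mulr_gt0//; split;
    [by []|by rewrite ge_min lexx|].
  apply: (@le_lt_trans _ _ (4 * M * (l / (8 * M)))).
    by apply: ler_wpM2l; [rewrite mulr_ge0// ltW|rewrite ge_min lexx orbT].
  have -> : 4 * M * (l / (8 * M)) = l / 2 by field; rewrite gt_eqF.
  qlra.
exists d => // t t0; case: (leP d `|x t - zx|) => [|xd]; first by left.
case: (leP d `|y t - zy|) => [|yd]; first by right.
exfalso; have := gl t t0; rewrite /g leNgt => /negP; apply; apply: le_lt_trans dl.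
rewrite /lyapunov; move: (x t - zx) (y t - zy) xd yd => X Y Xd Yd.
have sq (V W : R) : `|V| < d -> `|W| < d -> `|V * W| <= d.
  move=> hV hW; rewrite normrM -[d]mulr1.
  by rewrite ler_pM// ltW// (lt_le_trans hW).
have XX := sq _ _ Xd Xd; have YY := sq _ _ Yd Yd; have XY := sq _ _ Xd Yd.
rewrite !expr2; apply: le_trans (ler_norm _) _.
apply: le_trans (ler_normD _ _) _.
have -> : 4 * M * d = (d + d) + 2 * `|r - q| * (`|r| * d + `|s - p| * d + `|q| * d) +
  (2 * d + 2 * `|r - q| * (`|r| * d + `|s - p| * d + `|q| * d) * 3) by rewrite /M; ring.
apply: ler_wpDr.
  by have d0' := ltW d0; rewrite !(addr_ge0, mulr_ge0).
apply: lerD; first by apply: le_trans (ler_normD _ _) _; exact: lerD.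
rewrite !normrM normr_nat ler_wpM2l ?mulr_ge0//.
apply: le_trans (ler_normB _ _) _; apply: lerD; last by rewrite normrM ler_wpM2l.
by apply: le_trans (ler_normD _ _) _; apply: lerD; rewrite normrM ler_wpM2l.
Qed.

(** Reduction to [saddle_avoid] in the eigenbasis (- l2, l1), (w1, w2), for the eigenvalues
    [1 / 2 - h] and [1 / 2 + h]. On the linear part, the bending is [- (2 * h)] times the product of
    the two components of the field. *)
Lemma saddle_point_avoid : 4 * (p * s - q * r) < 1 -> exists2 d, 0 < d &
  forall t, 0 <= t -> d <= `|x t - zx| \/ d <= `|y t - zy|.
Proof.
move=> D; have ps : p + s = 1 by exact: divE.
have [h [w1 [w2 [l1 [l2 [h0 lw [pE qE] [rE sE]]]]]]] := rank_one_split ps D.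
have [K [K1 Kw1 Kw2 [Kl1 Kl2]]] : exists K, [/\ 1 <= K, `|w1| <= K,
  `|w2| <= K & `|l1| <= K /\ `|l2| <= K].
  have a1 := normr_ge0 w1; have a2 := normr_ge0 w2; have a3 := normr_ge0 l1;
    have a4 := normr_ge0 l2.
  exists (1 + (`|w1| + `|w2|) + (`|l1| + `|l2|)).
  by split; [qlra|qlra|qlra|split; qlra].
have K0 : 0 < K by qlra.
have KN (c : R) : `|c| <= K -> `|- c| <= K by rewrite normrN.
pose X a b := zx + (- l2 * a + w1 * b); pose Y a b := zy + (l1 * a + w2 * b).
pose al a b := - w2 * E1 (X a b) (Y a b) + w1 * E2 (X a b) (Y a b).
pose be a b := l1 * E1 (X a b) (Y a b) + l2 * E2 (X a b) (Y a b).
pose n a b := bending (X a b) (Y a b).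
have E1ab a b : E1 (X a b) (Y a b) = - l2 * al a b + w1 * be a b.
  rewrite /al /be; move: (E1 _ _) (E2 _ _) => u v.
  by rewrite -[LHS]mul1r -lw; ring.
have E2ab a b : E2 (X a b) (Y a b) = l1 * al a b + w2 * be a b.
  rewrite /al /be; move: (E1 _ _) (E2 _ _) => u v.
  by rewrite -[LHS]mul1r -lw; ring.
have X0 : X 0 0 = zx by rewrite /X !mulr0 !addr0.
have Y0 : Y 0 0 = zy by rewrite /Y !mulr0 !addr0.
have Xn (k a b : R) : 0 < k -> `|a| < k / (2 * K) -> `|b| < k / (2 * K) ->
    `|X a b - zx| < k /\ `|Y a b - zy| < k.
  move=> k0; rewrite !ltr_pdivlMr ?mulr_gt0// => ak bk.
  have ab : K * (`|a| + `|b|) < k by qlra.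
  by split; rewrite addrC addKr; apply: le_lt_trans ab; apply: lin_bound => //; exact: KN.
(* Covers [al] and [be] at once: any fixed combination of the components of the field is strictly
   differentiable in the new coordinates. [K] bounds all coefficients of the change of basis. *)
have sd (c1 c2 ga gb : R) : `|c1| <= K -> `|c2| <= K ->
    (forall a b, c1 * (p * (- l2 * a + w1 * b) + q * (l1 * a + w2 * b)) +
       c2 * (r * (- l2 * a + w1 * b) + s * (l1 * a + w2 * b)) = ga * a + gb * b) ->
    forall e : R, 0 < e -> exists2 k : R, 0 < k &
      strict_der_at0 (fun a b => c1 * E1 (X a b) (Y a b) + c2 * E2 (X a b) (Y a b)) ga gb e k.
  move=> Kc1 Kc2 gE e e0.
  have e0' : 0 < e / (4 * K ^+ 2) by rewrite divr_gt0// mulr_gt0// exprn_gt0.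
  have [k1 k10 S1] := strict_diff zx zy E1C e0'.
  have [k2 k20 S2] := strict_diff zx zy E2C e0'.
  have [k [k0 kk1 kk2]] : exists k, [/\ 0 < k, k <= k1 & k <= k2].
    by exists (Num.min k1 k2); rewrite lt_min k10 !ge_min !lexx orbT.
  exists (k / (2 * K)); first by rewrite divr_gt0// mulr_gt0.
  move=> a1 b1 a2 b2 ha1 hb1 ha2 hb2.
  have [x1 y1] := Xn k a1 b1 k0 ha1 hb1; have [x2 y2] := Xn k a2 b2 k0 ha2 hb2.
  have h1 := S1 _ _ _ _ (lt_le_trans x1 kk1) (lt_le_trans y1 kk1) (lt_le_trans x2 kk1)
    (lt_le_trans y2 kk1).
  have h2 := S2 _ _ _ _ (lt_le_trans x1 kk2) (lt_le_trans y1 kk2) (lt_le_trans x2 kk2)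
    (lt_le_trans y2 kk2).
  have dX : X a1 b1 - X a2 b2 = - l2 * (a1 - a2) + w1 * (b1 - b2) by rewrite /X; ring.
  have dY : Y a1 b1 - Y a2 b2 = l1 * (a1 - a2) + w2 * (b1 - b2) by rewrite /Y; ring.
  rewrite -/p -/q dX dY in h1; rewrite -/r -/s dX dY in h2.
  rewrite -gE; have lX := lin_bound (a1 - a2) (b1 - b2) (KN _ Kl2) Kw1.
  have lY := lin_bound (a1 - a2) (b1 - b2) Kl1 Kw2.
  move: (E1 (X a1 b1) (Y a1 b1)) (E1 (X a2 b2) (Y a2 b2)) h1 => u1 u2 h1.
  move: (E2 (X a1 b1) (Y a1 b1)) (E2 (X a2 b2) (Y a2 b2)) h2 => v1 v2 h2.
  move: (- l2 * (a1 - a2) + w1 * (b1 - b2)) (l1 * (a1 - a2) + w2 * (b1 - b2)) h1 h2 lX lY =>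
    dx dy h1 h2 lX lY.
  have -> : c1 * u1 + c2 * v1 - (c1 * u2 + c2 * v2) - (c1 * (p * dx + q * dy) + c2 * (r * dx
    + s * dy)) =
    c1 * (u1 - u2 - p * dx - q * dy) + c2 * (v1 - v2 - r * dx - s * dy) by ring.
  apply: le_trans (lin_bound _ _ Kc1 Kc2) _.
  have dd : `|dx| + `|dy| <= 2 * K * (`|a1 - a2| + `|b1 - b2|) by qlra.
  apply: (@le_trans _ _ (K * (e / (4 * K ^+ 2) * (2 * K * (`|a1 - a2| + `|b1 - b2|)) * 2))).
    have hh := ler_wpM2l (ltW e0') dd.
    by rewrite ler_wpM2l ?(ltW K0)//; qlra.
  by rewrite le_eqVlt; apply/orP; left; apply/eqP; field; rewrite gt_eqF.
have al_sd : forall e, 0 < e -> exists2 k, 0 < k & strict_der_at0 al (1 / 2 - h) 0 e k.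
  apply: (sd (- w2) w1) => //; first exact: KN.
  move=> a b; rewrite pE qE rE sE.
  have -> : (1 / 2 - h) * a + 0 * b = (1 / 2 - h) * ((l1 * w1 + l2 * w2) * a) by rewrite lw;
    field.
  by field.
have be_sd : forall e, 0 < e -> exists2 k, 0 < k & strict_der_at0 be 0 (1 / 2 + h) e k.
  apply: (sd l1 l2) => //.
  move=> a b; rewrite pE qE rE sE.
  have -> : 0 * a + (1 / 2 + h) * b = (1 / 2 - h) * ((l1 * w1 + l2 * w2) * b) +
      2 * h * ((l1 * w1 + l2 * w2) * ((l1 * w1 + l2 * w2) * b)).
    by rewrite lw; field.
  by field.
have n_near : forall e, 0 < e -> exists2 k, 0 < k & forall a b, `|a| < k -> `|b| < k ->
    `|n a b - - (2 * h) * (al a b * be a b)| <= e * (al a b ^+ 2 + be a b ^+ 2).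
  (* Freezing the four partial derivatives at the zero makes four errors, each at most [e / 8] times
     the square of [|al| + |be|]. *)
  move=> e e0; have e0' : 0 < e / (8 * K ^+ 2) by rewrite divr_gt0// mulr_gt0// exprn_gt0.
  have [_ _ c1x c1y] := E1C; have [_ _ c2x c2y] := E2C.
  have [k1 k10 H1] := cont2_eps zx zy c1x e0'; have [k2 k20 H2] := cont2_eps zx zy c1y e0'.
  have [k3 k30 H3] := cont2_eps zx zy c2x e0'; have [k4 k40 H4] := cont2_eps zx zy c2y e0'.
  have [k [k0 [kk1 kk2] [kk3 kk4]]] : exists k, [/\ 0 < k,
    k <= k1 /\ k <= k2 & k <= k3 /\ k <= k4].
    exists (Num.min (Num.min k1 k2) (Num.min k3 k4)).
    by rewrite !lt_min k10 k20 k30 !ge_min !lexx !orbT.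
  exists (k / (2 * K)); first by rewrite divr_gt0// mulr_gt0.
  move=> a b ha hb; have [xk yk] := Xn k a b k0 ha hb.
  have h1 := ltW (H1 _ _ (lt_le_trans xk kk1) (lt_le_trans yk kk1)).
  have h2 := ltW (H2 _ _ (lt_le_trans xk kk2) (lt_le_trans yk kk2)).
  have h3 := ltW (H3 _ _ (lt_le_trans xk kk3) (lt_le_trans yk kk3)).
  have h4 := ltW (H4 _ _ (lt_le_trans xk kk4) (lt_le_trans yk kk4)).
  rewrite -/p in h1; rewrite -/q in h2; rewrite -/r in h3; rewrite -/s in h4.
  rewrite /n /bending E1ab E2ab.
  move: (E1x _ _) (E1y _ _) (E2x _ _) (E2y _ _) h1 h2 h3 h4 => p' q' r' s' h1 h2 h3 h4.
  move: (al a b) (be a b) => A B.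
  have [u uE] : exists u, u = - l2 * A + w1 * B by eexists.
  have [v vE] : exists v, v = l1 * A + w2 * B by eexists.
  have uK : `|u| <= K * (`|A| + `|B|) by rewrite uE; apply: lin_bound => //; exact: KN.
  have vK : `|v| <= K * (`|A| + `|B|) by rewrite vE; apply: lin_bound.
  rewrite -uE -vE.
  have main : u * (r * u + s * v) - v * (p * u + q * v) = - (2 * h) * (A * B).
    have -> : A * B = ((l1 * w1 + l2 * w2) * A) * ((l1 * w1 + l2 * w2) * B)
      by rewrite lw !mul1r.
    by rewrite pE qE rE sE uE vE; field.
  rewrite -main.
  have -> : u * (r' * u + s' * v) - v * (p' * u + q' * v) - (u * (r * u + s * v) - v * (p * u
    + q * v)) =
    (r' - r) * (u * u) + ((s' - s) - (p' - p)) * (u * v) - (q' - q) * (v * v) by ring.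
  pose S := K * (`|A| + `|B|).
  have S0 : 0 <= S by rewrite mulr_ge0 ?addr_ge0// ltW.
  have T (c' u' v' : R) : `|c'| <= e / (8 * K ^+ 2) -> `|u'| <= S -> `|v'| <= S ->
      `|c' * (u' * v')| <= e / (8 * K ^+ 2) * (S * S).
    by move=> hc hu hv; rewrite !normrM !ler_pM ?mulr_ge0.
  have t1 := T _ _ _ h3 uK uK; have t2 := T _ _ _ h4 uK vK.
  have t3 := T _ _ _ h1 uK vK; have t4 := T _ _ _ h2 vK vK.
  have SS : e / (8 * K ^+ 2) * (S * S) = e / 8 * (`|A| + `|B|) ^+ 2.
    by rewrite /S; field; rewrite gt_eqF.
  have AB : (`|A| + `|B|) ^+ 2 <= 2 * (A ^+ 2 + B ^+ 2).
    have := sqr_ge0 (`|A| - `|B|).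
    by rewrite sqrrB sqrrD !real_normK ?num_real//; qlra.
  have AB' : 4 * (e / 8 * (`|A| + `|B|) ^+ 2) <= e * (A ^+ 2 + B ^+ 2).
    have := ler_wpM2l (ltW e0) AB; qlra.
  rewrite SS in t1 t2 t3 t4; apply: le_trans AB'.
  apply: le_trans (ler_normB _ _) _; rewrite [_ * (u * v)]mulrBl.
  have := ler_normD ((r' - r) * (u * u)) ((s' - s) * (u * v) - (p' - p) * (u * v)).
  have := ler_normB ((s' - s) * (u * v)) ((p' - p) * (u * v)); qlra.
have Xc : cont2 X by exact: cont2_lin.
have Yc : cont2 Y by exact: cont2_lin.
have n_c : cont2 n by exact: (cont2_comp2 bend_cont Xc Yc).
have be_c : cont2 be.
  by apply: cont2D; apply: cont2M;
    first [exact: cont2_cst|exact: (cont2_comp2 (C1_cont E1C))|exact: (cont2_comp2 (C1_cont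
      E2C))].
have n0 (a b : R) : n a b = 0 -> al a b = 0 /\ be a b = 0.
  by move=> /bend_eq0[e1 e2]; rewrite /al /be e1 e2 !mulr0 !addr0.
pose a t := - w2 * (x t - zx) + w1 * (y t - zy).
pose b t := l1 * (x t - zx) + l2 * (y t - zy).
have Xab t : X (a t) (b t) = x t.
  have -> : x t = zx + (l1 * w1 + l2 * w2) * (x t - zx) by rewrite lw mul1r addrC subrK.
  by rewrite /X /a /b; ring.
have Yab t : Y (a t) (b t) = y t.
  have -> : y t = zy + (l1 * w1 + l2 * w2) * (y t - zy) by rewrite lw mul1r addrC subrK.
  by rewrite /Y /a /b; ring.
have aE t : 0 <= t -> has_der a t (al (a t) (b t)).
  move=> t0; have dx := xE t0; have dy := yE t0.
  by rewrite /al Xab Yab /a; der; ring.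
have bE t : 0 <= t -> has_der b t (be (a t) (b t)).
  move=> t0; have dx := xE t0; have dy := yE t0.
  by rewrite /be Xab Yab /b; der; ring.
have ab0 t : 0 <= t -> al (a t) (b t) = 0 -> be (a t) (b t) = 0 -> False.
  move=> t0 e1 e2; apply: (E_neq0 t0); rewrite -{1}[x t]Xab -{1}[y t]Yab ?E1ab ?E2ab.
    by rewrite e1 e2 !mulr0 addr0.
  by rewrite e1 e2 !mulr0 addr0.
have lb0 : 0 < 1 / 2 + h by qlra.
have h2 : - (2 * h) != 0 by rewrite oppr_eq0 mulf_neq0// gt_eqF.
have al00 : al 0 0 = 0 by rewrite /al X0 Y0 E1z E2z !mulr0 addr0.
have be00 : be 0 0 = 0 by rewrite /be X0 Y0 E1z E2z !mulr0 addr0.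
have [d d0 H] := saddle_avoid lb0 h2 al00 be00 al_sd be_sd n_near n_c be_c n0 aE bE ab0.
exists (d / (2 * K)); first by rewrite divr_gt0// mulr_gt0.
move=> t t0; case: (leP (d / (2 * K)) `|x t - zx|) => [|xd]; first by left.
case: (leP (d / (2 * K)) `|y t - zy|) => [|yd]; first by right.
exfalso; move: xd yd; rewrite !ltr_pdivlMr ?mulr_gt0// => xd yd.
have ha : `|a t| <= K * (`|x t - zx| + `|y t - zy|) by apply: lin_bound => //; exact: KN.
have hb : `|b t| <= K * (`|x t - zx| + `|y t - zy|) by apply: lin_bound.
by case: (H t t0); qlra.
Qed.

Lemma zero_avoid : exists2 d, 0 < d &
  forall t, 0 <= t -> d <= `|x t - zx| \/ d <= `|y t - zy|.
Proof.
case: (leP 1 (4 * (p * s - q * r))) => D; first exact: node_avoid.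
exact: saddle_point_avoid.
Qed.

End Zero.
End Field.

(** * The trajectory *)

Section Clamp.
Variable R : realType.
Implicit Types c r x y : R.

Definition clamp c r x := Num.max (c - r) (Num.min x (c + r)).

Lemma clamp_cases c r x : 0 <= r ->
  [\/ clamp c r x = x /\ c - r <= x <= c + r, clamp c r x = c - r /\ x < c - r |
      clamp c r x = c + r /\ c + r < x].
Proof.
move=> r0; rewrite /clamp; case: (leP x (c + r)) => h1.
  by case: (leP (c - r) x) => h2; [apply: Or31; rewrite ?h1 ?h2|apply: Or32].
by apply: Or33; split => //; apply/max_idPr; qlra.
Qed.

Lemma clamp_near c r x : 0 <= r -> `|clamp c r x - c| <= r.
Proof.
by move=> r0; rewrite ler_norml; have [[-> h]|[-> h]|[-> h]] := clamp_cases c x r0; qlra.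
Qed.

Lemma clamp_id c r x : `|x - c| <= r -> clamp c r x = x.
Proof.
move=> xc; have r0 := le_trans (normr_ge0 _) xc; move: xc; rewrite ler_norml.
by have [[-> _]|[-> h]|[-> h]] := clamp_cases c x r0; qlra.
Qed.

Lemma clamp_lip c r x y : 0 <= r -> `|clamp c r x - clamp c r y| <= `|x - y|.
Proof.
move=> r0; have h1 := ler_norm (x - y); have h2 := ler_norm (- (x - y)).
rewrite normrN in h2; rewrite ler_norml.
have [[-> h]|[-> h]|[-> h]] := clamp_cases c x r0;
  by have [[-> h']|[-> h']|[-> h']] := clamp_cases c y r0; qlra.
Qed.

End Clamp.

Section Polar.
Variable R : realType.

Lemma polar (u v : R) : 0 < u ^+ 2 + v ^+ 2 ->
  exists P th, [/\ 0 < P, u = P * cos th & v = P * sin th].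
Proof.
move=> e0; pose P := Num.sqrt (u ^+ 2 + v ^+ 2).
have P0 : 0 < P by rewrite sqrtr_gt0.
have PP : P ^+ 2 = u ^+ 2 + v ^+ 2 by rewrite sqr_sqrtr// ltW.
have uP : -1 <= u / P <= 1.
  rewrite -ler_norml normrM normfV (gtr0_norm P0) ler_pdivrMr// mul1r.
  by rewrite -sqrtr_sqr ler_wsqrtr// lerDl sqr_ge0.
have uI : u / P \in `[(-1), 1] by rewrite in_itv.
have cE : cos (acos (u / P)) = u / P by rewrite acosK.
have sE : sin (acos (u / P)) = `|v| / P.
  rewrite sin_acos//; have -> : 1 - (u / P) ^+ 2 = (`|v| / P) ^+ 2.
    by rewrite !exprMn !exprVn PP real_normK ?num_real//; field; rewrite -PP expf_neq0// gt_eqF.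
  by rewrite sqrtr_sqr ger0_norm// divr_ge0// ltW.
have uE : u = P * (u / P) by field; rewrite gt_eqF.
case: (leP 0 v) => v0.
  exists P, (acos (u / P)); split; rewrite ?cE ?sE// (ger0_norm v0).
  by field; rewrite gt_eqF.
exists P, (- acos (u / P)); split; rewrite ?cosN ?sinN ?cE ?sE// (ltr0_norm v0).
by field; rewrite gt_eqF.
Qed.

End Polar.

(** * The angle of the velocity as a parameter *)

Section Turning.
Variables (R : realType) (T : R) (u v du dv : R -> R).
Implicit Types t s : R.
Hypothesis T0 : 0 <= T.
Hypothesis uE : forall t, 0 <= t <= T -> has_der u t (du t).
Hypothesis vE : forall t, 0 <= t <= T -> has_der v t (dv t).
Hypothesis uv_gt0 : forall t, 0 <= t <= T -> 0 < u t ^+ 2 + v t ^+ 2.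

(** The angular velocity of [(u, v)], that is, the derivative of its argument. *)
Definition turn t := (u t * dv t - v t * du t) / (u t ^+ 2 + v t ^+ 2).

Hypothesis turn_gt0 : forall t, 0 <= t <= T -> 0 < turn t.
Hypothesis turn_cont : forall t, 0 <= t <= T -> {for t, continuous turn}.

Let cT t := clamp (T / 2) (T / 2) t.
Let w t := turn (cT t).

Let half0 : 0 <= T / 2. Proof. by rewrite divr_ge0. Qed.

Let cT_in t : 0 <= cT t <= T.
Proof.
by have := clamp_near (T / 2) t half0; rewrite -/(cT t) ler_norml => /andP[]; qlra.
Qed.

Let cT_id t : 0 <= t <= T -> cT t = t.
Proof. by move=> /andP[t0 tT]; apply: clamp_id; rewrite ler_norml; qlra. Qed.

Let w_gt0 t : 0 < w t. Proof. exact: turn_gt0. Qed.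

Let w_cont : continuous w.
Proof.
move=> t; apply: (@continuous_comp _ _ _ cT turn); last exact: turn_cont.
apply/cvgrPdist_lt => e e0; apply/nbhs_ballP; exists e => // s; rewrite /ball /= => ts.
exact: le_lt_trans (clamp_lip _ _ _ half0) ts.
Qed.

(** The angle is defined as an integral of [turn]. The squared sine of its deviation from the
    direction of [(u, v)] is [Q ^+ 2 / (u ^+ 2 + v ^+ 2)], which has derivative 0 and vanishes at 0;
    the cosine part [P] then cannot vanish, so it stays positive. *)
Let angle_ex : exists th : R -> R, (forall t, -1 < t -> has_der th t (w t)) /\
  forall t, 0 <= t <= T ->
    exists2 P, 0 < P & u t = P * cos (th t) /\ v t = P * sin (th t).
Proof.
have [G GE] := antiderivative w_cont.
have O : 0 <= (0 : R) <= T by rewrite lexx.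
have [P0 [ph [P0p u0 v0]]] := polar (uv_gt0 O).
pose th t := ph - G 0 + G t.
have thE t : -1 < t -> has_der th t (w t).
  by move=> t1; apply: der_eq; [apply: derD; [exact: der_cst|exact: GE]|rewrite add0r].
have th0 : th 0 = ph by rewrite /th subrK.
exists th; split => //.
pose Q s := v s * cos (th s) - u s * sin (th s).
have Q0 : Q 0 = 0 by rewrite /Q th0 u0 v0; ring.
have Qt t : 0 <= t <= T -> Q t = 0.
  move=> tT; have /andP[t0 _] := tT.
  have sI s : 0 <= s <= t -> 0 <= s <= T by move: tT => /andP[]; qlra.
  have s1 s : 0 <= s <= t -> -1 < s by move=> /andP[]; qlra.
  have : Q 0 ^+ 2 / (u 0 ^+ 2 + v 0 ^+ 2) = Q t ^+ 2 / (u t ^+ 2 + v t ^+ 2).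
    apply: (der_eq0_cst (g := fun s => Q s ^+ 2 / (u s ^+ 2 + v s ^+ 2)) t0) => s st.
    have hu := uE (sI s st); have hv := vE (sI s st); have ht := thE s (s1 s st).
    have n0 : u s ^+ 2 + v s ^+ 2 != 0 by rewrite gt_eqF// uv_gt0// sI.
    have hQ : has_der Q s (- (u s * cos (th s) + v s * sin (th s)) * w s
        + (dv s * cos (th s) - du s * sin (th s))) by rewrite /Q; der; ring.
    have hn : has_der (fun s => u s ^+ 2 + v s ^+ 2) s (2 * (u s * du s + v s * dv s)).
      by der; ring.
    apply: der_eq; first exact: (derM (derX 1 hQ) (derV (f := fun s =>
      u s ^+ 2 + v s ^+ 2) n0 hn)).
    rewrite /w cT_id ?sI// /turn /Q.
    by rewrite expr1; field.
  have nt : u t ^+ 2 + v t ^+ 2 != 0 by rewrite gt_eqF// uv_gt0.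
  rewrite Q0 expr0n mul0r => /esym/eqP.
  by rewrite mulf_eq0 invr_eq0 (negbTE nt) orbF sqrf_eq0 => /eqP.
pose P s := u s * cos (th s) + v s * sin (th s).
have PQ s : P s ^+ 2 + Q s ^+ 2 = u s ^+ 2 + v s ^+ 2.
  rewrite /P /Q; have := cos2Dsin2 (th s); move: (cos _) (sin _) => c d cd.
  transitivity ((u s ^+ 2 + v s ^+ 2) * (c ^+ 2 + d ^+ 2)); first by ring.
  by rewrite cd mulr1.
have P_gt0 t : 0 <= t <= T -> 0 < P t.
  move=> tT; have /andP[t0 tT'] := tT; rewrite ltNge; apply/negP => Pt.
  have P00 : 0 < P 0.
    rewrite /P th0 u0 v0; have -> : P0 * cos ph * cos ph + P0 * sin ph * sin ph =
      P0 * (cos ph ^+ 2 + sin ph ^+ 2) by ring.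
    by rewrite cos2Dsin2 mulr1.
  have [||s /andP[s0 st] Ps] := @ivt_zero R P 0 t t0.
  - move=> s /andP[s0 st]; have sT : 0 <= s <= T by rewrite s0 (le_trans st).
    have hu := uE sT; have hv := vE sT; have ht := thE s (lt_le_trans (ltrN10 R) s0).
    by apply: (@der_cont _ P s); rewrite /P; repeat der1.
  - by rewrite pmulr_rle0.
  have sT : 0 <= s <= T by rewrite s0 (le_trans st).
  by have := uv_gt0 sT; rewrite -PQ Ps Qt// expr0n addr0 ltxx.
move=> t tT; have cd := cos2Dsin2 (th t); exists (P t); first exact: P_gt0.
have uP : u t = P t * cos (th t) - Q t * sin (th t).
  rewrite /P /Q; transitivity (u t * (cos (th t) ^+ 2 + sin (th t) ^+ 2)); last by ring.
  by rewrite cd mulr1.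
have vP : v t = P t * sin (th t) + Q t * cos (th t).
  rewrite /P /Q; transitivity (v t * (cos (th t) ^+ 2 + sin (th t) ^+ 2)); last by ring.
  by rewrite cd mulr1.
by split; [rewrite {1}uP Qt// mul0r subr0|rewrite {1}vP Qt// mul0r addr0].
Qed.

Lemma turning_param : exists (tau P : R -> R) (a b : R),
  [/\ a <= b, tau a = 0, tau b = T,
   forall s, a <= s <= b -> [/\ 0 <= tau s <= T, has_der tau s (turn (tau s))^-1,
     0 < P s, u (tau s) = P s * cos s & v (tau s) = P s * sin s] &
   forall m, (forall t, 0 <= t <= T -> m <= turn t) -> m * T <= b - a].
Proof.
have [th [thE thP]] := angle_ex.
(* The angle is inverted on an interval with [[0, T]] in its interior, so that the inverse has
   two-sided derivatives at both ends. *)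
have h1 : -1 / 2 <= T + 1 by move: T0 => t0; qlra.
have thc s : -1 / 2 <= s <= T + 1 -> {for s, continuous th}.
  by move=> /andP[s1 _]; apply: (der_cont (thE s _)); qlra.
have thi s t : -1 / 2 <= s -> s < t -> t <= T + 1 -> th s < th t.
  move=> s1 st t1; apply: (der_gt0_lt st (fun r rI => thE r ltac:(by move: rI => /andP[];
    qlra))) => r _.
  exact: w_gt0.
have [tau tauc tauP] := incr_inverse h1 thc thi.
have thle s t : -1 / 2 <= s -> s <= t -> t <= T + 1 -> th s <= th t.
  by move=> s1; rewrite le_eqVlt => /predU1P[->//|st] t1; apply/ltW/thi.
have tauK t : -1 / 2 <= t <= T + 1 -> tau (th t) = t.
  move=> /andP[t1 t2]; have [|/andP[u1 u2] e] := tauP (th t); first by rewrite !thle.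
  case: (ltgtP (tau (th t)) t) => // h.
    by have := thi _ _ u1 h t2; rewrite e ltxx.
  by have := thi _ _ t1 h u2; rewrite e ltxx.
have t0 := T0.
have tauD t : 0 <= t <= T -> has_der tau (th t) (turn t)^-1.
  move=> tT; have wt : w t = turn t by rewrite /w cT_id.
  have near_t : \forall s \near t, -1 / 2 <= s <= T + 1.
    have h2 : 0 < 1 / 2 :> R by rewrite divr_gt0.
    apply/nbhs_ballP; exists (1 / 2) => // s; rewrite /ball /= ltr_norml.
    by move: tT => /andP[]; qlra.
  rewrite -wt; apply: (@is_derive_inverse R th tau (w t) t).
  - by apply: filterS near_t => s; exact: tauK.
  - by apply: filterS near_t => s; exact: thc.
  - by apply: thE; move: tT => /andP[]; qlra.
  - by rewrite gt_eqF// w_gt0.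
have O : 0 <= (0 : R) <= T by rewrite lexx.
have TT : 0 <= T <= T by rewrite lexx T0.
have tau_in s : th 0 <= s <= th T -> exists2 t, 0 <= t <= T & s = th t.
  move=> /andP[s1 s2]; have h0 : th (- 1 / 2) <= th 0 by apply: thle; qlra.
  have hT : th T <= th (T + 1) by apply: thle; qlra.
  have [|/andP[u1 u2] e] := tauP s; first by apply/andP; split; qlra.
  exists (tau s) => //; apply/andP; split; rewrite leNgt; apply/negP => h.
    by have := thi _ _ u1 h (ltac:(qlra) : 0 <= T + 1); rewrite e; qlra.
  by have := thi _ _ (ltac:(qlra) : -1 / 2 <= T) h u2; rewrite e; qlra.
pose P s := u (tau s) * cos s + v (tau s) * sin s.
exists tau, P, (th 0), (th T); split.
- by apply: thle; qlra.
- by apply: tauK; qlra.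
- by apply: tauK; qlra.
- move=> s /tau_in[t tT ->]; rewrite tauK; last by move: tT => /andP[]; qlra.
  have [p p0 [up vp]] := thP t tT.
  have Pp : P (th t) = p.
    rewrite /P tauK; last by move: tT => /andP[]; qlra.
    rewrite up vp; transitivity (p * (cos (th t) ^+ 2 + sin (th t) ^+ 2)); first by ring.
    by rewrite cos2Dsin2 mulr1.
  by rewrite Pp; split => //; exact: tauD.
- move=> m mT; have [c cI ->] := der_mvt T0 (fun t tI =>
  thE t (lt_le_trans (ltrN10 R) (andP tI).1)).
  by rewrite subr0 ler_wpM2r// /w cT_id// mT.
Qed.

End Turning.

Section Uniqueness.
Variables (R : realType) (P Q : R -> R -> R) (L : R).
Hypothesis L0 : 0 < L.
Hypothesis Plip : forall x y x' y',
  `|P x y - P x' y'| <= L * (`|x - x'| + `|y - y'|).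
Hypothesis Qlip : forall x y x' y',
  `|Q x y - Q x' y'| <= L * (`|x - x'| + `|y - y'|).
Variables x y : R -> R.
Hypothesis xE : forall t, 0 <= t -> has_der x t (P (x t) (y t)).
Hypothesis yE : forall t, 0 <= t -> has_der y t (Q (x t) (y t)).

(** By the Lipschitz bound, the squared distance to the equilibrium decays at most at the
    exponential rate [4 * L], so it vanishes at [t] only if it vanishes at 0. *)
Lemma equilibrium_unreached t : 0 <= t -> P (x t) (y t) = 0 -> Q (x t) (y t) = 0 ->
  x 0 = x t /\ y 0 = y t.
Proof.
move=> t0 Pt Qt; set zx := x t in Pt Qt *; set zy := y t in Pt Qt *.
pose g s := ((x s - zx) ^+ 2 + (y s - zy) ^+ 2) * expR (4 * L * s).
have gE s : 0 <= s -> has_der g s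
    ((2 * ((x s - zx) * P (x s) (y s) + (y s - zy) * Q (x s) (y s)) +
      4 * L * ((x s - zx) ^+ 2 + (y s - zy) ^+ 2)) * expR (4 * L * s)).
  by move=> s0; have dx := xE s0; have dy := yE s0; rewrite /g; der; ring.
have : g 0 <= g t.
  apply: (der_ge0_le t0 (fun s sI => gE s (andP sI).1)) => s _.
  rewrite mulr_ge0 ?expR_ge0//.
  have h1 := Plip (x s) (y s) zx zy; have h2 := Qlip (x s) (y s) zx zy.
  rewrite Pt subr0 in h1; rewrite Qt subr0 in h2.
  move: (x s - zx) (y s - zy) (P _ _) (Q _ _) h1 h2 => X Y p q h1 h2.
  have X1 : - (`|X| * (L * (`|X| + `|Y|))) <= X * p.
    rewrite lerNl -mulrN; apply: le_trans (ler_norm _) _.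
    by rewrite normrM normrN ler_wpM2l.
  have Y1 : - (`|Y| * (L * (`|X| + `|Y|))) <= Y * q.
    rewrite lerNl -mulrN; apply: le_trans (ler_norm _) _.
    by rewrite normrM normrN ler_wpM2l.
  have L0' := L0.
  have : L * (`|X| + `|Y|) ^+ 2 <= L * (2 * (X ^+ 2 + Y ^+ 2)).
    rewrite ler_wpM2l ?(ltW L0')//; have := sqr_ge0 (`|X| - `|Y|).
    by rewrite sqrrB sqrrD !real_normK ?num_real//; qlra.
  by rewrite sqrrD !expr2; qlra.
rewrite /g /zx /zy !subrr expr0n /= addr0 mul0r mulr0 expR0 mulr1 => h.
have X2 := sqr_ge0 (x 0 - x t); have Y2 := sqr_ge0 (y 0 - y t).
have X0 : (x 0 - x t) ^+ 2 = 0 by qlra.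
have Y0 : (y 0 - y t) ^+ 2 = 0 by qlra.
by split; apply/eqP; rewrite -subr_eq0 -sqrf_eq0 ?X0 ?Y0.
Qed.

End Uniqueness.

(** * The contradiction from one point of positive bending *)

Section Core.
Variables (R : realType) (f E1 E2 E1x E1y E2x E2y : R -> R -> R) (C : R).
Hypothesis fC : C1 f (fun x y => E2 x y - y / 2) (fun x y => x / 2 - E1 x y).
Hypothesis E1C : C1 E1 E1x E1y.
Hypothesis E2C : C1 E2 E2x E2y.
Hypothesis divE : forall x y, E1x x y + E2y x y = 1.
Hypothesis C_gt0 : 0 < C.
Local Notation bend := (bending E1 E2 E1x E1y E2x E2y).
Hypothesis bend_ge : forall x y,
  C ^+ 2 * (E1 x y ^+ 2 + E2 x y ^+ 2) ^+ 3 <= bend x y ^+ 2.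

Lemma bend_eq0 x y : bend x y = 0 -> E1 x y = 0 /\ E2 x y = 0.
Proof.
move=> b0; have := bend_ge x y; rewrite b0 expr0n /=.
rewrite pmulr_rle0 ?exprn_gt0// => h.
have e0 : 0 <= E1 x y ^+ 2 + E2 x y ^+ 2 by rewrite addr_ge0 ?sqr_ge0.
have : E1 x y ^+ 2 + E2 x y ^+ 2 == 0.
  rewrite eq_le e0 andbT leNgt; apply/negP => h2.
  by move: h; rewrite leNgt exprn_gt0.
by rewrite paddr_eq0 ?sqr_ge0// !sqrf_eq0 => /andP[/eqP -> /eqP ->].
Qed.

Section Arc.
Variables (x y : R -> R) (T : R).
Hypothesis T0 : 0 <= T.
Hypothesis xE : forall t, 0 <= t <= T -> has_der x t (E1 (x t) (y t)).
Hypothesis yE : forall t, 0 <= t <= T -> has_der y t (E2 (x t) (y t)).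
Hypothesis E_neq0 : forall t, 0 <= t <= T ->
  E1 (x t) (y t) = 0 -> E2 (x t) (y t) = 0 -> False.
Hypothesis bend0 : 0 < bend (x 0) (y 0).

Let e t := E1 (x t) (y t) ^+ 2 + E2 (x t) (y t) ^+ 2.

Let e_gt0 t : 0 <= t <= T -> 0 < e t.
Proof.
move=> tT; rewrite lt_neqAle addr_ge0 ?sqr_ge0// andbT eq_sym paddr_eq0 ?sqr_ge0//.
by rewrite !sqrf_eq0; apply/negP => /andP[/eqP h1 /eqP h2]; exact: (E_neq0 tT).
Qed.

Let along (g : R -> R -> R) t : cont2 g -> 0 <= t <= T -> {for t, continuous (fun t =>
  g (x t) (y t))}.
Proof. by move=> gc tT; apply: (cont2_comp gc);
  [exact: (der_cont (xE tT))|exact: (der_cont (yE tT))]. Qed.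

Lemma bend_gt0_along t : 0 <= t <= T -> 0 < bend (x t) (y t).
Proof.
move=> tT; have /andP[t0 tT'] := tT; rewrite ltNge; apply/negP => bt.
have [||s /andP[s0 st] bs] := @ivt_zero R (fun t => bend (x t) (y t)) 0 t t0.
- move=> s /andP[s0 st]; apply: along; first exact: bend_cont.
  by rewrite s0 (le_trans st).
- by rewrite pmulr_rle0.
have [h1 h2] := bend_eq0 bs; apply: (E_neq0 _ h1 h2).
by rewrite s0 (le_trans st).
Qed.

(* The parameter s is the angle of the velocity. *)
Lemma arc_param : exists (X Y rho : R -> R) (a b : R),
  [/\ [/\ a <= b, X a = x 0, Y a = y 0, X b = x T & Y b = y T],
      [/\ forall s, a <= s <= b -> has_der X s (rho s * cos s),
          forall s, a <= s <= b -> has_der Y s (rho s * sin s) &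
          forall s, a <= s <= b -> has_der (fun s => f (X s) (Y s)) s
            (rho s * (X s * sin s - Y s * cos s) / 2)],
      forall s, a <= s <= b -> 0 < rho s <= C^-1,
      forall s, a <= s <= b -> exists t p, [/\ 0 <= t <= T, X s = x t /\ Y s = y t,
        0 < p, p ^+ 2 = e t & rho s = p ^+ 3 / bend (x t) (y t)] &
      forall m, (forall t, 0 <= t <= T -> m <= bend (x t) (y t) / e t) -> m * T <= b - a].
Proof.
pose u t := E1 (x t) (y t); pose v t := E2 (x t) (y t).
pose du t := E1x (x t) (y t) * u t + E1y (x t) (y t) * v t.
pose dv t := E2x (x t) (y t) * u t + E2y (x t) (y t) * v t.
have uE t : 0 <= t <= T -> has_der u t (du t).
  by move=> tT; exact: (chain2 E1C (xE tT) (yE tT)).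
have vE t : 0 <= t <= T -> has_der v t (dv t).
  by move=> tT; exact: (chain2 E2C (xE tT) (yE tT)).
have turnE t : turn u v du dv t = bend (x t) (y t) / e t by [].
have turn_gt0 t : 0 <= t <= T -> 0 < turn u v du dv t.
  by move=> tT; rewrite turnE divr_gt0 ?e_gt0// bend_gt0_along.
have turn_cont t : 0 <= t <= T -> {for t, continuous (turn u v du dv)}.
  move=> tT; have c1 := C1_cont E1C; have c2 := C1_cont E2C.
  apply: (@continuousM _ _ (fun t => bend (x t) (y t)) (fun t => (e t)^-1)).
    by apply: along tT; exact: bend_cont.
  apply: (@continuousV _ _ e); first by rewrite gt_eqF// e_gt0.
  by apply: (along (g := fun x y => E1 x y ^+ 2 + E2 x y ^+ 2)) tT; apply: cont2D;
    exact: cont2M.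
have [tau [P [a [b [ab ta tb tP tm]]]]] := turning_param T0 uE vE e_gt0 turn_gt0 turn_cont.
exists (fun s => x (tau s)), (fun s => y (tau s)), (fun s =>
  P s / turn u v du dv (tau s)), a, b.
have eE t : e t = u t ^+ 2 + v t ^+ 2 by [].
have rE s : a <= s <= b -> P s / turn u v du dv (tau s) = P s ^+ 3 / bend (x (tau s)) (y (tau
  s)).
  move=> sI; have [tT _ P0 uP vP] := tP s sI; rewrite turnE.
  have -> : e (tau s) = P s ^+ 2 by rewrite eE uP vP !exprMn -mulrDr cos2Dsin2 mulr1.
  have := bend_gt0_along tT; have := e_gt0 tT; move: (bend _ _) => B _ B0.
  by field; rewrite !gt_eqF.
have PP s : a <= s <= b -> P s ^+ 2 = e (tau s).
  move=> sI; have [tT _ P0 uP vP] := tP s sI.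
  by rewrite eE uP vP !exprMn -mulrDr cos2Dsin2 mulr1.
have dX s : a <= s <= b -> has_der (fun s =>
  x (tau s)) s (P s / turn u v du dv (tau s) * cos s).
  move=> sI; have [tT tD P0 uP vP] := tP s sI.
  by apply: der_eq; [exact: der_comp (xE tT) tD|rewrite -/(u _) uP; ring].
have dY s : a <= s <= b -> has_der (fun s =>
  y (tau s)) s (P s / turn u v du dv (tau s) * sin s).
  move=> sI; have [tT tD P0 uP vP] := tP s sI.
  by apply: der_eq; [exact: der_comp (yE tT) tD|rewrite -/(v _) vP; ring].
split.
- by rewrite ta tb.
- split=> // s sI; have [tT tD P0 uP vP] := tP s sI.
  (* The velocity is parallel to the field, whose terms in the gradient of [f] therefore cancel; the
     area form remains. *)
  apply: der_eq; first exact: (chain2 fC (dX s sI) (dY s sI)).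
  have uP' : E1 (x (tau s)) (y (tau s)) = P s * cos s := uP.
  have vP' : E2 (x (tau s)) (y (tau s)) = P s * sin s := vP.
  rewrite uP' vP'; move: (turn_gt0 _ tT); move: (turn _ _ _ _ _) => w w0.
  by field; rewrite gt_eqF.
- move=> s sI; have [tT tD P0 uP vP] := tP s sI.
  have B0 := bend_gt0_along tT.
  rewrite rE// divr_gt0 ?exprn_gt0//= ler_pdivrMr// mulrC ler_pdivlMr// mulrC.
  have := bend_ge (x (tau s)) (y (tau s)); rewrite -/(e (tau s)) -PP// -exprM.
  have -> : C ^+ 2 * P s ^+ (2 * 3) = (C * P s ^+ 3) ^+ 2 by rewrite exprMn -exprM.
  by rewrite ler_sqr ?nnegrE ?mulr_ge0 ?exprn_ge0// ltW.
- move=> s sI; have [tT tD P0 uP vP] := tP s sI.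
  by exists (tau s), (P s); split => //; [exact: PP|exact: rE].
- by move=> m mT; apply: tm => t tT; exact: mT.
Qed.

Lemma arc_displacement :
  `|x T - x 0| <= 64 * C^-1 /\ `|y T - y 0| <= 64 * C^-1.
Proof.
have [X [Y [rho [a [b [[ab <- <- <- <-] [dX dY dZ] rC _ _]]]]]] := arc_param.
apply: (displacement_le dX dY (fun s sI => (andP (rC s sI)).1) (fun s sI =>
  (andP (rC s sI)).2) dZ) => //.
  by move=> s t _ _ -> ->.
by rewrite invr_ge0 ltW.
Qed.

End Arc.

Lemma trajectory (x0 y0 : R) : 0 < bend x0 y0 -> exists (x y : R -> R) (B : R),
  [/\ x 0 = x0 /\ y 0 = y0,
  forall t, 0 <= t -> has_der x t (E1 (x t) (y t)) /\ has_der y t (E2 (x t) (y t)),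
  forall t, 0 <= t -> E1 (x t) (y t) = 0 -> E2 (x t) (y t) = 0 -> False &
  forall t, 0 <= t -> `|x t - x0| <= B /\ `|y t - y0| <= B].
Proof.
(* [K] bounds each coordinate of the displacement, and [r] satisfies [2 * K ^+ 2 < r ^+ 2]. *)
move=> b0; pose K := 64 * C^-1; pose r := 2 * K + 1.
have K0 : 0 <= K by rewrite mulr_ge0 ?invr_ge0 ?(ltW C_gt0).
have r0 : 0 < r by rewrite /r; qlra.
have [L1 L10 lip1] := C1_lip x0 y0 r E1C.
have [L2 L20 lip2] := C1_lip x0 y0 r E2C.
have clampE (a u v : R) : `|clamp a r u - clamp a r v| <= `|u - v| by apply/clamp_lip/ltW.
have near (a u : R) : `|clamp a r u - a| <= r by apply/clamp_near/ltW.
(* Clamping to a box that the trajectory does not leave makes E Lipschitz. *)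
pose P x y := E1 (clamp x0 r x) (clamp y0 r y).
pose Q x y := E2 (clamp x0 r x) (clamp y0 r y).
have L0 : 0 < L1 + L2 by rewrite addr_gt0.
have Plip x y x' y' : `|P x y - P x' y'| <= (L1 + L2) * (`|x - x'| + `|y - y'|).
  apply: le_trans (lip1 _ _ _ _ (near _ _) (near _ _) (near _ _) (near _ _)) _.
  apply: ler_pM; rewrite ?(ltW L10) ?addr_ge0//; first by rewrite lerDl ltW.
  by apply: lerD.
have Qlip x y x' y' : `|Q x y - Q x' y'| <= (L1 + L2) * (`|x - x'| + `|y - y'|).
  apply: le_trans (lip2 _ _ _ _ (near _ _) (near _ _) (near _ _) (near _ _)) _.
  apply: ler_pM; rewrite ?(ltW L20) ?addr_ge0//; first by rewrite lerDr ltW.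
  by apply: lerD.
have [x [y [x0E y0E xyE]]] := picard x0 y0 L0 Plip Qlip.
have ne t : 0 <= t -> P (x t) (y t) = 0 -> Q (x t) (y t) = 0 -> False.
  move=> t0 Pt Qt.
  have [xt yt] := equilibrium_unreached L0 Plip Qlip (fun s hs => (xyE s hs).1)
    (fun s hs => (xyE s hs).2) t0 Pt Qt.
  have cl (a : R) : clamp a r a = a by apply: clamp_id; rewrite subrr normr0 ltW.
  move: Pt Qt b0; rewrite /P /Q -xt -yt x0E y0E !cl /bending => -> ->.
  by rewrite !mul0r subrr ltxx.
pose D s := (x s - x0) ^+ 2 + (y s - y0) ^+ 2.
have inbox s : D s <= r ^+ 2 -> P (x s) (y s) = E1 (x s) (y s) /\ Q (x s) (y s) = E2 (x s) (y
  s).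
  move=> Ds; have hx : `|x s - x0| <= r.
    rewrite -(ler_pXn2r (n := 2)) ?nnegrE ?(ltW r0)// real_normK ?num_real//.
    by apply: le_trans Ds; rewrite lerDl sqr_ge0.
  have hy : `|y s - y0| <= r.
    rewrite -(ler_pXn2r (n := 2)) ?nnegrE ?(ltW r0)// real_normK ?num_real//.
    by apply: le_trans Ds; rewrite lerDr sqr_ge0.
  by rewrite /P /Q !clamp_id.
have disp t : 0 <= t -> (forall s, 0 <= s <= t -> D s <= r ^+ 2) ->
    `|x t - x0| <= K /\ `|y t - y0| <= K.
  move=> t0 Dt; rewrite -x0E -y0E; apply: (arc_displacement t0).
  - move=> s sI; have [<- _] := inbox s (Dt s sI); exact: (xyE s (andP sI).1).1.
  - move=> s sI; have [_ <-] := inbox s (Dt s sI); exact: (xyE s (andP sI).1).2.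
  - by move=> s sI; have [<- <-] := inbox s (Dt s sI); exact: ne (andP sI).1.
  - by rewrite x0E y0E.
(* Up to its first arrival on the circle of radius [r] the trajectory follows the unclamped field,
   so [disp] applies and gives [D <= 2 * K ^+ 2], too small for an arrival. *)
have stay t : 0 <= t -> D t < r ^+ 2.
  move=> t0; rewrite ltNge; apply/negP => Dt.
  have [|||s [/andP[s0 st] gs gp]] := @first_zero R (fun s => r ^+ 2 - D s) 0 t t0.
  - move=> s /andP[s0 _]; have [dx dy] := xyE s s0.
    by apply: (@der_cont _ _ _ (- (2 * ((x s - x0) * P (x s) (y s) + (y s - y0) * Q (x s) (y
      s)))));
      rewrite /D; der; ring.
  - by rewrite /D x0E y0E !subrr expr0n /= addr0 subr0 exprn_gt0.
  - by rewrite subr_le0.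
  have Ds u : 0 <= u <= s -> D u <= r ^+ 2.
    move=> /andP[u0]; rewrite le_eqVlt => /predU1P[->|us].
      by rewrite -subr_ge0 gs.
    by rewrite -subr_ge0 ltW// gp// u0.
  have [hx hy] := disp s (ltW s0) Ds.
  have hx2 : (x s - x0) ^+ 2 <= K ^+ 2.
    by rewrite -[leLHS]real_normK ?num_real// ler_pXn2r ?nnegrE.
  have hy2 : (y s - y0) ^+ 2 <= K ^+ 2.
    by rewrite -[leLHS]real_normK ?num_real// ler_pXn2r ?nnegrE.
  move: gs; rewrite /D /r sqrrD expr1n mulr1 exprMn; move: hx2 hy2 (sqr_ge0 K).
  move: ((x s - x0) ^+ 2) ((y s - y0) ^+ 2) (K ^+ 2) => X Y Z.
  by rewrite !expr2; qlra.
exists x, y, K; split => //.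
- move=> t t0; have [<- <-] := inbox t (ltW (stay t t0)); exact: xyE.
- by move=> t t0; have [<- <-] := inbox t (ltW (stay t t0)); exact: ne.
- by move=> t t0; apply: disp t0 _ => s /andP[s0 _]; rewrite ltW ?stay.
Qed.

(** Each point of the box has a neighbourhood in which the speed along the trajectory is bounded
    below: by continuity, or, at a zero, because the trajectory does not enter. Compactness makes
    the bound uniform. *)
Lemma speed_ge (x y : R -> R) (x0 y0 B : R) :
  (forall t, 0 <= t -> has_der x t (E1 (x t) (y t)) /\ has_der y t (E2 (x t) (y t))) ->
  (forall t, 0 <= t -> E1 (x t) (y t) = 0 -> E2 (x t) (y t) = 0 -> False) ->
  (forall t, 0 <= t -> `|x t - x0| <= B /\ `|y t - y0| <= B) ->
  exists2 c, 0 < c & forall t, 0 <= t -> c <= E1 (x t) (y t) ^+ 2 + E2 (x t) (y t) ^+ 2.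
Proof.
move=> xyE ne xyB; pose e a b := E1 a b ^+ 2 + E2 a b ^+ 2.
have ec : cont2 e.
  by have c1 := C1_cont E1C; have c2 := C1_cont E2C; apply: cont2D; exact: cont2M.
have local (a b : R) : exists d m : R, [/\ 0 < d, 0 < m &
    forall t : R, 0 <= t -> `|x t - a| < d -> `|y t - b| < d -> m <= e (x t) (y t)].
  have e0 : 0 <= e a b by rewrite addr_ge0 ?sqr_ge0.
  case: (eqVneq (e a b) 0) => [/eqP|eab].
    rewrite paddr_eq0 ?sqr_ge0// !sqrf_eq0 => /andP[/eqP h1 /eqP h2].
    have [d d0 far] := zero_avoid E1C E2C divE bend_eq0 h1 h2
      (fun t ht => (xyE t ht).1) (fun t ht => (xyE t ht).2) ne.
    (* Any positive bound would do, as the trajectory does not enter this neighbourhood. *)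
    exists d, 1; split => // t t0; rewrite !ltNge => h3 h4.
    by case: (far t t0) => h; [rewrite h in h3|rewrite h in h4].
  have eab0 : 0 < e a b / 2 by rewrite divr_gt0// lt_neqAle eq_sym eab.
  have [d d0 H] := cont2_eps a b ec eab0.
  exists d, (e a b / 2); split => // t t0 h1 h2.
  by have := H _ _ h1 h2; rewrite ltr_norml; move: (e (x t) (y t)) (e a b) => u v; qlra.
apply: contrapT => small.
have /choice[t tP] (n : nat) : exists t, 0 <= t /\ e (x t) (y t) < n.+1%:R^-1.
  apply: contrapT => h; apply: small; exists n.+1%:R^-1 => // s s0.
  by rewrite leNgt; apply/negP => h'; apply: h; exists s.
pose A := `[x0 - B, x0 + B] `*` `[y0 - B, y0 + B].
have cA : compact A by apply: compact_setX; exact: segment_compact.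
pose u n := (x (t n), y (t n)).
have uA : (u @ \oo) A.
  exists 0%N => // n _; have [t0 _] := tP n; have [] := xyB _ t0.
  by rewrite !ler_distl => h1 h2; split; rewrite /= in_itv.
have [[a b] [_ cl]] := cA _ _ uA.
have [d [m [d0 m0 H]]] := local a b.
pose N := Num.bound m^-1.
have [||p [[n Nn <-] [/= h1 h2]]] := cl [set p | exists2 n, (N <= n)%N & u n = p] (ball (a,
  b) d).
- by exists N => // n /= Nn; exists n.
- exact: nbhsx_ballx.
rewrite /ball /= in h1 h2.
have [t0 et] := tP n; have := H _ t0; rewrite (distrC _ a) (distrC _ b) => /(_ h1 h2).
apply/negP; rewrite -ltNge; apply: lt_le_trans et _.
rewrite -[leRHS]invrK lef_pV2 ?posrE ?invr_gt0//.
have /ltW mN : m^-1 < N%:R by apply: archi_boundP; rewrite invr_ge0 ltW.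
by apply: le_trans mN _; rewrite ler_nat (leq_trans Nn).
Qed.

Lemma bend_le0 x0 y0 : bend x0 y0 <= 0.
Proof.
rewrite leNgt; apply/negP => b0.
have [x [y [B [[x0E y0E] xyE ne xyB]]]] := trajectory b0.
have [c c0 ce] := speed_ge xyE ne xyB.
have E1c := C1_cont E1C; have E2c := C1_cont E2C.
have [N N0 bN] := cont2_bounded x0 y0 B (bend_cont E1C E2C).
have [M M0 fM] := cont2_bounded x0 y0 B (C1_cont fC).
have [X0 X00 xM] := cont2_bounded x0 y0 B (@cont2_fst R).
have [Y0 Y00 yM] := cont2_bounded x0 y0 B (@cont2_snd R).
(* [q] is a lower bound of the speed, and [r0] one of the radius of curvature |E|^3 / N. *)
pose q := Num.sqrt c; have q0 : 0 < q by rewrite sqrtr_gt0.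
pose r0 := q ^+ 3 / N; have r00 : 0 < r0 by rewrite divr_gt0 ?exprn_gt0.
(* A bound for [area] on the box: two values of [f], and half of two products of coordinates. *)
pose F := 2 * M + X0 * Y0.
have F0 : 0 < F by rewrite addr_gt0 ?mulr_gt0.
pose n := Num.bound (F / (r0 ^+ 2 / 2)).
have nF : F < n%:R * (r0 ^+ 2 / 2).
  rewrite -ltr_pdivrMr ?divr_gt0 ?exprn_gt0//.
  by apply: archi_boundP; rewrite !divr_ge0 ?exprn_ge0 ?ltW.
pose W := 2 * ((n%:R + 1) * (2 * @pi R)).
have W0 : 0 <= W.
  by have p0 := pi_ge0 R; apply: mulr_ge0 => //; apply: mulr_ge0;
    [apply: addr_ge0|apply: mulr_ge0].
have Cq : 0 < C * q by rewrite mulr_gt0.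
(* The turning rate N / |E|^2 is at least C |E|, hence at least [C * q]: by time [T] the total
   turning reaches [W]. *)
pose T := W / (C * q); have T0 : 0 <= T by rewrite divr_ge0// ltW.
have ne' t : 0 <= t <= T -> E1 (x t) (y t) = 0 -> E2 (x t) (y t) = 0 -> False.
  by move=> /andP[t0 _]; exact: ne.
have xT t : 0 <= t <= T -> has_der x t (E1 (x t) (y t)) by move=> /andP[/xyE[]].
have yT t : 0 <= t <= T -> has_der y t (E2 (x t) (y t)) by move=> /andP[/xyE[]].
have b0' : 0 < bend (x 0) (y 0) by rewrite x0E y0E.
have [X [Y [rho [a [b [[ab _ _ _ _] [dX dY dZ] rC rE mT]]]]]] := arc_param T0 xT yT ne' b0'.
have Wab : W <= b - a.
  have -> : W = C * q * T by rewrite /T mulrC divfK// gt_eqF.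
  apply: mT => t tT; have /andP[t0 _] := tT.
  have e0 := lt_le_trans c0 (ce t t0); have bt := bend_gt0_along xT yT ne' b0' tT.
  have := bend_ge (x t) (y t); have := ce t t0; move: e0 bt.
  move: (E1 _ _ ^+ 2 + _) (bend _ _) => e d e0 bt ce' be.
  rewrite ler_pdivlMr//; apply: (@le_trans _ _ (C * Num.sqrt e * e)).
    by rewrite ler_wpM2r ?(ltW e0)// ler_wpM2l ?(ltW C_gt0)// ler_wsqrtr.
  have h0 : 0 <= C * Num.sqrt e * e by rewrite !mulr_ge0 ?sqrtr_ge0 ?ltW.
  rewrite -(ler_pXn2r (n := 2)) ?nnegrE ?(ltW bt)//.
  by apply: le_trans be; rewrite !exprMn sqr_sqrtr ?(ltW e0)// -mulrA -exprS.
have rho0 s : a <= s <= b -> r0 <= rho s.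
  move=> sI; have [t [p [/andP[t0 tT] _ p0 pe ->]]] := rE s sI.
  have bt := bend_gt0_along xT yT ne' b0' (introT andP (conj t0 tT)).
  have [bx by_] := xyB t t0; have bN' := le_trans (ler_norm _) (bN _ _ bx by_).
  apply: ler_pM; rewrite ?exprn_ge0 ?invr_ge0 ?(ltW q0) ?(ltW N0) ?lef_pV2 ?posrE//.
  rewrite ler_pXn2r ?nnegrE ?(ltW q0) ?(ltW p0)//.
  have -> : p = Num.sqrt (p ^+ 2) by rewrite sqrtr_sqr gtr0_norm.
  by rewrite ler_wsqrtr// pe ce.
have same s t : a <= s <= b -> a <= t <= b -> X s = X t -> Y s = Y t -> f (X s) (Y s) = f (X
  t) (Y t).
  by move=> _ _ -> ->.
have [s [v [sI vI]]] := area_unbounded dX dY (fun s sI =>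
  (andP (rC s sI)).1) dZ same r00 rho0 Wab.
apply/negP; rewrite -ltNge; apply: le_lt_trans nF; rewrite /F /area.
have [t1 [_ [/andP[t10 _] [-> ->] _ _ _]]] := rE s sI.
have [t2 [_ [/andP[t20 _] [-> ->] _ _ _]]] := rE v vI.
have [h1 h2] := xyB _ t10; have [h3 h4] := xyB _ t20.
have [f1 f2] := (fM _ _ h1 h2, fM _ _ h3 h4).
have [x1 x2] := (xM _ _ h1 h2, xM _ _ h3 h4).
have [y1 y2] := (yM _ _ h1 h2, yM _ _ h3 h4).
have p1 : `|x t2 * y t1| <= X0 * Y0 by rewrite normrM ler_pM.
have p2 : `|y t2 * x t1| <= X0 * Y0 by rewrite normrM mulrC ler_pM.
move: f1 f2 p1 p2; rewrite !ler_norml.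
by move: (f _ _) (f _ _) (x t2 * _) (y t2 * _) (X0 * Y0) => u1 u2 u3 u4 u5; qlra.
Qed.

End Core.

(** * Exclusion of negative bending and conclusion for plane fields *)

Section NoField.
Variables (R : realType).

Lemma cont2_reflect (g : R -> R -> R) : cont2 g -> cont2 (fun x y => g x (- y)).
Proof.
move=> gc; apply: (cont2_comp2 (X := fun x _ => x) (Y := fun _ y => - y)) => //.
  exact: cont2_fst.
by apply: cont2N; exact: cont2_snd.
Qed.

Lemma C1_reflect (g gx gy : R -> R -> R) : C1 g gx gy ->
  C1 (fun x y => g x (- y)) (fun x y => gx x (- y)) (fun x y => - gy x (- y)).
Proof.
move=> [dx dy cx cy]; split.
- by move=> x y; exact: dx.
- move=> x y; apply: der_eq; first exact: der_comp (dy x (- y)) (derN (der_id y)).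
  by rewrite mulrN1.
- exact: cont2_reflect.
- by apply: cont2N; exact: cont2_reflect.
Qed.

Lemma C1_opp (g gx gy : R -> R -> R) : C1 g gx gy ->
  C1 (fun x y => - g x y) (fun x y => - gx x y) (fun x y => - gy x y).
Proof.
move=> [dx dy cx cy]; split; try exact: cont2N.
- by move=> x y; apply: derN; exact: dx.
- by move=> x y; apply: derN; exact: dy.
Qed.

Lemma C1_eq (g gx gy gx' gy' : R -> R -> R) : C1 g gx gy ->
  (forall x y, gx x y = gx' x y) -> (forall x y, gy x y = gy' x y) -> C1 g gx' gy'.
Proof.
move=> + ex ey; have -> : gx = gx' by apply/funext => x; apply/funext => y; exact: ex.
by have -> : gy = gy' by apply/funext => x; apply/funext => y; exact: ey.
Qed.

Variables (f E1 E2 E1x E1y E2x E2y : R -> R -> R) (C : R).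
Hypothesis fC : C1 f (fun x y => E2 x y - y / 2) (fun x y => x / 2 - E1 x y).
Hypothesis E1C : C1 E1 E1x E1y.
Hypothesis E2C : C1 E2 E2x E2y.
Hypothesis divE : forall x y, E1x x y + E2y x y = 1.
Hypothesis C_gt0 : 0 < C.
Local Notation bend := (bending E1 E2 E1x E1y E2x E2y).
Hypothesis bend_ge : forall x y,
  C ^+ 2 * (E1 x y ^+ 2 + E2 x y ^+ 2) ^+ 3 <= bend x y ^+ 2.

(* Replacing f(x, y) by - f(x, - y) preserves the hypotheses and changes the sign
   of bend. *)
Lemma bend_ge0 x y : 0 <= bend x y.
Proof.
have f'C : C1 (fun x y => - f x (- y)) (fun x y => - E2 x (- y) - y / 2)
    (fun x y => x / 2 - E1 x (- y)).
  apply: (C1_eq (C1_opp (C1_reflect fC))) => a b; rewrite ?opprK//.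
  by rewrite mulNr; ring.
have E1'C := C1_reflect E1C; have E2'C := C1_opp (C1_reflect E2C).
have bendE a b : bending (fun x y => E1 x (- y)) (fun x y => - E2 x (- y))
    (fun x y => E1x x (- y)) (fun x y => - E1y x (- y)) (fun x y => - E2x x (- y))
    (fun x y => - - E2y x (- y)) a b = - bend a (- b).
  by rewrite /bending; ring.
have divE' a b : E1x a (- b) + - - E2y a (- b) = 1 by rewrite opprK.
have := bend_le0 f'C E1'C E2'C divE' C_gt0 _ x (- y).
rewrite bendE opprK oppr_le0; apply => a b.
by rewrite bendE !sqrrN.
Qed.

Lemma field_absurd : False.
Proof.
have b0 x y : bend x y = 0.
  by apply/eqP; rewrite eq_le bend_ge0 (bend_le0 fC E1C E2C divE C_gt0 bend_ge).
have E0 x y := bend_eq0 C_gt0 bend_ge (b0 x y).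
have [d1 _ _ _] := E1C; have [_ d2 _ _] := E2C.
have z1 : E1 ^~ 0 = fun=> 0 by apply/funext => x; have [] := E0 x 0.
have z2 : E2 0 = fun=> 0 by apply/funext => y; have [] := E0 0 y.
have h1 := d1 0 0; rewrite z1 in h1; have h2 := d2 0 0; rewrite z2 in h2.
have := divE 0 0; rewrite /has_der in h1 h2.
rewrite -(@derive_val _ _ _ _ _ _ _ h1) -(@derive_val _ _ _ _ _ _ _ h2) !derive_cst addr0 =>
  /eqP.
by rewrite eq_sym oner_eq0.
Qed.

End NoField.

(** * T-graphs *)

Section Lines.
Variables (R : realType) (V : normedModType R).

(** Equality of the difference quotients themselves, so that derivability and the value of the
    derivative carry over in both directions. *)
Lemma line_quotient (phi : R -> R) (x : R) (F : V -> R) (v p : V) :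
  (forall h, phi (h + x) = F (h *: v + p)) ->
  (fun h => h^-1 *: ((phi \o shift x) (h *: (1 : R)) - phi x)) =
  (fun h => h^-1 *: ((F \o shift p) (h *: v) - F p)).
Proof.
move=> phiF; apply/funext => h /=; congr (_ *: (_ - _)).
  by rewrite -phiF; congr (phi (_ + x)); rewrite /GRing.scale /= mulr1.
by have := phiF 0; rewrite scale0r !add0r.
Qed.

Lemma has_der_line (phi : R -> R) (x : R) (F : V -> R) (v p : V) :
  (forall h, phi (h + x) = F (h *: v + p)) -> derivable F p v ->
  has_der phi x ('D_v F p).
Proof.
move=> /line_quotient E; rewrite /has_der /derivable /derive -E => dF.
by split.
Qed.

Lemma derive_line (phi : R -> R) (x d : R) (F : V -> R) (v p : V) :
  (forall h, phi (h + x) = F (h *: v + p)) -> has_der phi x d -> 'D_v F p = d.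
Proof.
move=> /line_quotient E xd; rewrite /derive -E.
exact: (@derive_val _ _ _ _ _ _ _ xd).
Qed.

End Lines.

Section Plane.
Variable R : realType.

(** As a combination of basis vectors, so that changing one coordinate is visibly a translation
    along a basis vector. *)
Definition plane_pt (x y : R) : 'rV[R]_2 := x *: delta_mx 0 0 + y *: delta_mx 0 1.

Lemma plane_cont2 (F : 'rV[R]_2 -> R) : continuous F -> cont2 (fun x y => F (plane_pt x y)).
Proof.
move=> Fc p; apply: (@continuous_comp _ _ _ (fun p : R * R => plane_pt p.1 p.2) F);
  last exact: Fc.
by apply: cvgD; apply: cvgZ; try exact: cvg_cst; [exact: cvg_fst|exact: cvg_snd].
Qed.

Lemma class_C1 (F : 'rV[R]_2 -> R) : class_C 1 setT F ->
  C1 (fun x y => F (plane_pt x y)) (fun x y => partial 0 F (plane_pt x y))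
    (fun x y => partial 1 F (plane_pt x y)).
Proof.
move=> [_ dF]; have [d0 [c0 _]] := dF 0; have [d1 [c1 _]] := dF 1; split.
- move=> x y; apply: has_der_line (d0 _ I) => h.
  by rewrite /plane_pt scalerDl addrA.
- move=> x y; apply: has_der_line (d1 _ I) => h.
  by rewrite /plane_pt scalerDl addrCA.
- by apply: plane_cont2 => q; exact: c0.
- by apply: plane_cont2 => q; exact: c1.
Qed.

End Plane.

(** * The field and the horizontal mean curvature of a T-graph *)

Section Graph.
Variables (R : realType) (f : 'rV[R]_2 -> R).
Hypothesis fC2 : class_C 2 setT f.

Local Notation fx := (fun x y => partial 0 f (plane_pt x y)).
Local Notation fy := (fun x y => partial 1 f (plane_pt x y)).
Local Notation D2 i j := (fun x y => partial j (partial i f) (plane_pt x y)).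

(** [(- field2, field1)] is the horizontal gradient of [graph_fun]; turned by a right angle, it
    gives the horizontal tangent direction of the graph. *)
Definition field1 x y : R := x / 2 - fy x y.
Definition field2 x y : R := y / 2 + fx x y.

Let partialC (i : 'I_2) : class_C 1 setT (partial i f).
Proof. exact: (fC2.2 i).2. Qed.

Let class1 : class_C 1 setT f.
Proof.
split; first exact: fC2.1.
move=> i; have [d c] := fC2.2 i; split=> //; split=> //; exact: c.1.
Qed.

Lemma field1_C1 : C1 field1 (fun x y => 1 / 2 - D2 1 0 x y) (fun x y => - D2 1 1 x y).
Proof.
have [dx dy cx cy] := class_C1 (partialC 1); split.
- by move=> x y; have h := dx x y; rewrite /field1; der; field.
- by move=> x y; have h := dy x y; rewrite /field1; der; ring.
- by apply: cont2D; [exact: cont2_cst|exact: cont2N].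
- exact: cont2N.
Qed.

Lemma field2_C1 : C1 field2 (D2 0 0) (fun x y => 1 / 2 + D2 0 1 x y).
Proof.
have [dx dy cx cy] := class_C1 (partialC 0); split.
- by move=> x y; have h := dx x y; rewrite /field2; der; ring.
- by move=> x y; have h := dy x y; rewrite /field2; der; field.
- by [].
- by apply: cont2D; [exact: cont2_cst|].
Qed.

(** The mixed derivatives cancel, and the divergence of (x, y) / 2 remains. *)
Lemma field_div x y : (1 / 2 - D2 1 0 x y) + (1 / 2 + D2 0 1 x y) = 1.
Proof.
have [dx dy _ _] := class_C1 class1.
have [_ dxy _ cxy] := class_C1 (partialC 0); have [dyx _ cyx _] := class_C1 (partialC 1).
by rewrite (schwarz dx dy dxy dyx cxy cyx); field.
Qed.

Lemma graph_C1 : C1 (fun x y => f (plane_pt x y)) (fun x y => field2 x y - y / 2)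
  (fun x y => x / 2 - field1 x y).
Proof.
apply: (C1_eq (class_C1 class1)) => x y.
  by rewrite /field2 addrC addKr.
by rewrite /field1 subKr.
Qed.

Lemma proj_xyE (p : 'rV[R]_3) : proj_xy p = plane_pt (p 0 0) (p 0 1).
Proof.
apply/rowP => i; rewrite !mxE; case: i => -[|[|//]] i2 /=.
  by rewrite mulr1 mulr0 addr0.
by rewrite mulr1 mulr0 add0r.
Qed.

Let e x y := field1 x y ^+ 2 + field2 x y ^+ 2.

Lemma grad_graph p : grad (graph_fun f) p =
  vec3 (- field2 (p 0 0) (p 0 1)) (field1 (p 0 0) (p 0 1)) 1.
Proof.
have [dx dy _ _] := class_C1 class1.
apply/rowP => i; rewrite !mxE; case: i => -[|[|[|//]]] i3 /=;
  rewrite /frame_der /frame /tnth /=.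
- apply: (@derive_line _ _ (fun s =>
  p 0 2%:R - (s - p 0 0) * (p 0 1 / 2) - f (plane_pt s (p 0 1))) (p 0 0)) => [h|].
    rewrite /graph_fun proj_xyE !mxE /= addrK mulr1 mulr0 add0r.
    by congr (_ - _); ring.
  by have h := dx (p 0 0) (p 0 1); der; rewrite /field2; ring.
- apply: (@derive_line _ _ (fun s =>
  p 0 2%:R + (s - p 0 1) * (p 0 0 / 2) - f (plane_pt (p 0 0) s)) (p 0 1)) => [h|].
    rewrite /graph_fun proj_xyE !mxE /= addrK mulr1 mulr0 add0r.
    by congr (_ - _); ring.
  by have h := dy (p 0 0) (p 0 1); der; rewrite /field1; ring.
- apply: (@derive_line _ _ (fun s => p 0 2%:R + s - f (plane_pt (p 0 0) (p 0 1))) 0) => [h|].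
    rewrite /graph_fun proj_xyE !mxE /= addr0 mulr1 mulr0 !add0r.
    by congr (_ - _); ring.
  by der; ring.
Qed.

Lemma dotp_vec3 (a b c : R) : dotp (vec3 a b c) (vec3 a b c) = a ^+ 2 + b ^+ 2 + c ^+ 2.
Proof. by rewrite /dotp !big_ord_recl big_ord0 !mxE /= addr0 addrA !expr2. Qed.

Lemma scale_vec3 (k a b c : R) : k *: vec3 a b c = vec3 (k * a) (k * b) (k * c).
Proof.
by apply/rowP => i; rewrite !mxE; case: i => -[|[|[|//]]].
Qed.

Lemma projH_vec3 (a b c : R) : projH (vec3 a b c) = vec3 a b 0.
Proof.
by apply/rowP => i; rewrite !mxE; case: i => -[|[|[|//]]].
Qed.

Lemma projH_normal p : exists2 n : R, 0 < n & projH (unit_normal (graph_fun f) p) =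
  vec3 (n^-1 * - field2 (p 0 0) (p 0 1)) (n^-1 * field1 (p 0 0) (p 0 1)) 0.
Proof.
rewrite /unit_normal grad_graph;
  exists (norm2 (vec3 (- field2 (p 0 0) (p 0 1)) (field1 (p 0 0) (p 0 1)) 1)).
  by rewrite sqrtr_gt0 dotp_vec3 ltr_wpDl ?addr_ge0 ?sqr_ge0 ?expr1n.
by rewrite scale_vec3 projH_vec3.
Qed.

Lemma normalH_graph p : normalH (graph_fun f) p =
  vec3 (- field2 (p 0 0) (p 0 1) * (Num.sqrt (e (p 0 0) (p 0 1)))^-1)
    (field1 (p 0 0) (p 0 1) * (Num.sqrt (e (p 0 0) (p 0 1)))^-1) 0.
Proof.
rewrite /normalH; have [n n0 ->] := projH_normal p.
have -> : norm2 (vec3 (n^-1 * - field2 (p 0 0) (p 0 1)) (n^-1 * field1 (p 0 0) (p 0 1)) 0) =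
    n^-1 * Num.sqrt (e (p 0 0) (p 0 1)).
  rewrite /norm2 dotp_vec3 expr0n /= addr0 !exprMn -mulrDr sqrrN addrC.
  by rewrite sqrtrM ?sqr_ge0// sqrtr_sqr gtr0_norm ?invr_gt0// addrC.
rewrite scale_vec3 mulr0 invfM invrK.
by congr (vec3 _ _ _); rewrite mulrACA divff ?gt_eqF// mul1r mulrC.
Qed.

Local Notation bend := (bending field1 field2 (fun x y => 1 / 2 - D2 1 0 x y) (fun x y =>
  - D2 1 1 x y)
  (D2 0 0) (fun x y => 1 / 2 + D2 0 1 x y)).

(** [normalH] does not depend on the third coordinate, so its derivatives along X and Y are partial
    derivatives in the plane. *)
Lemma mean_curvature_graph (p : 'rV[R]_3) : 0 < e (p 0 0) (p 0 1) ->
  mean_curvatureH (graph_fun f) p * Num.sqrt (e (p 0 0) (p 0 1)) ^+ 3 = bend (p 0 0) (p 0 1).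
Proof.
set x := p 0 0; set y := p 0 1 => e0.
have [d1x d1y _ _] := field1_C1; have [d2x d2y _ _] := field2_C1.
have sqrtD (u : R -> R) t d : 0 < u t -> has_der u t d ->
    has_der (fun s => Num.sqrt (u s)) t ((2 * Num.sqrt (u t))^-1 * d).
  by move=> ut ud; apply: der_comp ud; exact: is_derive1_sqrt.
have r0 : 0 < Num.sqrt (e x y) by rewrite sqrtr_gt0.
rewrite /mean_curvatureH divHE.
pose a s := - field2 s y * (Num.sqrt (e s y))^-1.
pose b s := field1 x s * (Num.sqrt (e x s))^-1.
have rx := @sqrtD (e ^~ y) x _ e0 (derD (derX 1 (d1x x y)) (derX 1 (d2x x y))).
have ry := @sqrtD (e x) y _ e0 (derD (derX 1 (d1y x y)) (derX 1 (d2y x y))).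
have aD := derM (derN (d2x x y)) (derV (f := fun s => Num.sqrt (e s y)) (lt0r_neq0 r0) rx).
have bD := derM (d1y x y) (derV (f := fun s => Num.sqrt (e x s)) (lt0r_neq0 r0) ry).
rewrite [frame_der 0 _ _](derive_line (v := frame 0 p) (p := p) _ aD); last first.
  move=> h; rewrite normalH_graph !mxE /=.
  by rewrite mulr1 mulr0 add0r.
rewrite [frame_der 1 _ _](derive_line (v := frame 1 p) (p := p) _ bD); last first.
  move=> h; rewrite normalH_graph !mxE /=.
  by rewrite mulr1 mulr0 add0r.
rewrite /bending; have e2 : Num.sqrt (e x y) ^+ 2 = field1 x y ^+ 2 + field2 x y ^+ 2
  by rewrite sqr_sqrtr// ltW.
move: r0 e2; move: (Num.sqrt (e x y)) => r r0.
move: (1 / 2 + partial 1 _ _) => B2. move: (1 / 2 - partial 0 _ _) => B1.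
move: (partial 0 _ _) (partial 1 _ _) (field1 x y) (field2 x y).
move=> A D F1 F2 e2; transitivity (A * r ^+ 2 - F2 * (F1 * B1 + F2 * A) +
  (D * r ^+ 2 + F1 * (F2 * B2 - F1 * D))); last by rewrite e2; ring.
by field; rewrite gt_eqF.
Qed.

Variable C : R.
Hypothesis C_gt0 : 0 < C.
Hypothesis curvature_ge : forall p : 'rV[R]_3, tgraph f p -> ~ charset f p ->
  C <= `|mean_curvatureH (graph_fun f) p|.

(** The curvature hypothesis, squared so as to be polynomial in the field and its derivatives; at a
    characteristic point the left-hand side is 0. *)
Lemma graph_bend_ge x y : C ^+ 2 * (field1 x y ^+ 2 + field2 x y ^+ 2) ^+ 3 <= bend x y ^+ 2.
Proof.
rewrite -/(e x y); have : 0 <= e x y by rewrite addr_ge0 ?sqr_ge0.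
rewrite le_eqVlt => /predU1P[<-|e0]; first by rewrite expr0n mulr0 sqr_ge0.
pose p := vec3 x y (f (plane_pt x y)).
have px : p 0 0 = x by rewrite !mxE.
have py : p 0 1 = y by rewrite !mxE.
have Sp : tgraph f p by rewrite /tgraph /= proj_xyE px py !mxE.
have /(curvature_ge Sp) Cp : ~ charset f p.
  move=> [_]; have [n n0 ->] := projH_normal p; rewrite px py => n0E.
  have n_neq0 : n^-1 != 0 by rewrite invr_eq0 gt_eqF.
  have /eqP := congr1 (fun v : 'rV[R]_3 => v 0 0) n0E;
    rewrite !mxE /= mulf_eq0 (negPf n_neq0) oppr_eq0 /= => /eqP h2.
  have /eqP := congr1 (fun v : 'rV[R]_3 => v 0 1) n0E;
    rewrite !mxE /= mulf_eq0 (negPf n_neq0) /= => /eqP h1.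
  by move: e0; rewrite /e h1 h2 expr0n /= addr0 ltxx.
have := @mean_curvature_graph p; rewrite px py => /(_ e0) <-.
rewrite exprMn -exprM mulnC exprM sqr_sqrtr ?(ltW e0)//.
rewrite ler_wpM2r ?exprn_ge0 ?(ltW e0)// -[leRHS]real_normK ?num_real//.
by rewrite ler_pXn2r ?nnegrE ?(ltW C_gt0).
Qed.

Lemma no_entire_graph : False.
Proof.
exact: (field_absurd graph_C1 field1_C1 field2_C1 field_div C_gt0 graph_bend_ge).
Qed.

End Graph.

Theorem theorem39 (R : realType) (f : 'rV[R]_2 -> R) (C : R)
  (hf : class_C 2 setT f)
  (hC : 0 < C)
  (hH : forall p : 'rV[R]_3, tgraph f p -> ~ charset f p ->
    C <= `|mean_curvatureH (graph_fun f) p|) :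
  (forall U : set 'rV[R]_3, C1_relcompact_open f U ->
    (C%:E * hausdorff 2 (@proj_xy R @` U)
     <= hausdorff 1 (@proj_xy R @` rel_boundary (tgraph f) U))%E)
  /\
  (forall r : R, 0 < r ->
    C1_relcompact_open f (tgraph f `&` vertical_cylinder r) /\ r <= 2%:R / C).
Proof. by have := no_entire_graph hf hC hH. Qed.
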